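(* Suppose $\psi$ satisfies (A1) and (A2), and that $\mathcal{X}=(x_j)_{j\in\mathbb{Z}}$ is a complete interpolating sequence for $PW_\pi$. Then there are constants $c_1,c_2,c_3,c_4>0$ (independent of $f$) such that for every $f=\sum_{j\in\mathbb{Z}}c_j\psi(\cdot-x_j)\in V(\psi,\mathcal{X})$ with $(c_j)\in\ell_2$, \[ c_1\|(c_j)\|_{\ell_2}\le \|f\|_{L_2(\mathbb{R})}\le c_2\|(c_j)\|_{\ell_2},\qquad c_3\|(f(x_j))\|_{\ell_2}\le\|(c_j)\|_{\ell_2}\le c_4\|(f(x_j))\|_{\ell_2}.\]
   Context: Fourier transform: $\widehat f(\xi)=\frac{1}{\sqrt{2\pi}}\int_{\mathbb{R}}f(x)e^{-i\xi x}\,dx$. $\mathbb{T}=[-\pi,\pi)$. $\|g\|_{W(L_\infty,\ell_1)}:=\sum_{k\in\mathbb{Z}}\|g(\cdot+2\pi k)\|_{L_\infty(\mathbb{T})}$. $PW_\pi=\{f\in L_2(\mathbb{R}):\widehat f=0\text{ a.e. outside }[-\pi,\pi]\}$. A sequence $\mathcal{X}=(x_j)\subset\mathbb{R}$ is a complete interpolating sequence for $PW_\pi$ if for every $(c_j)\in\ell_2$ there is a unique $f\in PW_\pi$ with $f(x_j)=c_j$ for all $j$ (equivalently $(e^{-ix_j\cdot})_j$ is a Riesz basis of $L_2(\mathbb{T})$). $\psi$ satisfies (A1) if $\psi\in L_2(\mathbb{R})$ is positive definite; (A2) if $\widehat\psi\in W(L_\infty,\ell_1)$, $\inf_{\xi\in\mathbb{T}}|\widehat\psi(\xi)|>0$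 and $\sum_{j\neq0}\|\widehat\psi(\cdot+2\pi j)\|_{L_\infty(\mathbb{T})}/\inf_{\xi\in\mathbb{T}}|\widehat\psi(\xi)|<\infty$. $V(\psi,\mathcal{X})$ is the $L_2(\mathbb{R})$-closure of the span of $\{\psi(\cdot-x_j)\}$; every element has the form $\sum_jc_j\psi(\cdot-x_j)$ with $(c_j)\in\ell_2$ (series converging in $L_2$) and is continuous. *)

(* Defs.v *)
From HB Require Import structures.
From mathcomp Require Import all_boot all_order all_algebra.
From mathcomp Require Import all_classical all_reals all_analysis.
From mathcomp Require Import complex.

Set Implicit Arguments.
Unset Strict Implicit.
Unset Printing Implicit Defensive.

Import Order.TTheory GRing.Theory Num.Theory.
Import numFieldNormedType.Exports.

Local Open Scope classical_set_scope.
Local Open Scope ring_scope.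

Section Defs.
Variable R : realType.

Local Notation mu := (@lebesgue_measure R).

Definition cabs2 (z : R[i]) : R := complex.Re z ^+ 2 + complex.Im z ^+ 2.
Definition cmod (z : R[i]) : R := Num.sqrt (cabs2 z).

Definition ccontinuous (f : R -> R[i]) : Prop :=
  continuous (fun x => complex.Re (f x)) /\ continuous (fun x => complex.Im (f x)).

Definition L2norm2 (f : R -> R[i]) : \bar R :=
  (\int[mu]_x (cabs2 (f x))%:E)%E.

Definition L2norm (f : R -> R[i]) : \bar R := sqrte (L2norm2 f).

Definition isL2 (f : R -> R[i]) : Prop :=
  [/\ measurable_fun setT (fun x => complex.Re (f x)),
      measurable_fun setT (fun x => complex.Im (f x)) &
      (L2norm2 f < +oo)%E].

Definition l2norm2 (c : int -> R[i]) : \bar R :=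
  \esum_(j in [set: int]) (cabs2 (c j))%:E.
Definition l2norm (c : int -> R[i]) : \bar R := sqrte (l2norm2 c).
Definition isl2 (c : int -> R[i]) : Prop := (l2norm2 c < +oo)%E.

Definition posdef (psi : R -> R[i]) : Prop :=
  forall (n : nat) (x : 'I_n -> R) (a : 'I_n -> R[i]),
    0 <= \sum_(j < n) \sum_(k < n) a j * (a k)^*%C * psi (x j - x k).

Definition FT_trunc (f : R -> R[i]) (N : nat) (xi : R) : R[i] :=
  let g := fun x => f x * (cos (xi * x) -i* sin (xi * x))%C in
  let I := [set x : R | - N%:R <= x <= N%:R] in
  ((\int[mu]_(x in I) complex.Re (g x)) +i* (\int[mu]_(x in I) complex.Im (g x)))%C
  * ((Num.sqrt (2 * pi))^-1)%:C%C.

(* g is (a representative of) the Fourier(-Plancherel) transform of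
   f in L_2(R): the L_2-limit of the truncated Fourier integrals *)
Definition is_fourier (f g : R -> R[i]) : Prop :=
  isL2 g /\
  forall e : R, 0 < e -> exists N0 : nat, forall N : nat, (N0 <= N)%N ->
    (L2norm2 (fun xi => FT_trunc f N xi - g xi)%R < e%:E)%E.

Definition torus : set R := [set x | - pi <= x < pi].

Definition ess_sup_on (A : set R) (h : R -> R) : \bar R :=
  ereal_inf [set M : \bar R | \forall x \ae mu, A x -> ((h x)%:E <= M)%E].
Definition ess_inf_on (A : set R) (h : R -> R) : \bar R :=
  ereal_sup [set M : \bar R | \forall x \ae mu, A x -> (M <= (h x)%:E)%E].

Definition Linf_T_shift (g : R -> R[i]) (k : int) : \bar R :=
  ess_sup_on torus (fun x => cmod (g (x + 2 * pi * k%:~R))).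

Definition Wnorm (g : R -> R[i]) : \bar R :=
  \esum_(k in [set: int]) Linf_T_shift g k.

Definition A1 (psi : R -> R[i]) : Prop := isL2 psi /\ posdef psi.

Definition A2 (psi : R -> R[i]) : Prop :=
  exists g : R -> R[i], is_fourier psi g /\
    [/\ (Wnorm g < +oo)%E,
        (0 < ess_inf_on torus (fun x => cmod (g x)))%E &
        ((\esum_(k in [set k : int | (k != 0)%R]) Linf_T_shift g k)
           * (ess_inf_on torus (fun x => cmod (g x)))^-1 < +oo)%E].

Definition isPW (f : R -> R[i]) : Prop :=
  [/\ isL2 f, ccontinuous f &
      exists g, is_fourier f g /\
        \forall xi \ae mu, ~ (- pi <= xi <= pi) -> g xi = 0].

Definition CIS (xs : int -> R) : Prop :=
  forall c : int -> R[i], isl2 c ->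
    exists f, [/\ isPW f, (forall j, f (xs j) = c j) &
      forall f', isPW f' -> (forall j, f' (xs j) = c j) -> f' = f].

Definition psum (psi : R -> R[i]) (xs : int -> R) (c : int -> R[i])
    (N : nat) (x : R) : R[i] :=
  \sum_(i < (2 * N).+1)
     c (i%:Z - N%:Z) * psi (x - xs (i%:Z - N%:Z)).

Definition series_L2 (psi : R -> R[i]) (xs : int -> R) (c : int -> R[i])
    (f : R -> R[i]) : Prop :=
  forall e : R, 0 < e -> exists N0 : nat, forall N : nat, (N0 <= N)%N ->
    (L2norm2 (fun x => psum psi xs c N x - f x)%R < e%:E)%E.

End Defs.

(* Main.v *)
Require Import Defs.
From HB Require Import structures.
From mathcomp Require Import all_boot all_order all_algebra.
From mathcomp Require Import all_classical all_reals all_analysis.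
From mathcomp Require Import measurable_realfun.
From mathcomp Require Import zify ring lra.
From mathcomp Require Import complex.
Set Implicit Arguments.
Unset Strict Implicit.
Unset Printing Implicit Defensive.
Import Order.TTheory GRing.Theory Num.Theory.
Import numFieldNormedType.Exports.
Local Open Scope classical_set_scope.
Local Open Scope ring_scope.
Local Notation Re := complex.Re.
Local Notation Im := complex.Im.

(** Write [G] for the Fourier transform of [psi].  It is integrable because it
lies in W(L_oo, l_1), so inversion gives [psi] as the transform of [G], and
positive definiteness, tested against Riemann sums, forces [G >= 0].  For a
finite sum [s = sum_j a_j psi (. - x_j)] put [E t = sum_j a_j exp (- i x_j t)]:
Plancherel gives [||s||^2 = int G^2 |E|^2], while [int G |E|^2] is the
quadratic form of the samples of [s] against the coefficients.  Both integrals
are comparable to [sum |a_j|^2] because of the bounds on [G] over the shifted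
tori and the Riesz bounds for the exponentials.  Of the latter, the lower one
follows from solvability of the interpolation problem through uniform
boundedness; it forces the nodes to be separated, and the upper one then
follows from Plancherel applied to disjointly supported bumps.  Plancherel
itself comes from Poisson regularisation of the autocorrelation. *)

(** * Lebesgue integrals of real functions *)

(** Two features of the data shape the argument. First, [psi] is only an L_2 function, so its
    transform determines it a.e. and single values of [psi] carry no information. Samples are
    therefore computed with the continuous representative [ksc (T G)], and positive definiteness is
    applied only after moving the differences of distinct nodes off the exceptional null set; the
    remaining value [psi 0] is made harmless by its vanishing weight. Secondly, L_2 convergence of
    the series for [f] says nothing about samples by itself; a uniform bound on finite sums by the
    l_2 norm of their coefficients, together with the continuity of [f], turns it into convergence
    at every point.

    The samples of a finite sum pair with coefficients [b] as the G-weighted product of two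
    exponential sums. Taking [b] to be the samples gives the upper sampling bound, taking [b] to be
    the coefficients of the sum gives the lower one.

    Estimates concern squared norms, and the limit is taken through |z + w|^2 <= 2 |z|^2 + 2 |w|^2;
    this is the factor 2 in the final constants. *)

Section RealIntegral.
Variable R : realType.
Local Notation mu := (@lebesgue_measure R).

Definition Lint (f : R -> R) := mu.-integrable [set: R] (EFin \o f).

Lemma Lint_meas (f : R -> R) : Lint f -> measurable_fun [set: R] f.
Proof. by case/integrableP => /measurable_EFinP. Qed.

Lemma Lint_lty (f : R -> R) : measurable_fun [set: R] f ->
  (\int[mu]_x (`|f x|%R)%:E < +oo)%E -> Lint f.
Proof. by move=> mf h; apply/integrableP; split; [exact/measurable_EFinP|]. Qed.

Lemma ge0_Lint (f : R -> R) : measurable_fun [set: R] f -> (forall x, 0 <= f x) ->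
  (\int[mu]_x (f x)%:E < +oo)%E -> Lint f.
Proof.
move=> mf f0 h; apply: Lint_lty => //.
by under eq_integral do rewrite ger0_norm//.
Qed.

Lemma Lint_EFin (f : R -> R) : Lint f -> (\int[mu]_x (f x)%:E)%E = (\int[mu]_x f x)%:E.
Proof. by move=> h; rewrite /Rintegral fineK// integrable_fin_num. Qed.

Lemma Lint0 : Lint (fun=> 0).
Proof. exact: integrable0. Qed.

Lemma LintD (f g : R -> R) : Lint f -> Lint g -> Lint (fun x => f x + g x).
Proof. by move=> hf hg; apply: (integrableD _ hf hg). Qed.

Lemma LintB (f g : R -> R) : Lint f -> Lint g -> Lint (fun x => f x - g x).
Proof. by move=> hf hg; apply: (integrableB _ hf hg). Qed.

Lemma LintZ (k : R) (f : R -> R) : Lint f -> Lint (fun x => k * f x).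
Proof. by move=> hf; apply: (@integrableZl _ _ _ _ _ measurableT k _ hf). Qed.

Lemma LintN (f : R -> R) : Lint f -> Lint (fun x => - f x).
Proof. by move=> hf; apply: (integrableN hf). Qed.

Lemma Lint_norm (f : R -> R) : Lint f -> Lint (fun x => `|f x|).
Proof. by move=> hf; apply: (integrable_norm hf). Qed.

Lemma Lint_le (f g : R -> R) : measurable_fun [set: R] f -> (forall x, `|f x| <= g x) ->
  Lint g -> Lint f.
Proof.
move=> mf fg; apply: le_integrable => //; first exact/measurable_EFinP.
move=> x _ /=; rewrite lee_fin.
by rewrite (le_trans (fg x))// ler_norm.
Qed.

Lemma Lint_bddM (f h : R -> R) M : Lint f -> measurable_fun [set: R] h ->
  (forall x, `|h x| <= M) -> Lint (fun x => f x * h x).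
Proof.
move=> hf mh hM.
apply: (@Lint_le _ (fun x => M * `|f x|)).
- by apply: measurable_funM => //; exact: Lint_meas.
- by move=> x; rewrite normrM mulrC ler_wpM2r.
- exact/LintZ/Lint_norm.
Qed.

Lemma Lint_sum (I : eqType) (s : seq I) (f : I -> R -> R) :
  (forall i, i \in s -> Lint (f i)) -> Lint (fun x => \sum_(i <- s) f i x).
Proof.
elim: s => [|i s ih] h.
  by under eq_fun do rewrite big_nil; exact: Lint0.
under eq_fun do rewrite big_cons.
by apply: LintD; [apply: h; rewrite mem_head|apply: ih => j js; apply: h; rewrite in_cons js orbT].
Qed.

Lemma IntD (f g : R -> R) : Lint f -> Lint g ->
  \int[mu]_x (f x + g x) = \int[mu]_x f x + \int[mu]_x g x.
Proof. by move=> hf hg; apply: RintegralD. Qed.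

Lemma IntB (f g : R -> R) : Lint f -> Lint g ->
  \int[mu]_x (f x - g x) = \int[mu]_x f x - \int[mu]_x g x.
Proof. by move=> hf hg; apply: RintegralB. Qed.

Lemma IntZ (k : R) (f : R -> R) : Lint f -> \int[mu]_x (k * f x) = k * \int[mu]_x f x.
Proof. by move=> hf; apply: RintegralZl. Qed.

Lemma IntN (f : R -> R) : Lint f -> \int[mu]_x (- f x) = - \int[mu]_x f x.
Proof.
move=> hf; rewrite -mulN1r -IntZ//; apply: eq_Rintegral => x _.
by rewrite mulN1r.
Qed.

Lemma Int0 : \int[mu]_x (0 : R) = 0 :> R.
Proof. by rewrite /Rintegral integral0. Qed.

Lemma Int_ge0 (f : R -> R) : (forall x, 0 <= f x) -> 0 <= \int[mu]_x f x.
Proof. by move=> h; apply: Rintegral_ge0. Qed.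

Lemma Int_le (f g : R -> R) : Lint f -> Lint g -> (forall x, f x <= g x) ->
  \int[mu]_x f x <= \int[mu]_x g x.
Proof. by move=> hf hg h; apply: le_Rintegral. Qed.

Lemma Int_norm (f : R -> R) : Lint f -> `|\int[mu]_x f x| <= \int[mu]_x `|f x|.
Proof. by move=> hf; apply: le_normr_Rintegral. Qed.

Lemma Int_sum (I : eqType) (s : seq I) (f : I -> R -> R) :
  (forall i, i \in s -> Lint (f i)) ->
  \int[mu]_x (\sum_(i <- s) f i x) = \sum_(i <- s) \int[mu]_x (f i x).
Proof.
elim: s => [|i s ih] h.
  by under eq_Rintegral do rewrite big_nil; rewrite Int0 big_nil.
under eq_Rintegral do rewrite big_cons.
have h1 : forall j, j \in s -> Lint (f j) by move=> j js; apply: h; rewrite in_cons js orbT.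
rewrite IntD ?ih ?big_cons//; first by apply: h; rewrite mem_head.
exact: Lint_sum.
Qed.

(** Integrability of the limit is part of the conclusion: in [real_plancherel] it supplies the
    dominating function for [Int_DCT]. *)
Lemma Int_fatou (f_ : nat -> R -> R) (f : R -> R) C :
  (forall n, Lint (f_ n)) -> (forall n x, 0 <= f_ n x) ->
  (forall x, (f_ n x) @[n --> \oo] --> f x) ->
  (forall n, \int[mu]_x f_ n x <= C) ->
  Lint f /\ \int[mu]_x f x <= C.
Proof.
move=> If f0 ff fC.
have mf : measurable_fun [set: R] f.
  by apply: (measurable_fun_cvg (fun n => Lint_meas (If n))) => x _; exact: ff.
have fx0 x : 0 <= f x.
  rewrite -(cvg_lim _ (ff x))//; apply: limr_ge; first by apply: cvgP (ff x).
  by apply: nearW => n.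
have key : (\int[mu]_x (f x)%:E <= C%:E)%E.
  have -> : (\int[mu]_x (f x)%:E = \int[mu]_x (limn_einf (fun n => (f_ n x)%:E)))%E.
    apply: eq_integral => x _; apply/esym.
    have h : ((f_ n x)%:E @[n --> \oo] --> (f x)%:E)%E.
      by apply: cvg_EFin; [exact: nearW|exact: ff].
    rewrite is_cvg_limn_einfE; last by apply: cvgP h.
    exact/cvg_lim.
  have hF := @fatou _ _ _ mu _ measurableT (fun n x => (f_ n x)%:E)
    (fun n => iffRL (measurable_EFinP _ _) (Lint_meas (If n)))
    (fun n x _ => f0 n x).
  apply: (le_trans hF); under eq_fun do rewrite Lint_EFin//.
  rewrite limn_einf_lim; apply: lime_le; first exact: is_cvg_einfs.
  apply: nearW => n; apply: ereal_inf_le; exists (\int[mu]_x f_ n x)%:E.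
    by exists n => //=.
  by rewrite lee_fin.
have Lf : Lint f by apply: ge0_Lint => //; exact: le_lt_trans key (ltry _).
by split=> //; rewrite -lee_fin -Lint_EFin.
Qed.

Lemma Int_DCT (f_ : nat -> R -> R) (f g : R -> R) :
  (forall n, measurable_fun [set: R] (f_ n)) ->
  (forall x, (f_ n x) @[n --> \oo] --> f x) -> Lint g ->
  (forall n x, `|f_ n x| <= g x) ->
  Lint f /\ (\int[mu]_x f_ n x) @[n --> \oo] --> \int[mu]_x f x.
Proof.
move=> mf ff Lg fg.
have mf' : measurable_fun [set: R] f.
  by apply: (measurable_fun_cvg (fun n => mf n)) => x _; exact: ff.
have ffE x : ((f_ n x)%:E @[n --> \oo] --> (f x)%:E)%E.
  by apply: cvg_EFin; [exact: nearW|exact: ff].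
have [||||| Lf _ h] := @dominated_convergence _ _ _ mu _ measurableT
  (fun n x => (f_ n x)%:E) (EFin \o f) (EFin \o g).
- by move=> n; apply/measurable_EFinP; exact: mf.
- exact/measurable_EFinP.
- by apply: aeW => x _; exact: ffE.
- exact: Lg.
- by apply: aeW => x n _; rewrite /= lee_fin.
split => //.
rewrite /Rintegral; apply: fine_cvg.
by rewrite fineK; [exact: h|exact: integrable_fin_num].
Qed.

Lemma eq_Lint (f g : R -> R) : f =1 g -> Lint f -> Lint g.
Proof. by move=> /funext ->. Qed.

Lemma eq_Int (f g : R -> R) : f =1 g -> \int[mu]_x f x = \int[mu]_x g x.
Proof. by move=> fg; apply: eq_Rintegral => x _. Qed.

Lemma measurable_shift (a : R) : measurable_fun [set: R] (fun x : R => x + a).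
Proof. by apply: measurable_funD. Qed.

Lemma lebesgue_measure_shift (a : R) (A : set R) : measurable A ->
  pushforward mu (fun x : measurableTypeR R => (x + a) : measurableTypeR R) A = mu A.
Proof.
move=> mA; apply/esym/lebesgue_measure_unique => //=.
  exact: measurable_shift.
move=> _ _ [[b c] /= _ <-].
rewrite /pushforward.
have -> : (fun x : R => x + a) @^-1` `]b, c]%classic = `]b - a, c - a]%classic.
  by apply/seteqP; split=> x /=; rewrite !in_itv/= ltrBlDr lerBrDr.
rewrite !lebesgue_measure_itv/= !lte_fin ltrD2r -!EFinB.
by have -> : c - a - (b - a) = c - b by ring.
Qed.

Lemma Int_preserve (phi : measurableTypeR R -> measurableTypeR R) (f : R -> R) :
  measurable_fun [set: R] phi ->
  (forall A, measurable A -> pushforward mu phi A = mu A) -> Lint f ->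
  Lint (fun x => f (phi x)) /\ \int[mu]_x f (phi x) = \int[mu]_x f x.
Proof.
move=> mphi hphi Lf; have mf := Lint_meas Lf.
have eI (g : R -> \bar R) : (\int[pushforward mu phi]_x g x = \int[mu]_x g x)%E.
  by apply: eq_measure_integral => A mA _; exact: hphi.
have Lc : Lint (fun x => f (phi x)).
  apply: Lint_lty; first exact: measurableT_comp mf mphi.
  have -> : (\int[mu]_x (`|f (phi x)|%R)%:E = \int[pushforward mu phi]_x (`|f x|%R)%:E)%E.
    rewrite ge0_integral_pushforward//.
    by apply/measurable_EFinP; exact: measurableT_comp.
  by rewrite eI; case/integrableP: Lf.
split => //; rewrite /Rintegral; congr fine.
by rewrite -[RHS]eI integral_pushforward//; exact/measurable_EFinP.
Qed.

Lemma Lint_shift (a : R) (f : R -> R) : Lint f -> Lint (fun x => f (x + a)).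
Proof. by case/(Int_preserve (@measurable_shift a) (@lebesgue_measure_shift a)). Qed.

Lemma Int_shift (a : R) (f : R -> R) : Lint f ->
  \int[mu]_x f (x + a) = \int[mu]_x f x.
Proof. by case/(Int_preserve (@measurable_shift a) (@lebesgue_measure_shift a)). Qed.

Lemma Lint_opp (f : R -> R) : Lint f -> Lint (fun x => f (- x)).
Proof. by case/(Int_preserve (@oppr_measurable _ _) (@lebesgue_measureN R)). Qed.

Lemma Int_opp (f : R -> R) : Lint f -> \int[mu]_x f (- x) = \int[mu]_x f x.
Proof. by case/(Int_preserve (@oppr_measurable _ _) (@lebesgue_measureN R)). Qed.

(** The role of [b] is to feed Tonelli: an integrable bound on the inner absolute integrals makes
    [F] integrable on the plane. *)
Lemma Int_fubini (F : R -> R -> R) (b : R -> R) :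
  measurable_fun [set: R * R] (fun z => F z.1 z.2) ->
  (forall x, Lint (F x)) -> (forall y, Lint (F ^~ y)) ->
  (forall y, \int[mu]_x `|F x y| <= b y) -> Lint b ->
  [/\ Lint (fun x => \int[mu]_y F x y), Lint (fun y => \int[mu]_x F x y) &
   \int[mu]_x (\int[mu]_y F x y) = \int[mu]_y (\int[mu]_x F x y)].
Proof.
move=> mF L1 L2 Fb Lb.
have mF' : measurable_fun [set: R * R] (fun z : measurableTypeR R * measurableTypeR R => (F z.1 z.2)%:E).
  exact/measurable_EFinP.
have If : (mu \x mu)%E.-integrable [set: R * R] (fun z : measurableTypeR R * measurableTypeR R => (F z.1 z.2)%:E).
  apply: (@integrable21ltyP _ _ _ _ R mu mu _ mF').2.
  have mG : measurable_fun [set: R] (fun y => (\int[mu]_x `|(F x y)%:E|)%E).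
    apply: (@measurable_fun_fubini_tonelli_G _ _ _ _ _ mu (fun z => `|(F z.1 z.2)%:E|%E)).
      exact: measurableT_comp mF'.
    by move=> z; exact: abse_ge0.
  apply: (@le_lt_trans _ _ (\int[mu]_y (b y)%:E)%E).
    apply: ge0_le_integral => //.
    - by move=> y _; exact: integral_ge0.
    - exact: (measurable_int mu Lb).
    - move=> y _; rewrite -[leLHS]/(\int[mu]_x (`|F x y|%R)%:E)%E.
      by rewrite Lint_EFin ?lee_fin//; exact/Lint_norm.
  by rewrite Lint_EFin// ltry.
have e1 x : (\int[mu]_y (F x y)%:E = (\int[mu]_y F x y)%:E)%E by rewrite Lint_EFin.
have e2 y : (\int[mu]_x (F x y)%:E = (\int[mu]_x F x y)%:E)%E.
  by rewrite (Lint_EFin (L2 y)).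
split.
- have h := integrable_fubini_F If.
  by rewrite /Lint (_ : EFin \o _ = fubini_F mu (fun z => (F z.1 z.2)%:E)) //; apply/funext => x; rewrite /= -e1.
- apply: (@Lint_le _ b) => //.
    apply/measurable_EFinP.
    have h := measurable_fubini_G If.
    by rewrite (_ : EFin \o _ = fubini_G mu (fun z => (F z.1 z.2)%:E)) //; apply/funext => y; rewrite /= -e2.
  by move=> y; rewrite (le_trans _ (Fb y))//; exact: Int_norm (L2 y).
- rewrite {1 3}/Rintegral; congr fine.
  under eq_integral do rewrite -e1.
  under [RHS]eq_integral do rewrite -e2.
  exact: (Fubini If).
Qed.

Lemma Int_fubini_dom (F : R -> R -> R) (a b : R -> R) :
  measurable_fun [set: R * R] (fun z => F z.1 z.2) ->
  Lint a -> Lint b -> (forall x y, `|F x y| <= a x * b y) ->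
  [/\ forall x, Lint (F x), forall y, Lint (F ^~ y),
   Lint (fun x => \int[mu]_y F x y), Lint (fun y => \int[mu]_x F x y) &
   \int[mu]_x (\int[mu]_y F x y) = \int[mu]_y (\int[mu]_x F x y)].
Proof.
move=> mF La Lb Fab.
have L1 x : Lint (F x).
  apply: (@Lint_le _ (fun y => a x * b y)) => //; last exact: LintZ.
  exact: (measurableT_comp mF (measurable_pair1 x)).
have La' y : Lint (fun x => a x * b y).
  by apply: (@eq_Lint (fun x => b y * a x)); [move=> x; rewrite mulrC|exact: LintZ].
have L2 y : Lint (F ^~ y).
  apply: (@Lint_le _ (fun x => a x * b y)) => //.
  exact: (measurableT_comp mF (measurable_pair2 y)).
have [|h1 h2 h3] := @Int_fubini F (fun y => (\int[mu]_x a x) * b y) mF L1 L2 _ (LintZ _ Lb).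
  move=> y; apply: (@le_trans _ _ (\int[mu]_x (a x * b y))).
    by apply: Int_le => //; exact: Lint_norm (L2 y).
  under eq_Int do rewrite mulrC.
  by rewrite IntZ// mulrC.
by split.
Qed.

End RealIntegral.

(** * Plancherel formula via the Poisson kernel *)

Section Poisson.
Variable R : realType.
Local Notation mu := (@lebesgue_measure R).

(** For a nonnegative integrand, convergence of an antiderivative at infinity yields integrability
    and the value together; evenness doubles the half-line integral. *)
Lemma ge0_even_FTC (f F : R -> R) (l : R) :
  (forall x, 0 <= x -> 0 <= f x) -> continuous f ->
  (forall x : R, is_derive x 1 F (f x)) -> F x @[x --> +oo%R] --> l ->
  Lint (fun x => f `|x|) /\ \int[mu]_x f `|x| = 2 * (l - F 0).
Proof.
move=> f0 cf dF Fl.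
have cF : continuous F.
  by move=> x; apply: differentiable_continuous; apply/derivable1_diffP; case: (dF x).
have h : (\int[mu]_x (f `|x|)%:E = (2 * (l - F 0))%:E)%E.
  rewrite (@ge0_symfun_integralT _ (fun x => f `|x|)); first last.
  - by move=> x /=; rewrite normrN.
  - by move=> x; apply: continuous_comp; [exact: norm_continuous|exact: cf].
  - by move=> x; exact: f0.
  rewrite EFinM; congr (_ * _)%E.
  transitivity (\int[mu]_(x in `[0%R, +oo[) (f x)%:E)%E.
    rewrite set_itvcy; apply: eq_integral => x; rewrite inE /= => x0.
    by rewrite ger0_norm.
  rewrite (ge0_continuous_FTC2y (F := F) (l := l)) ?EFinB//.
  - exact: continuous_subspaceT.
  - by apply: cvg_at_right_filter; exact: cF.
  - by move=> x _; rewrite derive1E; case: (dF x).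
split; last by rewrite /Rintegral h.
apply: ge0_Lint.
- apply: continuous_measurable_fun => x.
  by apply: continuous_comp; [exact: norm_continuous|exact: cf].
- by move=> x; exact: f0.
- by rewrite h ltry.
Qed.

(** [expw e] is the Abel summation factor and [poisson e] its Fourier transform, an approximate
    identity of mass 2 pi as [e] tends to 0. *)
Definition expw (e x : R) := expR (- (e * `|x|)).
Definition poisson (e t : R) := 2 * e / (e ^+ 2 + t ^+ 2).

Lemma cvg_expRN (e : R) : 0 < e -> expR (- (e * x)) @[x --> +oo%R] --> (0 : R).
Proof.
move=> e0.
apply: (@cvg_comp _ _ _ (fun x : R => e * x) (fun x => expR (- x)) _ (+oo%R)); last exact: cvgr_expR.
exact: gt0_cvgMry.
Qed.

Lemma Int_expw (e : R) : 0 < e -> Lint (expw e) /\ \int[mu]_x expw e x = 2 / e.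
Proof.
move=> e0.
have e0' : e != 0 by rewrite gt_eqF.
have [||||h1 h2] := @ge0_even_FTC (fun x => expR (- (e * x))) (fun x => - e^-1 * expR (- (e * x))) (- e^-1 * 0).
- by move=> x _; exact: expR_ge0.
- move=> x; apply: continuous_comp; last exact: continuous_expR.
  by apply: cvgN; apply: cvgM; [exact: cvg_cst|exact: cvg_id].
- move=> x; apply: is_derive_eq; rewrite /GRing.scale/=.
  by field.
- by apply: cvgM; [exact: cvg_cst|exact: cvg_expRN].
split=> //.
by rewrite h2 !mulr0 oppr0 expR0 mulr1 sub0r opprK.
Qed.

Lemma Int_expw_cos (e t : R) : 0 < e -> Lint (fun x => expw e x * cos (x * t)) /\
  \int[mu]_x (expw e x * cos (x * t)) = poisson e t.
Proof.
move=> e0.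
have e0' : e != 0 by rewrite gt_eqF.
have et : e ^+ 2 + t ^+ 2 != 0.
  by rewrite gt_eqF// ltr_wpDr ?sqr_ge0// exprn_gt0.
have cE : continuous (fun x => expR (- (e * x))).
  move=> x; apply: continuous_comp; last exact: continuous_expR.
  by apply: cvgN; apply: cvgM; [exact: cvg_cst|exact: cvg_id].
have cC : continuous (fun x : R => cos (x * t)).
  move=> x; apply: continuous_comp; last exact: continuous_cos.
  by apply: cvgM; [exact: cvg_id|exact: cvg_cst].
(* [G] is an antiderivative of exp(- e x) cos(x t). The integrand below carries 1 + cos in place of
   cos so as to be nonnegative; the surplus is [expw e], subtracted at the end. *)
pose G (x : R) := expR (- (e * x)) * (t * sin (x * t) - e * cos (x * t)) / (e ^+ 2 + t ^+ 2).
have [||||h1 h2] := @ge0_even_FTC (fun x => expR (- (e * x)) * (1 + cos (x * t)))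
  (fun x => - e^-1 * expR (- (e * x)) + G x) (- e^-1 * 0 + 0).
- move=> x _; apply: mulr_ge0; first exact: expR_ge0.
  by have := cos_geN1 (x * t); lra.
- move=> x; apply: cvgM; first exact: cE.
  by apply: cvgD; [exact: cvg_cst|exact: cC].
- move=> x; rewrite /G.
  apply: is_derive_eq; rewrite /GRing.scale/=.
  by field; apply/andP.
- apply: cvgD; first by apply: cvgM; [exact: cvg_cst|exact: cvg_expRN].
  apply/norm_cvg0P.
  apply: (@squeeze_cvgr _ _ _ _ (fun=> 0) (fun x : R => (`|t| + e) / (e ^+ 2 + t ^+ 2) * expR (- (e * x)))).
  + apply: nearW => x; rewrite normr_ge0/= /G normrM normrM.
    rewrite (ger0_norm (expR_ge0 _)) -mulrA mulrC ler_wpM2r ?expR_ge0//.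
    rewrite normfV (ger0_norm (x := e ^+ 2 + _)) ?addr_ge0 ?sqr_ge0//.
    rewrite ler_wpM2r ?invr_ge0 ?addr_ge0 ?sqr_ge0//.
    rewrite (le_trans (ler_normB _ _))// !normrM lerD//.
      by rewrite ler_piMr// ler_norml sin_geN1 sin_le1.
    by rewrite (gtr0_norm e0) ler_piMr ?(ltW e0)// ler_norml cos_geN1 cos_le1.
  + exact: cvg_cst.
  + rewrite -[X in _ --> X](mulr0 ((`|t| + e) / (e ^+ 2 + t ^+ 2))).
    by apply: cvgM; [exact: cvg_cst|exact: cvg_expRN].
have [w1 w2] := Int_expw e0.
have eE x : expw e x * cos (x * t) = expR (- (e * `|x|)) * (1 + cos (`|x| * t)) - expw e x.
  rewrite mulrDr mulr1 addrAC subrr add0r; congr (_ * _).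
  by case: (ger0P x) => // _; rewrite mulNr cosN.
split.
  by apply: (@eq_Lint _ _ _ (fsym eE)); exact: LintB.
rewrite (eq_Int eE) IntB// h2 w2 /G /poisson !mulr0 oppr0 expR0 mul0r cos0 sin0.
by field; apply/andP.
Qed.

Lemma poisson_ge0 (e t : R) : 0 < e -> 0 <= poisson e t.
Proof.
by move=> e0; rewrite divr_ge0// ?mulr_ge0 ?addr_ge0 ?sqr_ge0// ltW.
Qed.

Lemma continuous_poisson (e : R) : 0 < e -> continuous (poisson e).
Proof.
move=> e0 x; apply: cvgM; first exact: cvg_cst.
apply: cvgV; first by rewrite gt_eqF// ltr_wpDr ?sqr_ge0// exprn_gt0.
by apply: cvgD; [exact: cvg_cst|exact: exprn_continuous].
Qed.

Lemma Int_poisson (e : R) : 0 < e -> Lint (poisson e) /\ \int[mu]_x poisson e x = 2 * pi.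
Proof.
move=> e0.
have e0' : e != 0 by rewrite gt_eqF.
have [||||h1 h2] := @ge0_even_FTC (poisson e) (fun x => 2 * atan (x * e^-1)) (2 * (pi / 2)).
- by move=> x _; exact: poisson_ge0.
- exact: continuous_poisson.
- move=> x; apply: is_derive_eq; rewrite /GRing.scale/= /poisson.
  field.
  by rewrite !gt_eqF// ltr_wpDr ?sqr_ge0// exprn_gt0.
- apply: cvgM; first exact: cvg_cst.
  apply: (@cvg_comp _ _ _ (fun x : R => x * e^-1) (@atan R) _ (+oo%R)); last exact: cvgy_atan.
  by apply: gt0_cvgMly => //; rewrite invr_gt0.
have eE x : poisson e `|x| = poisson e x by rewrite /poisson real_normK ?num_real.
split; first exact: (eq_Lint eE).
rewrite -(eq_Int eE) h2 mul0r atan0 mulr0 subr0; by field.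
Qed.

End Poisson.

(** * Continuity at 0 of the autocorrelation of a square-integrable function *)

Section Autocorr.
Variable R : realType.
Local Notation mu := (@lebesgue_measure R).
Implicit Types (f g h a b : R -> R).

Lemma Lint_mul_sqr a b : measurable_fun [set: R] a -> measurable_fun [set: R] b ->
  Lint (fun x => a x ^+ 2) -> Lint (fun x => b x ^+ 2) -> Lint (fun x => a x * b x).
Proof.
move=> ma mb La Lb; apply: (@Lint_le _ _ (fun x => a x ^+ 2 + b x ^+ 2)).
- exact: measurable_funM.
- move=> x; rewrite ler_norml; apply/andP; split; nra.
- exact: LintD.
Qed.

(** Weighted arithmetic-geometric mean in place of Cauchy-Schwarz: the weight [s] avoids square
    roots and is chosen at each use. It comes from integrating (s |a| - |b|)^2 / s >= 0. *)
Lemma Int_AMGM a b (s : R) : measurable_fun [set: R] a -> measurable_fun [set: R] b ->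
  Lint (fun x => a x ^+ 2) -> Lint (fun x => b x ^+ 2) -> 0 < s ->
  2 * `|\int[mu]_x (a x * b x)| <= s * \int[mu]_x (a x ^+ 2) + s^-1 * \int[mu]_x (b x ^+ 2).
Proof.
move=> ma mb La Lb s0.
have Lab := Lint_mul_sqr ma mb La Lb.
rewrite -!IntZ// -IntD; [|exact: LintZ|exact: LintZ].
apply: le_trans (_ : \int[mu]_x (2 * `|a x * b x|) <= _).
  by rewrite IntZ ?ler_wpM2l ?Int_norm//; exact: Lint_norm.
apply: Int_le.
- exact/LintZ/Lint_norm.
- by apply: LintD; exact: LintZ.
move=> x; rewrite -subr_ge0.
have -> : s * a x ^+ 2 + s^-1 * b x ^+ 2 - 2 * `|a x * b x| =
  s^-1 * (s * `|a x| - `|b x|) ^+ 2.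
  rewrite normrM sqrrB exprMn !real_normK ?num_real//; field.
  by rewrite gt_eqF.
by rewrite mulr_ge0 ?sqr_ge0// invr_ge0 ltW.
Qed.

Lemma Int_continuous (f : R -> R -> R) g : (forall t, Lint (f t)) ->
  (forall x, continuous (f ^~ x)) -> Lint g -> (forall t x, `|f t x| <= g x) ->
  continuous (fun t => \int[mu]_x f t x).
Proof.
move=> Lf cf Lg fg t.
apply: (@continuity_under_integral R _ _ mu f setT measurableT (t - 1) (t + 1) _ _ g Lg).
- by move=> s _; exact: Lf.
- by apply: aeW => x _ s _; exact: cf.
- by move=> s _; apply: aeW => x _; exact: fg.
- by rewrite inE/= in_itv/= ltrBlDr ltrDl ltr01.
Qed.

(** Both the support and the values are truncated, so that a measurable [h] becomes bounded and
    integrable. *)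
Definition trunc (n : nat) h x := if (`|x| <= n%:R) && (`|h x| <= n%:R) then h x else 0.

Lemma measurable_trunc n h : measurable_fun [set: R] h -> measurable_fun [set: R] (trunc n h).
Proof.
move=> mh; apply: measurable_fun_ifT => //.
apply: measurable_and; apply: measurable_fun_ler => //; exact: measurableT_comp.
Qed.

Lemma trunc_bound n h x : `|trunc n h x| <= n%:R.
Proof. by rewrite /trunc; case: ifPn => [/andP[]|]//; rewrite normr0. Qed.

Lemma trunc_out n h x : n%:R < `|x| -> trunc n h x = 0.
Proof. by rewrite /trunc ltNge => /negbTE ->. Qed.

Lemma sqr_trunc_cvg0 h : measurable_fun [set: R] h -> Lint (fun x => h x ^+ 2) ->
  forall e, 0 < e -> exists n, (Lint (fun x => (h x - trunc n h x) ^+ 2)) /\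
   \int[mu]_x ((h x - trunc n h x) ^+ 2) <= e.
Proof.
move=> mh Lh e e0.
have md n : measurable_fun [set: R] (fun x => (h x - trunc n h x) ^+ 2).
  by apply: measurable_funX; apply: measurable_funB => //; exact: measurable_trunc.
have hb n x : `|(h x - trunc n h x) ^+ 2| <= h x ^+ 2.
  rewrite ger0_norm ?sqr_ge0// /trunc; case: ifP => _; last by rewrite subr0.
  by rewrite subrr expr0n/= sqr_ge0.
have [|_] := @Int_DCT _ (fun n x => (h x - trunc n h x) ^+ 2) (fun=> 0) _ md _ Lh hb.
  move=> x; apply: cvg_near_cst.
  near=> n; rewrite /trunc ifT ?subrr ?expr0n//.
  by apply/andP; split; near: n; exact: nbhs_infty_ger.
rewrite Int0 => /cvgrPdist_le/(_ _ e0)[N _ /(_ N (leqnn N))].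
have I0 : 0 <= \int[mu]_x ((h x - trunc N h x) ^+ 2) by apply: Int_ge0 => x; exact: sqr_ge0.
rewrite sub0r normrN (ger0_norm I0) => h1.
by exists N; split => //; exact: Lint_le (hb N) Lh.
Unshelve. all: by end_near. Qed.

(** The power spectrum [cosT h ^+ 2 + sinT h ^+ 2] is the Fourier transform of this function, whose
    value at 0 is the squared L_2 norm. *)
Definition autocorr h t := \int[mu]_x (h x * h (x - t)).

Lemma Lint_sqr_shift h t : Lint (fun x => h x ^+ 2) -> Lint (fun x => h (x - t) ^+ 2).
Proof. by move=> Lh; exact: (Lint_shift (- t) Lh). Qed.

Lemma Int_sqr_shift h t : Lint (fun x => h x ^+ 2) ->
  \int[mu]_x (h (x - t) ^+ 2) = \int[mu]_x (h x ^+ 2).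
Proof. by move=> Lh; exact: (Int_shift (- t) Lh). Qed.

Lemma measurable_shiftN h t : measurable_fun [set: R] h -> measurable_fun [set: R] (fun x => h (x - t)).
Proof. by move=> mh; exact: (measurableT_comp mh (measurable_shift (- t))). Qed.

Lemma autocorr_bound h t : measurable_fun [set: R] h -> Lint (fun x => h x ^+ 2) ->
  `|autocorr h t| <= \int[mu]_x (h x ^+ 2).
Proof.
move=> mh Lh.
have := Int_AMGM mh (measurable_shiftN t mh) Lh (Lint_sqr_shift t Lh) ltr01.
rewrite Int_sqr_shift// invr1 !mul1r /autocorr; lra.
Qed.

(** Write the difference of products as (h - k) h(. - t) + k (h - k)(. - t). Opposite weights in the
    two uses of [Int_AMGM] put [s] on the norm of [h] and its inverse on that of [h - k]. *)
Lemma autocorr_trunc h (k : R -> R) t (s : R) :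
  measurable_fun [set: R] h -> measurable_fun [set: R] k ->
  Lint (fun x => h x ^+ 2) -> (forall x, `|k x| <= `|h x|) ->
  Lint (fun x => (h x - k x) ^+ 2) -> 0 < s ->
  `|autocorr h t - autocorr k t| <=
    s * \int[mu]_x (h x ^+ 2) + s^-1 * \int[mu]_x ((h x - k x) ^+ 2).
Proof.
move=> mh mk Lh kh Ld s0.
have s0' : 0 < s^-1 by rewrite invr_gt0.
have Lk : Lint (fun x => k x ^+ 2).
  apply: Lint_le Lh; first exact: measurable_funX.
  move=> x; rewrite ger0_norm ?sqr_ge0//.
  by rewrite -real_normK ?num_real// -[leRHS]real_normK ?num_real// lerXn2r ?nnegrE.
have Ikh : \int[mu]_x (k x ^+ 2) <= \int[mu]_x (h x ^+ 2).
  apply: Int_le => // x.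
  by rewrite -real_normK ?num_real// -[leRHS]real_normK ?num_real// lerXn2r ?nnegrE.
have md : measurable_fun [set: R] (fun x => h x - k x) by exact: measurable_funB.
have h1 := Int_AMGM md (measurable_shiftN t mh) Ld (Lint_sqr_shift t Lh) s0'.
have h2 := Int_AMGM mk (measurable_shiftN t md) Lk (Lint_sqr_shift t Ld) s0.
have L1 := Lint_mul_sqr md (measurable_shiftN t mh) Ld (Lint_sqr_shift t Lh).
have L2 := Lint_mul_sqr mk (measurable_shiftN t md) Lk (Lint_sqr_shift t Ld).
have -> : autocorr h t - autocorr k t =
  \int[mu]_x ((h x - k x) * h (x - t)) + \int[mu]_x (k x * (h (x - t) - k (x - t))).
  rewrite -IntD// -IntB; first by apply: eq_Int => x; ring.
    exact: Lint_mul_sqr mh (measurable_shiftN t mh) Lh (Lint_sqr_shift t Lh).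
  exact: Lint_mul_sqr mk (measurable_shiftN t mk) Lk (Lint_sqr_shift t Lk).
apply: (le_trans (ler_normD _ _)).
move: h1 h2; rewrite (Int_sqr_shift t Lh) (Int_sqr_shift t Ld) invrK.
have : s * \int[mu]_x (k x ^+ 2) <= s * \int[mu]_x (h x ^+ 2) by rewrite ler_wpM2l ?(ltW s0).
lra.
Qed.

(** Up to errors uniform for |t| < 1, one factor of h h(. - t) becomes a bounded function of bounded
    support and the other a bounded continuous function; the resulting correlation [B] is continuous
    by dominated convergence. The errors add up to 2 (e/4) + 2 (e/8) + e/8 <= e. *)
Lemma autocorr_continuous0 h : measurable_fun [set: R] h -> Lint (fun x => h x ^+ 2) ->
  forall e, 0 < e -> exists2 d, 0 < d & forall t, `|t| < d ->
   `|autocorr h t - autocorr h 0| <= e.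
Proof.
move=> mh Lh e e0.
set Q := \int[mu]_x (h x ^+ 2).
have Q0 : 0 <= Q by apply: Int_ge0 => x; exact: sqr_ge0.
(* Makes s Q <= e/8; the 1 keeps the denominator positive when [Q] is 0. *)
pose s := e / (8 * (Q + 1)).
have s0 : 0 < s by rewrite divr_gt0 ?mulr_gt0 ?ltr_wpDl.
have sQ : s * Q <= e / 8.
  rewrite /s -subr_ge0.
  have -> : e / 8 - e / (8 * (Q + 1)) * Q = e / (8 * (Q + 1)).
    by field; rewrite gt_eqF// ltr_wpDl.
  by rewrite ltW.
have e8 : 0 < e / 8 by rewrite divr_gt0.
have [n [Ld hd]] := sqr_trunc_cvg0 mh Lh (mulr_gt0 s0 e8).
pose k := trunc n h.
have mk : measurable_fun [set: R] k by exact: measurable_trunc.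
have kh x : `|k x| <= `|h x|.
  by rewrite /k /trunc; case: ifP => // _; rewrite normr0.
have hk t : `|autocorr h t - autocorr k t| <= e / 4.
  have := autocorr_trunc t mh mk Lh kh Ld s0.
  have : s^-1 * \int[mu]_x ((h x - k x) ^+ 2) <= e / 8 by rewrite ler_pdivrMl.
  rewrite -/Q; lra.
(* One more than the radius of the support of [k]: for |x| <= n and |t| < 1 the point x - t stays in
   [E], where [k] is approximated. *)
pose M : R := n.+1%:R.
have M0 : 0 < M by rewrite ltr0n.
pose E := [set` `[- M, M]] : set R.
have mE : measurable E by exact: measurable_itv.
have muE : (mu E < +oo)%E.
  by rewrite /E lebesgue_measure_itv/=; case: ifP => // _; rewrite ltry.
have LE : Lint \1_E by exact: integrable_indic_itv.
have kn x : `|k x| <= n%:R by exact: trunc_bound.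
have k1 x : k x = k x * \1_E x.
  rewrite indicE; case: (boolP (x \in E)); rewrite ?mulr1// => xE.
  rewrite mulr0 /k trunc_out//; rewrite ltNge; apply: contra xE => xn.
  rewrite inE /E/= in_itv/= -ler_norml (le_trans xn)// /M ler_nat//.
have Lk : Lint k.
  apply: (@eq_Lint _ (fun x => \1_E x * k x)); first by move=> x; rewrite mulrC -k1.
  exact: (Lint_bddM LE mk kn).
have LkE : mu.-integrable E (EFin \o k) by exact: (@integrableS _ _ _ mu setT).
have [phi_ [cphi iphi hphi]] := approximation_continuous_integrable mE muE LkE.
have en0 : 0 < e / (8 * M) by rewrite divr_gt0 ?mulr_gt0.
have [phi [cph ph]] : exists phi : R -> R, continuous phi /\
    (\int[mu]_(z in E) `|(k z - phi z)%:E| <= (e / (8 * M))%:E)%E.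
  move/fine_cvgP: hphi => [hf /cvgrPdist_le/(_ _ en0) hc].
  have [N _ hN] : \forall n \near \oo, (\int[mu]_(z in E) `|(k z - phi_ n z)%:E|)%E \is a fin_num
    /\ `|0 - fine (\int[mu]_(z in E) `|(k z - phi_ n z)%:E|)%E| <= e / (8 * M).
    by near=> m; split; near: m; [exact: hf|exact: hc].
  have [h1 h2] := hN N (leqnn N).
  exists (phi_ N); split => //.
  rewrite -(fineK h1) lee_fin; apply: le_trans h2.
  by rewrite sub0r normrN ler_norm.
(* Clipping to [-n, n], where [k] takes its values, makes the approximant bounded without increasing
   its distance to [k]. *)
pose psi x := Num.max (- n%:R) (Num.min n%:R (phi x)).
have n0 : 0 <= n%:R :> R by exact: ler0n.
have cpsi : continuous psi.
  move=> x; apply: (@continuous_max R R (fun=> - n%:R) (fun x => Num.min n%:R (phi x)) x).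
    exact: cvg_cst.
  apply: (@continuous_min R R (fun=> n%:R) phi x); first exact: cvg_cst.
  exact: cph.
have mpsi : measurable_fun [set: R] psi by exact: continuous_measurable_fun.
have psin x : `|psi x| <= n%:R.
  rewrite ler_norml /psi le_max lexx/= ge_max ge_min lexx/=.
  by rewrite andbT; lra.
have kpsi x : `|k x - psi x| <= `|k x - phi x|.
  have := kn x; rewrite ler_norml => /andP[k_1 k_2].
  rewrite /psi; case: (leP n%:R (phi x)) => a1;
    [case: (leP (- n%:R) n%:R) => a2 | case: (leP (- n%:R) (phi x)) => a2];
    have := ler_norm (k x - phi x); have := ler_norm (- (k x - phi x)); rewrite normrN;
    rewrite ler_norml => u1 u2; apply/andP; split; lra.
pose B t := \int[mu]_x (k x * psi (x - t)).
have cB : continuous B.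
  apply: (@Int_continuous (fun t x => k x * psi (x - t)) (fun x => n%:R * `|k x|)).
  - by move=> t; apply: (Lint_bddM Lk (measurable_shiftN t mpsi) (fun x => psin _)).
  - move=> x t; apply: cvgM; first exact: cvg_cst.
    apply: (@continuous_comp _ _ _ (fun t => x - t) psi); last exact: cpsi.
    by apply: cvgB; [exact: cvg_cst|exact: cvg_id].
  - exact/LintZ/Lint_norm.
  - by move=> t x; rewrite normrM mulrC ler_wpM2r.
have Ldk : Lint (fun x => \1_E x * `|k x - psi x|).
  have md : measurable_fun [set: R] (fun x => `|k x - psi x|).
    by apply: measurableT_comp => //; exact: measurable_funB.
  apply: (Lint_bddM (M := n%:R + n%:R) LE md) => x.
  by rewrite normr_id (le_trans (ler_normB _ _))// lerD.
have Idk : \int[mu]_x (\1_E x * `|k x - psi x|) <= e / (8 * M).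
  rewrite -lee_fin -Lint_EFin//; apply: le_trans ph.
  rewrite [leRHS]integral_mkcond/=.
  apply: ge0_le_integral => //.
  - exact: (measurable_int mu Ldk).
  - have mph : measurable_fun [set: R] phi by exact: continuous_measurable_fun.
    have mkp : measurable_fun [set: R] (fun z => `|k z - phi z|).
      by apply: measurableT_comp => //; exact: measurable_funB.
    by apply/(measurable_restrictT _ mE)/measurable_funTS/measurable_EFinP.
  - move=> x _; rewrite /patch indicE; case: ifP => _; rewrite ?mul0r// mul1r lee_fin.
    exact: kpsi.
have kB t : `|t| < 1 -> `|autocorr k t - B t| <= e / 8.
  move=> t1.
  have Lkk : Lint (fun x => k x * k (x - t)).
    exact: (Lint_bddM Lk (measurable_shiftN t mk) (fun x => kn _)).
  have Lkp : Lint (fun x => k x * psi (x - t)).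
    exact: (Lint_bddM Lk (measurable_shiftN t mpsi) (fun x => psin _)).
  rewrite /autocorr /B -IntB//.
  apply: (le_trans (Int_norm (LintB Lkk Lkp))).
  apply: (@le_trans _ _ (\int[mu]_x (M * (\1_E (x - t) * `|k (x - t) - psi (x - t)|)))).
    apply: Int_le.
    - exact/Lint_norm/LintB.
    - exact: LintZ (Lint_shift (- t) Ldk).
    - move=> x; rewrite -mulrBr normrM.
      have nM : n%:R <= M by rewrite ler_nat.
      have [xn|xn] := lerP `|x| n%:R; last first.
        by rewrite /k (trunc_out h xn) normr0 mul0r !mulr_ge0// ltW.
      rewrite indicE mem_set ?mul1r; last first.
        rewrite /E/= in_itv/= -ler_norml (le_trans (ler_normB _ _))//.
        by rewrite /M -natr1 lerD// ltW.
      by rewrite ler_wpM2r// (le_trans (kn _)).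
  rewrite IntZ; last exact: (Lint_shift (- t) Ldk).
  rewrite (Int_shift (- t) Ldk).
  apply: le_trans (_ : M * (e / (8 * M)) <= _); first by rewrite ler_wpM2l// ltW.
  by rewrite le_eqVlt; apply/orP; left; apply/eqP; field; rewrite gt_eqF.
have /cvgrPdist_le/(_ _ e8)/nbhs_ballP[d /= d0 hB] : B t @[t --> 0] --> B 0 by exact: cB.
exists (Num.min d 1); first by rewrite lt_min d0 ltr01.
move=> t; rewrite lt_min => /andP[td t1].
have hBt : `|B 0 - B t| <= e / 8.
  by apply: hB; rewrite /ball/= sub0r normrN.
have := kB t t1; have := kB 0; rewrite normr0 => /(_ ltr01).
have := hk t; have := hk 0; move: hBt.
rewrite !ler_norml; lra.
Unshelve. all: by end_near. Qed.

End Autocorr.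

(** * Plancherel formula for real functions *)

Section RealPlancherel.
Variable R : realType.
Local Notation mu := (@lebesgue_measure R).
Implicit Types (f g h a b : R -> R).

Lemma measurable_fst_comp f : measurable_fun [set: R] f ->
  measurable_fun [set: R * R] (fun z => f z.1).
Proof. by move=> mf; exact: (measurableT_comp mf measurable_fst). Qed.

Lemma measurable_snd_comp f : measurable_fun [set: R] f ->
  measurable_fun [set: R * R] (fun z => f z.2).
Proof. by move=> mf; exact: (measurableT_comp mf measurable_snd). Qed.

Section BoundedKernel.
Variable (w : R -> R).
Hypotheses (cw : continuous w) (w1 : forall x, `|w x| <= 1).

(** [w] stands for the cosine or the sine, so that both transforms are treated at once. *)
Definition kerT h t := \int[mu]_x (h x * w (t * x)).

Let mw : measurable_fun [set: R] w. Proof. exact: continuous_measurable_fun. Qed.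

Lemma measurable_kerM t : measurable_fun [set: R] (fun x => w (t * x)).
Proof. by apply: (measurableT_comp mw); exact: measurable_funM. Qed.

Lemma measurable_ker2 : measurable_fun [set: R * R] (fun z => w (z.1 * z.2)).
Proof. by apply: (measurableT_comp mw); exact: measurable_funM. Qed.

Lemma Lint_ker h t : Lint h -> Lint (fun x => h x * w (t * x)).
Proof. by move=> Lh; exact: (Lint_bddM Lh (measurable_kerM t) (fun x => w1 _)). Qed.

Lemma continuous_kerT h : Lint h -> continuous (kerT h).
Proof.
move=> Lh; apply: (@Int_continuous _ (fun t x => h x * w (t * x)) (fun x => `|h x|)).
- by move=> t; exact: Lint_ker.
- move=> x t; apply: cvgM; first exact: cvg_cst.
  apply: (@continuous_comp R R R (fun t : R => t * x) w t); last exact: cw.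
  by apply: cvgM; [exact: cvg_id|exact: cvg_cst].
- exact: Lint_norm.
- by move=> t x; rewrite normrM ler_piMr.
Qed.

Lemma kerT_bound h t : Lint h -> `|kerT h t| <= \int[mu]_x `|h x|.
Proof.
move=> Lh; apply: (le_trans (Int_norm (Lint_ker t Lh))).
apply: Int_le; [exact/Lint_norm/Lint_ker|exact: Lint_norm|].
by move=> x; rewrite normrM ler_piMr.
Qed.

Lemma kerT_dual a b : Lint a -> Lint b ->
  [/\ Lint (fun t => kerT a t * b t), Lint (fun x => a x * kerT b x) &
  \int[mu]_t (kerT a t * b t) = \int[mu]_x (a x * kerT b x)].
Proof.
move=> La Lb.
have [||||L1 L2 L3 L4 E] := @Int_fubini_dom _ (fun t x => b t * (a x * w (t * x)))
  (fun t => `|b t|) (fun x => `|a x|).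
- apply: measurable_funM; first exact: measurable_fst_comp (Lint_meas Lb).
  by apply: measurable_funM; [exact: measurable_snd_comp (Lint_meas La)|exact: measurable_ker2].
- exact: Lint_norm.
- exact: Lint_norm.
- move=> t x; rewrite normrM; apply: ler_wpM2l; first exact: normr_ge0.
  by rewrite normrM; apply: ler_piMr; [exact: normr_ge0|exact: w1].
have e1 t : \int[mu]_x (b t * (a x * w (t * x))) = kerT a t * b t.
  by rewrite IntZ; [rewrite mulrC|exact: Lint_ker].
have e2 x : \int[mu]_t (b t * (a x * w (t * x))) = a x * kerT b x.
  rewrite /kerT -IntZ; last exact: Lint_ker.
  by apply: eq_Int => t; rewrite mulrCA (mulrC t).
split; [exact: eq_Lint e1 L3|exact: eq_Lint e2 L4|].
by rewrite -(eq_Int e1) E (eq_Int e2).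
Qed.

End BoundedKernel.

Lemma normr_cos_le1 (x : R) : `|cos x| <= 1.
Proof. by rewrite ler_norml cos_geN1 cos_le1. Qed.

Lemma normr_sin_le1 (x : R) : `|sin x| <= 1.
Proof. by rewrite ler_norml sin_geN1 sin_le1. Qed.

Definition cosT := kerT (@cos R).
Definition sinT := kerT (@sin R).

Definition measurable_cosM := measurable_kerM (@continuous_cos R).
Definition measurable_sinM := measurable_kerM (@continuous_sin R).
Definition Lint_cos := Lint_ker (@continuous_cos R) normr_cos_le1.
Definition Lint_sin := Lint_ker (@continuous_sin R) normr_sin_le1.
Definition continuous_cosT := continuous_kerT (@continuous_cos R) normr_cos_le1.
Definition continuous_sinT := continuous_kerT (@continuous_sin R) normr_sin_le1.
Definition cosT_bound := kerT_bound (@continuous_cos R) normr_cos_le1.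
Definition sinT_bound := kerT_bound (@continuous_sin R) normr_sin_le1.
Definition cosT_dual := kerT_dual (@continuous_cos R) normr_cos_le1.
Definition sinT_dual := kerT_dual (@continuous_sin R) normr_sin_le1.

(** Multiplied by [h x] and integrated in [x], the left side becomes the power spectrum and the
    right side a double integral in the difference x - y. *)
Lemma cosT_sinT_addition h t x : Lint h ->
  cos (t * x) * cosT h t + sin (t * x) * sinT h t =
  \int[mu]_y (h y * cos (t * (x - y))).
Proof.
move=> Lh; rewrite -IntZ; last exact: Lint_cos.
rewrite -IntZ; last exact: Lint_sin.
rewrite -IntD; [|exact/LintZ/Lint_cos|exact/LintZ/Lint_sin].
by apply: eq_Int => y; rewrite mulrBr cosB; ring.
Qed.

Lemma poisson_bound (e t : R) : 0 < e -> `|poisson e t| <= 2 / e.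
Proof.
move=> e0; rewrite ger0_norm ?poisson_ge0// /poisson.
have e2 : 0 < e ^+ 2 by rewrite exprn_gt0.
have -> : 2 / e = 2 * e / e ^+ 2 by field; rewrite gt_eqF.
rewrite ler_wpM2l ?mulr_ge0 ?(ltW e0)// lef_pV2 ?posrE ?ltr_wpDr ?sqr_ge0//.
by rewrite lerDl sqr_ge0.
Qed.

(** Write the spectrum as the double integral of h(x) h(y) cos(t (x - y)) and integrate in [t]
    first: the weight [expw e] produces [poisson e (x - y)]. The substitution y = x - t then
    exhibits the autocorrelation. *)
Lemma poisson_autocorr h (e : R) : Lint h -> Lint (fun x => h x ^+ 2) -> 0 < e ->
  [/\ Lint (fun t => expw e t * (cosT h t ^+ 2 + sinT h t ^+ 2)),
   Lint (fun t => poisson e t * autocorr h t) &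
   \int[mu]_t (expw e t * (cosT h t ^+ 2 + sinT h t ^+ 2)) =
   \int[mu]_t (poisson e t * autocorr h t)].
Proof.
move=> Lh Lh2 e0.
have mh := Lint_meas Lh.
have [Lw _] := Int_expw e0.
have mw := Lint_meas Lw.
have w0 t : 0 <= expw e t by exact: expR_ge0.
have mC : measurable_fun [set: R] (cosT h) by exact: continuous_measurable_fun (continuous_cosT Lh).
have mS : measurable_fun [set: R] (sinT h) by exact: continuous_measurable_fun (continuous_sinT Lh).
pose N := \int[mu]_x `|h x|.
have N0 : 0 <= N by exact: Int_ge0.
pose D t x := cos (t * x) * cosT h t + sin (t * x) * sinT h t.
have mD : measurable_fun [set: R * R] (fun z => D z.1 z.2).
  apply: measurable_funD; apply: measurable_funM.
  - exact: measurable_ker2 (@continuous_cos R).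
  - exact: measurable_fst_comp.
  - exact: measurable_ker2 (@continuous_sin R).
  - exact: measurable_fst_comp.
have Db t x : `|D t x| <= 2 * N.
  apply: (le_trans (ler_normD _ _)); rewrite mulr_natl mulr2n; apply: lerD; rewrite normrM.
    by rewrite -[leRHS]mul1r; apply: ler_pM => //; [exact: normr_cos_le1|exact: cosT_bound].
  by rewrite -[leRHS]mul1r; apply: ler_pM => //; [exact: normr_sin_le1|exact: sinT_bound].
have [||||L1 L2 L3 L4 E1] := @Int_fubini_dom _ (fun t x => expw e t * (h x * D t x))
    (expw e) (fun x => 2 * N * `|h x|).
- apply: measurable_funM; first exact: measurable_fst_comp.
  by apply: measurable_funM; [exact: measurable_snd_comp|exact: mD].
- exact: Lw.
- exact/LintZ/Lint_norm.
- move=> t x; rewrite normrM ger0_norm// ler_wpM2l// normrM mulrC ler_wpM2r//.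
have eD t : \int[mu]_x (expw e t * (h x * D t x)) =
    expw e t * (cosT h t ^+ 2 + sinT h t ^+ 2).
  rewrite IntZ; last first.
    apply: (Lint_bddM Lh _ (Db t)).
    exact: (measurableT_comp mD (measurable_pair1 t)).
  congr (_ * _); rewrite !expr2 -!IntZ; [|exact: Lint_sin|exact: Lint_cos].
  rewrite -IntD; [|exact/LintZ/Lint_cos|exact/LintZ/Lint_sin].
  by apply: eq_Int => x; rewrite /D; ring.
have eX x : \int[mu]_t (expw e t * (h x * D t x)) =
    \int[mu]_t (h x * h (x - t) * poisson e t).
  have Lsub : Lint (fun y => h y * poisson e (x - y)).
    apply: (Lint_bddM Lh (M := 2 / e)); last by move=> y; exact: poisson_bound.
    apply: continuous_measurable_fun => y.
    apply: (@continuous_comp R R R (fun y : R => x - y) (poisson e) y); last exact: continuous_poisson.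
    by apply: cvgB; [exact: cvg_cst|exact: cvg_id].
  have LDx : Lint (fun t => expw e t * D t x).
    apply: (Lint_bddM Lw _ (fun t => Db t x)).
    exact: (measurableT_comp mD (measurable_pair2 x)).
  under eq_Int do rewrite mulrCA.
  rewrite (IntZ (h x) LDx).
  have [||||_ _ _ _ E2] := @Int_fubini_dom _ (fun t y => expw e t * (h y * cos (t * (x - y))))
      (expw e) (fun y => `|h y|).
  - apply: measurable_funM; first exact: measurable_fst_comp.
    apply: measurable_funM; first exact: measurable_snd_comp.
    apply: (measurableT_comp (continuous_measurable_fun (@continuous_cos R))).
    apply: measurable_funM; first exact: measurable_fst.
    by apply: measurable_funB => //; exact: measurable_cst.
  - exact: Lw.
  - exact: Lint_norm.
  - move=> t y; rewrite normrM (ger0_norm (w0 t)).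
    apply: ler_wpM2l; first exact: w0.
    rewrite normrM; apply: ler_piMr; [exact: normr_ge0|exact: normr_cos_le1].
  have Lcx t : Lint (fun y => h y * cos (t * (x - y))).
    apply: (Lint_bddM Lh (M := 1)); last by move=> y; exact: normr_cos_le1.
    apply: (measurableT_comp (continuous_measurable_fun (@continuous_cos R))).
    by apply: measurable_funM; [exact: measurable_cst|apply: measurable_funB; [exact: measurable_cst|]].
  have -> : \int[mu]_t (expw e t * D t x) = \int[mu]_y (h y * poisson e (x - y)).
    transitivity (\int[mu]_t (\int[mu]_y (expw e t * (h y * cos (t * (x - y)))))).
      by apply: eq_Int => t; rewrite (IntZ _ (Lcx t)) /D cosT_sinT_addition.
    rewrite E2; apply: eq_Int => y.
    have [Lwc <-] := Int_expw_cos (x - y) e0.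
    by under eq_Int do rewrite mulrCA; rewrite IntZ.
  rewrite -(Int_opp Lsub) -(Int_shift (- x) (Lint_opp Lsub)).
  have Lx : Lint (fun t => h (x - t) * poisson e t).
    apply: eq_Lint (Lint_shift (- x) (Lint_opp Lsub)) => t.
    by congr (h _ * poisson _ _); ring.
  under [RHS]eq_Int do rewrite -mulrA.
  rewrite (IntZ (h x) Lx); congr (_ * _).
  by apply: eq_Int => t; congr (h _ * poisson _ _); ring.
have [LP _] := Int_poisson e0.
have mA t : Lint (fun x => h x * h (x - t)).
  exact: Lint_mul_sqr mh (measurable_shiftN t mh) Lh2 (Lint_sqr_shift t Lh2).
pose Q := \int[mu]_x (h x ^+ 2).
have [|||||L5 L6 E3] := @Int_fubini _ (fun x t => h x * h (x - t) * poisson e t) (fun t => Q * poisson e t).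
- apply: measurable_funM; last exact: measurable_snd_comp (Lint_meas LP).
  apply: measurable_funM; first exact: measurable_fst_comp.
  apply: (measurableT_comp mh).
  by apply: measurable_funB; [exact: measurable_fst|exact: measurable_snd].
- move=> x; apply: (@eq_Lint _ (fun t => h x * (h (x - t) * poisson e t))).
    by move=> t; rewrite mulrA.
  apply: LintZ; apply: (Lint_bddM (M := 2 / e)).
  + apply: eq_Lint (Lint_shift (- x) (Lint_opp Lh)) => t.
    by congr h; ring.
  + exact: Lint_meas LP.
  + by move=> t; exact: poisson_bound.
- move=> t; apply: (@eq_Lint _ (fun x => poisson e t * (h x * h (x - t)))).
    by move=> x; rewrite mulrC.
  exact/LintZ/mA.
- move=> t.
  have -> : \int[mu]_x `|h x * h (x - t) * poisson e t| = poisson e t * \int[mu]_x `|h x * h (x - t)|.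
    rewrite -IntZ; last exact/Lint_norm/mA.
    by apply: eq_Int => x; rewrite normrM mulrC (ger0_norm (poisson_ge0 _ e0)).
  rewrite [leRHS]mulrC; apply: ler_wpM2l; first exact: poisson_ge0.
  (* The inner absolute integral is the autocorrelation of |h|, which [autocorr_bound] controls by
     [Q]. *)
  have mn : measurable_fun [set: R] (fun x => `|h x|) by exact: measurableT_comp.
  have Ln : Lint (fun x => `|h x| ^+ 2).
    by apply: eq_Lint Lh2 => x; rewrite real_normK ?num_real.
  have := autocorr_bound t mn Ln; rewrite /autocorr ger0_norm; last first.
    by apply: Int_ge0 => x; rewrite mulr_ge0.
  under eq_Int do rewrite -normrM.
  have -> : \int[mu]_x (`|h x| ^+ 2) = Q.
    by apply: eq_Int => x; rewrite (real_normK (num_real _)).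
  exact: id.
- exact: LintZ.
split.
- exact: eq_Lint eD L3.
- apply: eq_Lint L6 => t; rewrite /autocorr -IntZ; last exact: mA.
  by apply: eq_Int => x; rewrite mulrC.
- rewrite -(eq_Int eD) E1 (eq_Int eX) E3; apply: eq_Int => t.
  rewrite /autocorr -IntZ; last exact: mA.
  by apply: eq_Int => x; rewrite mulrC.
Qed.

(** Away from 0 the kernel is O(e) times [poisson 1], whose integral is known. The constant comes
    from 1 + t^2 <= (1 + d^-2) t^2 for |t| >= d. *)
Lemma poisson_tail (d : R) : 0 < d -> exists2 C : R, 0 < C &
  forall e t, 0 < e -> d <= `|t| -> poisson e t <= C * e * poisson 1 t.
Proof.
move=> d0; exists (1 + d^-1 ^+ 2); first by rewrite ltr_wpDr ?sqr_ge0.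
move=> e t e0 dt; rewrite /poisson.
have d2 : 0 < d ^+ 2 by rewrite exprn_gt0.
have t2 : d ^+ 2 <= t ^+ 2.
  by rewrite -[leRHS](real_normK (num_real _)) lerXn2r// nnegrE// ltW.
have t20 : 0 < t ^+ 2 by apply: lt_le_trans t2.
have e2 : 0 < e ^+ 2 by rewrite exprn_gt0.
have -> : (1 + d^-1 ^+ 2) * e * (2 * 1 / (1 ^+ 2 + t ^+ 2)) = 2 * e * ((1 + d^-1 ^+ 2) / (1 ^+ 2 + t ^+ 2)).
  by ring.
apply: ler_wpM2l; first by rewrite mulr_ge0// ltW.
rewrite expr1n ler_pdivlMr ?addr_gt0// mulrC ler_pdivrMr ?addr_gt0//.
have : 1 <= d^-1 ^+ 2 * t ^+ 2 by rewrite exprVn ler_pdivlMl// mulr1.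
have : 0 <= d^-1 ^+ 2 by exact: sqr_ge0.
nra.
Qed.

Lemma poisson_approx_id h : measurable_fun [set: R] h -> Lint (fun x => h x ^+ 2) ->
  (forall e, 0 < e -> Lint (fun t => poisson e t * autocorr h t)) ->
  \int[mu]_t (poisson n.+1%:R^-1 t * autocorr h t) @[n --> \oo] --> 2 * pi * autocorr h 0.
Proof.
move=> mh Lh LA; apply/cvgrPdist_le => eps eps0.
pose Q := \int[mu]_x (h x ^+ 2).
have Q0 : 0 <= Q by apply: Int_ge0 => x; exact: sqr_ge0.
have pi0 := pi_gt0 R.
(* The kernel has mass 2 pi, so this tolerance near 0 contributes eps/2; the tail contributes at
   most eps/2 for large [n]. *)
have eta0 : 0 < eps / (4 * pi) by rewrite divr_gt0// mulr_gt0.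
have [d d0 hd] := autocorr_continuous0 mh Lh eta0.
have [C C0 hC] := poisson_tail d0.
have Ap t : `|autocorr h t - autocorr h 0| <= 2 * Q.
  apply: (le_trans (ler_normB _ _)); rewrite mulr_natl mulr2n.
  by apply: lerD; exact: autocorr_bound.
near=> n.
set e := n.+1%:R^-1.
have e0 : 0 < e by rewrite invr_gt0 ltr0n.
have [LP IP] := Int_poisson e0.
have [LP1 IP1] := Int_poisson (@ltr01 R).
have -> : 2 * pi * autocorr h 0 = \int[mu]_t (autocorr h 0 * poisson e t).
  by rewrite (IntZ _ LP) IP mulrC.
rewrite distrC -IntB; [|exact: LA|exact: LintZ].
apply: (le_trans (Int_norm (LintB (LA e e0) (LintZ _ LP)))).
apply: (@le_trans _ _ (\int[mu]_t (eps / (4 * pi) * poisson e t + 2 * Q * (C * e) * poisson 1 t))).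
  apply: Int_le.
  - by apply/Lint_norm/LintB; [exact: LA|exact: LintZ].
  - by apply: LintD; exact: LintZ.
  move=> t.
  have -> : poisson e t * autocorr h t - autocorr h 0 * poisson e t =
    poisson e t * (autocorr h t - autocorr h 0) by ring.
  have p0 := poisson_ge0 t e0.
  have p10 := poisson_ge0 t (@ltr01 R).
  rewrite normrM (ger0_norm p0).
  have [td|td] := ltP `|t| d.
    rewrite mulrC; apply: ler_wpDr.
      by apply: mulr_ge0 p10; rewrite !mulr_ge0// ltW.
    by apply: ler_wpM2r => //; exact: hd.
  apply: ler_wpDl; first by apply: mulr_ge0 => //; exact: ltW.
  have -> : 2 * Q * (C * e) * poisson 1 t = (C * e * poisson 1 t) * (2 * Q) by ring.
  by apply: ler_pM => //; exact: hC.
rewrite IntD; [|exact: LintZ|exact: LintZ].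
rewrite (IntZ _ LP) (IntZ _ LP1) IP IP1.
have pin0 : pi != 0 :> R by rewrite gt_eqF.
have -> : eps / (4 * pi) * (2 * pi) = eps / 2.
  by move: pin0; move: (pi) => p p0; field.
have : 2 * Q * (C * e) * (2 * pi) <= eps / 2; last lra.
have -> : 2 * Q * (C * e) * (2 * pi) = 4 * Q * C * pi * e by ring.
rewrite /e ler_pdivrMr ?ltr0n// -ler_pdivrMl ?divr_gt0//.
apply: (@le_trans _ _ n%:R); last by rewrite ler_nat.
by near: n; exact: nbhs_infty_ger.
Unshelve. all: by end_near. Qed.

(** Let the parameter of [poisson_autocorr] tend to 0. Fatou and the bound on the autocorrelation
    make the spectrum integrable; it then dominates its own regularisations, whose integrals
    converge to its integral, while the Poisson side converges to 2 pi times the autocorrelation at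
    0. *)
Theorem real_plancherel h : Lint h -> Lint (fun x => h x ^+ 2) ->
  Lint (fun t => cosT h t ^+ 2 + sinT h t ^+ 2) /\
  \int[mu]_t (cosT h t ^+ 2 + sinT h t ^+ 2) = 2 * pi * \int[mu]_x (h x ^+ 2).
Proof.
move=> Lh Lh2.
have mh := Lint_meas Lh.
pose G t := cosT h t ^+ 2 + sinT h t ^+ 2.
have G0 t : 0 <= G t by rewrite addr_ge0 ?sqr_ge0.
pose e n : R := n.+1%:R^-1.
have e0 n : 0 < e n by rewrite invr_gt0 ltr0n.
pose F n t := expw (e n) t * G t.
have cvgF t : F n t @[n --> \oo] --> G t.
  have cvg_en : - (e n * `|t|) @[n --> \oo] --> (0 : R).
    have -> : (0 : R) = - (0 * `|t|) by rewrite mul0r oppr0.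
    by apply: cvgN; apply: cvgM; [exact: cvg_harmonic|exact: cvg_cst].
  rewrite -[X in _ --> X]mul1r -expR0.
  apply: cvgM; last exact: cvg_cst.
  apply: (@cvg_comp _ _ _ (fun n => - (e n * `|t|)) (@expR R) _ (nbhs (0 : R))); last exact: continuous_expR.
  exact: cvg_en.
have LF n : Lint (F n) by have [] := poisson_autocorr Lh Lh2 (e0 n).
have LA u : 0 < u -> Lint (fun t => poisson u t * autocorr h t).
  by move=> u0; have [] := poisson_autocorr Lh Lh2 u0.
have IF n : \int[mu]_t F n t = \int[mu]_t (poisson (e n) t * autocorr h t).
  by have [] := poisson_autocorr Lh Lh2 (e0 n).
have F0 n t : 0 <= F n t by apply: mulr_ge0 => //; exact: expR_ge0.
have [|LG _] := Int_fatou LF F0 cvgF (C := 2 * pi * \int[mu]_x (h x ^+ 2)).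
  move=> n; rewrite IF; have [LP IP] := Int_poisson (e0 n).
  rewrite -IP mulrC -IntZ//; apply: Int_le; [exact: LA|exact: LintZ|].
  move=> t; rewrite mulrC; apply: ler_wpM2r; first exact: poisson_ge0.
  exact: le_trans (ler_norm _) (autocorr_bound t mh Lh2).
split => //.
have [|_ cI] := Int_DCT (fun n => Lint_meas (LF n)) cvgF LG.
  move=> n t; rewrite (ger0_norm (F0 n t)) ler_piMl//.
  rewrite -expR0 ler_expR oppr_le0; apply: mulr_ge0 => //; exact: ltW.
have cJ := poisson_approx_id mh Lh2 LA.
have -> : \int[mu]_x (h x ^+ 2) = autocorr h 0.
  by apply: eq_Int => x; rewrite subr0 expr2.
move: cI; rewrite (funext IF) => cI.
exact: (cvg_unique _ cI cJ).
Qed.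

End RealPlancherel.

(** * Complex-valued functions *)

Section ComplexAlg.
Variable R : realType.
Local Notation mu := (@lebesgue_measure R).
Implicit Types (z w : R[i]) (f g h : R -> R[i]).

Lemma cplx_ext z w : Re z = Re w -> Im z = Im w -> z = w.
Proof. by case: z w => [a b] [c d] /= -> ->. Qed.

Lemma ReD z w : Re (z + w) = Re z + Re w. Proof. by case: z w => [a b] [c d]. Qed.
Lemma ImD z w : Im (z + w) = Im z + Im w. Proof. by case: z w => [a b] [c d]. Qed.
Lemma ReN z : Re (- z) = - Re z. Proof. by case: z. Qed.
Lemma ImN z : Im (- z) = - Im z. Proof. by case: z. Qed.
Lemma ReB z w : Re (z - w) = Re z - Re w. Proof. by rewrite ReD ReN. Qed.
Lemma ImB z w : Im (z - w) = Im z - Im w. Proof. by rewrite ImD ImN. Qed.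
Lemma ReM z w : Re (z * w) = Re z * Re w - Im z * Im w. Proof. by case: z w => [a b] [c d]. Qed.
Lemma ImM z w : Im (z * w) = Re z * Im w + Im z * Re w.
Proof. by case: z w => [a b] [c d] /=. Qed.
Lemma Reconj z : Re z^*%C = Re z. Proof. by case: z. Qed.
Lemma Imconj z : Im z^*%C = - Im z. Proof. by case: z. Qed.
Definition ReImE := (ReD, ImD, ReN, ImN, ReM, ImM, Reconj, Imconj).

Lemma Re_sum (I : Type) (s : seq I) (P : pred I) (F : I -> R[i]) :
  Re (\sum_(i <- s | P i) F i) = \sum_(i <- s | P i) Re (F i).
Proof. by elim/big_rec2: _ => // i x y _ <-; rewrite ReD. Qed.
Lemma Im_sum (I : Type) (s : seq I) (P : pred I) (F : I -> R[i]) :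
  Im (\sum_(i <- s | P i) F i) = \sum_(i <- s | P i) Im (F i).
Proof. by elim/big_rec2: _ => // i x y _ <-; rewrite ImD. Qed.

Lemma cabs2E z : cabs2 z = Re z ^+ 2 + Im z ^+ 2. Proof. by []. Qed.
Lemma cabs2_ge0 z : 0 <= cabs2 z. Proof. by rewrite addr_ge0 ?sqr_ge0. Qed.
Lemma cabs2M z w : cabs2 (z * w) = cabs2 z * cabs2 w.
Proof. by rewrite !cabs2E ReM ImM; ring. Qed.
Lemma cabs2N z : cabs2 (- z) = cabs2 z.
Proof. by rewrite !cabs2E ReN ImN !sqrrN. Qed.
Lemma cabs20 : cabs2 (0 : R[i]) = 0.
Proof. by rewrite cabs2E /= expr0n/= addr0. Qed.
Lemma cabs2_eq0 z : cabs2 z = 0 -> z = 0.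
Proof.
move=> /eqP; rewrite cabs2E paddr_eq0 ?sqr_ge0// !sqrf_eq0 => /andP[/eqP a /eqP b].
exact: cplx_ext.
Qed.
Lemma cabs2D_le z w : cabs2 (z + w) <= 2 * cabs2 z + 2 * cabs2 w.
Proof.
rewrite !cabs2E ReD ImD -subr_ge0.
have -> : 2 * (Re z ^+ 2 + Im z ^+ 2) + 2 * (Re w ^+ 2 + Im w ^+ 2) -
  ((Re z + Re w) ^+ 2 + (Im z + Im w) ^+ 2) = (Re z - Re w) ^+ 2 + (Im z - Im w) ^+ 2 by ring.
by rewrite addr_ge0 ?sqr_ge0.
Qed.
Lemma cabs2B_le z w : cabs2 (z - w) <= 2 * cabs2 z + 2 * cabs2 w.
Proof. by rewrite -(cabs2N w) cabs2D_le. Qed.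
Lemma Re_sqr_le z : Re z ^+ 2 <= cabs2 z. Proof. by rewrite lerDl sqr_ge0. Qed.
Lemma Im_sqr_le z : Im z ^+ 2 <= cabs2 z. Proof. by rewrite lerDr sqr_ge0. Qed.
(** Turns a bound on [cabs2] into one on the components without square roots; it is applied where
    only boundedness matters. *)
Lemma normr_le_sqr1 (a : R) : `|a| <= 1 + a ^+ 2.
Proof.
rewrite -[a ^+ 2](real_normK (num_real a)); have := normr_ge0 a; nra.
Qed.

Definition cis (t : R) : R[i] := (cos t +i* sin t)%C.
Lemma cisD s t : cis (s + t) = cis s * cis t.
Proof. by apply: cplx_ext; rewrite ?ReM ?ImM /= ?cosD ?sinD//; ring. Qed.
Lemma conj_cis t : (cis t)^*%C = cis (- t).
Proof. by apply: cplx_ext => /=; rewrite ?cosN ?sinN. Qed.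
Lemma cabs2_cis t : cabs2 (cis t) = 1.
Proof. by rewrite cabs2E /= cos2Dsin2. Qed.

Definition cmeas f := measurable_fun [set: R] (fun x => Re (f x)) /\
  measurable_fun [set: R] (fun x => Im (f x)).
Definition cLint f := Lint (fun x => Re (f x)) /\ Lint (fun x => Im (f x)).
Definition cI f : R[i] := ((\int[mu]_x Re (f x)) +i* (\int[mu]_x Im (f x)))%C.

Lemma cLint_meas f : cLint f -> cmeas f.
Proof. by case=> a b; split; exact: Lint_meas. Qed.

Lemma cmeasD f g : cmeas f -> cmeas g -> cmeas (fun x => f x + g x).
Proof.
move=> [f1 f2] [g1 g2]; split.
  by under eq_fun do rewrite ReD; exact: measurable_funD.
by under eq_fun do rewrite ImD; exact: measurable_funD.
Qed.

Lemma cmeasN f : cmeas f -> cmeas (fun x => - f x).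
Proof.
move=> [f1 f2]; split.
  by under eq_fun do rewrite ReN; exact: (measurableT_comp (@oppr_measurable _ _) f1).
by under eq_fun do rewrite ImN; exact: (measurableT_comp (@oppr_measurable _ _) f2).
Qed.

Lemma cmeasB f g : cmeas f -> cmeas g -> cmeas (fun x => f x - g x).
Proof. by move=> mf mg; exact: cmeasD mf (cmeasN mg). Qed.

Lemma cmeasM f g : cmeas f -> cmeas g -> cmeas (fun x => f x * g x).
Proof.
move=> [f1 f2] [g1 g2]; split.
  under eq_fun do rewrite ReM; apply: measurable_funB; exact: measurable_funM.
under eq_fun do rewrite ImM; apply: measurable_funD; exact: measurable_funM.
Qed.

Lemma cmeas_cst c : cmeas (fun=> c).
Proof. by split; exact: measurable_cst. Qed.

Lemma cmeas_cis t : cmeas (fun x => cis (t * x)).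
Proof. by split; [exact: measurable_cosM|exact: measurable_sinM]. Qed.

Lemma cmeas_real (f : R -> R) : measurable_fun [set: R] f -> cmeas (fun x => (f x)%:C%C).
Proof. by move=> mf; split => //; exact: measurable_cst. Qed.

Lemma measurable_cabs2 f : cmeas f -> measurable_fun [set: R] (fun x => cabs2 (f x)).
Proof. by move=> [f1 f2]; apply: measurable_funD; exact: measurable_funX. Qed.

Lemma cmeas_sum (I : eqType) (s : seq I) (F : I -> R -> R[i]) :
  (forall i, i \in s -> cmeas (F i)) -> cmeas (fun x => \sum_(i <- s) F i x).
Proof.
elim: s => [|i s ih] h; first by under eq_fun do rewrite big_nil; exact: cmeas_cst.
under eq_fun do rewrite big_cons.
apply: cmeasD; first by apply: h; rewrite mem_head.
by apply: ih => j js; apply: h; rewrite in_cons js orbT.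
Qed.

Lemma cLintD f g : cLint f -> cLint g -> cLint (fun x => f x + g x).
Proof.
move=> [f1 f2] [g1 g2]; split.
  by under eq_fun do rewrite ReD; exact: LintD.
by under eq_fun do rewrite ImD; exact: LintD.
Qed.

Lemma cLint_bdd f h (M : R) : cLint f -> cmeas h -> (forall x, cabs2 (h x) <= M) ->
  cLint (fun x => f x * h x).
Proof.
move=> [f1 f2] [m1 m2] hM.
have b1 x : `|Re (h x)| <= 1 + M.
  by apply: (le_trans (normr_le_sqr1 _)); rewrite lerD2l (le_trans (Re_sqr_le _)).
have b2 x : `|Im (h x)| <= 1 + M.
  by apply: (le_trans (normr_le_sqr1 _)); rewrite lerD2l (le_trans (Im_sqr_le _)).
split.
  under eq_fun do rewrite ReM.
  by apply: LintB; [exact: Lint_bddM f1 m1 b1|exact: Lint_bddM f2 m2 b2].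
under eq_fun do rewrite ImM.
by apply: LintD; [exact: Lint_bddM f1 m2 b2|exact: Lint_bddM f2 m1 b1].
Qed.

Lemma cLintZ c f : cLint f -> cLint (fun x => c * f x).
Proof.
move=> Lf; have := cLint_bdd Lf (cmeas_cst c) (fun=> lexx _).
by congr (cLint _); apply/funext => x; rewrite mulrC.
Qed.

Lemma cLint_cis f t : cLint f -> cLint (fun x => f x * cis (t * x)).
Proof.
move=> Lf; apply: (cLint_bdd Lf (cmeas_cis t) (M := 1)).
by move=> x; rewrite cabs2_cis.
Qed.

Lemma cLint_sum (I : eqType) (s : seq I) (F : I -> R -> R[i]) :
  (forall i, i \in s -> cLint (F i)) -> cLint (fun x => \sum_(i <- s) F i x).
Proof.
move=> h; split.
  under eq_fun do rewrite Re_sum.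
  by apply: (Lint_sum (f := fun i x => Re (F i x))) => i /h [].
under eq_fun do rewrite Im_sum.
by apply: (Lint_sum (f := fun i x => Im (F i x))) => i /h [].
Qed.

Lemma eq_cI f g : f =1 g -> cI f = cI g.
Proof. by move=> /funext ->. Qed.

Lemma cID f g : cLint f -> cLint g -> cI (fun x => f x + g x) = cI f + cI g.
Proof.
move=> [f1 f2] [g1 g2]; apply: cplx_ext; rewrite ?ReD ?ImD /=.
  by rewrite -IntD//; apply: eq_Int => x; rewrite ReD.
by rewrite -IntD//; apply: eq_Int => x; rewrite ImD.
Qed.

Lemma cIZ c f : cLint f -> cI (fun x => c * f x) = c * cI f.
Proof.
move=> [f1 f2]; apply: cplx_ext; rewrite ?ReM ?ImM /=.
  rewrite -(IntZ _ f1) -(IntZ _ f2) -IntB; [|exact: LintZ|exact: LintZ].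
  by apply: eq_Int => x; rewrite ReM.
rewrite -(IntZ _ f1) -(IntZ _ f2) -IntD; [|exact: LintZ|exact: LintZ].
by apply: eq_Int => x; rewrite ImM.
Qed.

Lemma cI_sum (I : eqType) (s : seq I) (F : I -> R -> R[i]) :
  (forall i, i \in s -> cLint (F i)) ->
  cI (fun x => \sum_(i <- s) F i x) = \sum_(i <- s) cI (F i).
Proof.
move=> h; apply: cplx_ext; rewrite ?Re_sum ?Im_sum /=.
  rewrite -(Int_sum (f := fun i x => Re (F i x))); last by move=> i /h [].
  by apply: eq_Int => x; rewrite Re_sum.
rewrite -(Int_sum (f := fun i x => Im (F i x))); last by move=> i /h [].
by apply: eq_Int => x; rewrite Im_sum.
Qed.

Definition sL2 f := cmeas f /\ Lint (fun x => cabs2 (f x)).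
Definition n2 f := \int[mu]_x cabs2 (f x).
(** The real part of the Hermitian product, which suffices for polarisation and for recovering
    [n2]. *)
Definition ip f g := \int[mu]_x (Re (f x) * Re (g x) + Im (f x) * Im (g x)).

Lemma n2_ge0 f : 0 <= n2 f. Proof. by apply: Int_ge0 => x; exact: cabs2_ge0. Qed.

Lemma isL2P f : isL2 f <-> sL2 f.
Proof.
split.
  move=> [m1 m2 h]; split=> //; apply: ge0_Lint => //.
    exact: measurable_cabs2.
  by move=> x; exact: cabs2_ge0.
move=> [[m1 m2] L]; split=> //.
by rewrite /L2norm2 (Lint_EFin L) ltry.
Qed.

Lemma L2norm2E f : sL2 f -> L2norm2 f = (n2 f)%:E.
Proof. by move=> [_ L]; rewrite /L2norm2 (Lint_EFin L). Qed.

Lemma sL2_le f (b : R -> R) : cmeas f -> Lint b -> (forall x, cabs2 (f x) <= b x) -> sL2 f.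
Proof.
move=> mf Lb fb; split => //; apply: (@Lint_le _ _ b) => //.
  exact: measurable_cabs2.
by move=> x; rewrite ger0_norm ?cabs2_ge0.
Qed.

Lemma sL2D f g : sL2 f -> sL2 g -> sL2 (fun x => f x + g x).
Proof.
move=> [mf Lf] [mg Lg].
apply: (@sL2_le _ (fun x => 2 * cabs2 (f x) + 2 * cabs2 (g x))).
- exact: cmeasD.
- by apply: LintD; exact: LintZ.
- by move=> x; exact: cabs2D_le.
Qed.

Lemma sL2N f : sL2 f -> sL2 (fun x => - f x).
Proof.
move=> [mf Lf]; split; first exact: cmeasN.
by under eq_fun do rewrite cabs2N.
Qed.

Lemma sL2B f g : sL2 f -> sL2 g -> sL2 (fun x => f x - g x).
Proof. by move=> Lf Lg; exact: sL2D Lf (sL2N Lg). Qed.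

Lemma sL2_bdd f h (M : R) : sL2 f -> cmeas h -> (forall x, cabs2 (h x) <= M) ->
  sL2 (fun x => f x * h x).
Proof.
move=> [mf Lf] mh hM; apply: (@sL2_le _ (fun x => M * cabs2 (f x))).
- exact: cmeasM.
- exact: LintZ.
- by move=> x; rewrite cabs2M mulrC ler_wpM2r// cabs2_ge0.
Qed.

Lemma sL2Z c f : sL2 f -> sL2 (fun x => c * f x).
Proof.
move=> Lf; have := sL2_bdd Lf (cmeas_cst c) (fun=> lexx _).
by congr (sL2 _); apply/funext => x; rewrite mulrC.
Qed.

Lemma sL2_Re f : sL2 f -> Lint (fun x => Re (f x) ^+ 2).
Proof.
move=> [[m1 m2] L]; apply: Lint_le L; first exact: measurable_funX.
by move=> x; rewrite ger0_norm ?sqr_ge0// Re_sqr_le.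
Qed.

Lemma sL2_Im f : sL2 f -> Lint (fun x => Im (f x) ^+ 2).
Proof.
move=> [[m1 m2] L]; apply: Lint_le L; first exact: measurable_funX.
by move=> x; rewrite ger0_norm ?sqr_ge0// Im_sqr_le.
Qed.

Lemma n2E f : sL2 f -> n2 f = \int[mu]_x (Re (f x) ^+ 2) + \int[mu]_x (Im (f x) ^+ 2).
Proof. by move=> L; rewrite -IntD//; [exact: sL2_Re|exact: sL2_Im]. Qed.

Lemma Lint_ip f g : sL2 f -> sL2 g -> Lint (fun x => Re (f x) * Re (g x) + Im (f x) * Im (g x)).
Proof.
move=> Lf Lg; have [[f1 f2] _] := Lf; have [[g1 g2] _] := Lg.
by apply: LintD; apply: Lint_mul_sqr => //; [exact: sL2_Re|exact: sL2_Re|exact: sL2_Im|exact: sL2_Im].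
Qed.

Lemma ip_AMGM f g (s : R) : sL2 f -> sL2 g -> 0 < s ->
  2 * `|ip f g| <= s * n2 f + s^-1 * n2 g.
Proof.
move=> Lf Lg s0; have [[f1 f2] Lf'] := Lf; have [[g1 g2] Lg'] := Lg.
have s0' : 0 < s^-1 by rewrite invr_gt0.
have L1 := Lint_mul_sqr f1 g1 (sL2_Re Lf) (sL2_Re Lg).
have L2 := Lint_mul_sqr f2 g2 (sL2_Im Lf) (sL2_Im Lg).
have h1 := Int_AMGM f1 g1 (sL2_Re Lf) (sL2_Re Lg) s0.
have h2 := Int_AMGM f2 g2 (sL2_Im Lf) (sL2_Im Lg) s0.
rewrite /ip IntD// !n2E//.
have := ler_normD (\int[mu]_x (Re (f x) * Re (g x))) (\int[mu]_x (Im (f x) * Im (g x))).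
move: h1 h2; lra.
Qed.

Lemma n2D f g : sL2 f -> sL2 g -> n2 (fun x => f x + g x) = n2 f + 2 * ip f g + n2 g.
Proof.
move=> Lf Lg; have LI := Lint_ip Lf Lg; have [_ Lf'] := Lf; have [_ Lg'] := Lg.
rewrite /n2 /ip -IntZ// -IntD//; last exact: LintZ.
rewrite -IntD//; last by apply: LintD => //; exact: LintZ.
by apply: eq_Int => x; rewrite !cabs2E ReD ImD; ring.
Qed.

Lemma n2B f g : sL2 f -> sL2 g -> n2 (fun x => f x - g x) = n2 f - 2 * ip f g + n2 g.
Proof.
move=> Lf Lg; have LI := Lint_ip Lf Lg; have [_ Lf'] := Lf; have [_ Lg'] := Lg.
rewrite /n2 /ip -IntZ// -IntB//; last exact: LintZ.
rewrite -IntD//; last by apply: LintB => //; exact: LintZ.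
by apply: eq_Int => x; rewrite !cabs2E ReB ImB; ring.
Qed.

Lemma n2D_le f g : sL2 f -> sL2 g -> n2 (fun x => f x + g x) <= 2 * n2 f + 2 * n2 g.
Proof.
move=> Lf Lg; have [_ Lf'] := Lf; have [_ Lg'] := Lg.
rewrite /n2 -!IntZ// -IntD//; [|exact: LintZ|exact: LintZ].
apply: Int_le; first by have [] := sL2D Lf Lg.
  by apply: LintD; exact: LintZ.
by move=> x; exact: cabs2D_le.
Qed.

Lemma n2B_le f g : sL2 f -> sL2 g -> n2 (fun x => f x - g x) <= 2 * n2 f + 2 * n2 g.
Proof.
move=> Lf Lg; have := n2D_le Lf (sL2N Lg).
by rewrite [n2 (fun x => - g x)](_ : _ = n2 g)//; apply: eq_Int => x; rewrite cabs2N.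
Qed.

Lemma n2Z c f : sL2 f -> n2 (fun x => c * f x) = cabs2 c * n2 f.
Proof. by move=> [_ L]; rewrite /n2 -IntZ//; apply: eq_Int => x; rewrite cabs2M. Qed.

Lemma cmeas_if (b : R -> bool) f : measurable_fun [set: R] b -> cmeas f ->
  cmeas (fun x => if b x then f x else 0).
Proof.
move=> mb [m1 m2]; split.
  rewrite (_ : (fun x => _) = fun x => if b x then Re (f x) else 0).
    exact: measurable_fun_ifT.
  by apply/funext => x; case: ifP.
rewrite (_ : (fun x => _) = fun x => if b x then Im (f x) else 0).
  exact: measurable_fun_ifT.
by apply/funext => x; case: ifP.
Qed.

Lemma sL2_if (b : R -> bool) f : measurable_fun [set: R] b -> sL2 f ->
  sL2 (fun x => if b x then f x else 0).
Proof.
move=> mb [mf Lf]; apply: sL2_le Lf _; first exact: cmeas_if.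
by move=> x; case: ifP => // _; rewrite cabs20 cabs2_ge0.
Qed.

Lemma cLint_if (b : R -> bool) f : Lint (fun x => if b x then 1 else 0) -> sL2 f ->
  cLint (fun x => if b x then f x else 0).
Proof.
move=> L1 Sf; have [[m1 m2] _] := Sf.
have L1' : Lint (fun x => (if b x then 1 else 0 : R) ^+ 2).
  by apply: eq_Lint L1 => x; case: ifP; rewrite ?expr1n ?expr0n.
split.
  apply: eq_Lint (Lint_mul_sqr m1 (Lint_meas L1) (sL2_Re Sf) L1') => x.
  by case: ifP; rewrite ?mulr1 ?mulr0.
apply: eq_Lint (Lint_mul_sqr m2 (Lint_meas L1) (sL2_Im Sf) L1') => x.
by case: ifP; rewrite ?mulr1 ?mulr0.
Qed.

End ComplexAlg.

(** * Fourier transform and inversion *)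

Section Transform.
Variable R : realType.
Local Notation mu := (@lebesgue_measure R).
Implicit Types (z w : R[i]) (f g h : R -> R[i]).

(** The kernel is exp(i t x) without normalisation: up to the factor [ksqrt] this is the inverse
    transform, and the forward one is its value at - t. *)
Definition T f t := cI (fun x => f x * cis (t * x)).

Lemma Re_T f t : cLint f ->
  Re (T f t) = cosT (fun x => Re (f x)) t - sinT (fun x => Im (f x)) t.
Proof.
move=> [f1 f2]; rewrite /cosT /sinT -IntB; [|exact: Lint_cos|exact: Lint_sin].
by apply: eq_Int => x /=; rewrite ReM.
Qed.

Lemma Im_T f t : cLint f ->
  Im (T f t) = sinT (fun x => Re (f x)) t + cosT (fun x => Im (f x)) t.
Proof.
move=> [f1 f2]; rewrite /cosT /sinT -IntD; [|exact: Lint_sin|exact: Lint_cos].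
by apply: eq_Int => x /=; rewrite ImM.
Qed.

Lemma TD f g t : cLint f -> cLint g -> T (fun x => f x + g x) t = T f t + T g t.
Proof.
move=> Lf Lg; rewrite /T -cID; [|exact: cLint_cis|exact: cLint_cis].
by apply: eq_cI => x; rewrite mulrDl.
Qed.

Lemma TZ c f t : cLint f -> T (fun x => c * f x) t = c * T f t.
Proof.
move=> Lf; rewrite /T -cIZ; last exact: cLint_cis.
by apply: eq_cI => x; rewrite mulrA.
Qed.

Lemma T_sum (I : eqType) (s : seq I) (F : I -> R -> R[i]) t :
  (forall i, i \in s -> cLint (F i)) ->
  T (fun x => \sum_(i <- s) F i x) t = \sum_(i <- s) T (F i) t.
Proof.
move=> h; rewrite /T -cI_sum; last by move=> i /h Li; exact: cLint_cis.
by apply: eq_cI => x; rewrite mulr_suml.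
Qed.

Lemma T_modulation f s t : T (fun x => f x * cis (s * x)) t = T f (s + t).
Proof. by apply: eq_cI => x; rewrite -mulrA -cisD mulrDl. Qed.

Lemma continuous_ReT f : cLint f -> continuous (fun t => Re (T f t)).
Proof.
move=> Lf; rewrite (funext (fun t => Re_T t Lf)); have [f1 f2] := Lf.
by move=> t; apply: cvgB; [exact: continuous_cosT|exact: continuous_sinT].
Qed.

Lemma continuous_ImT f : cLint f -> continuous (fun t => Im (T f t)).
Proof.
move=> Lf; rewrite (funext (fun t => Im_T t Lf)); have [f1 f2] := Lf.
by move=> t; apply: cvgD; [exact: continuous_sinT|exact: continuous_cosT].
Qed.

Lemma cmeas_T f : cLint f -> cmeas (T f).
Proof.
move=> Lf; split; apply: continuous_measurable_fun.
  exact: continuous_ReT.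
exact: continuous_ImT.
Qed.

Lemma T_bound f : cLint f -> exists M, forall t, cabs2 (T f t) <= M.
Proof.
move=> Lf; have [f1 f2] := Lf.
pose N := \int[mu]_x `|Re (f x)| + \int[mu]_x `|Im (f x)|.
exists (N ^+ 2 + N ^+ 2) => t; rewrite cabs2E; apply: lerD;
  rewrite -[leLHS](real_normK (num_real _)) lerXn2r ?nnegrE ?addr_ge0 ?Int_ge0//.
  rewrite Re_T//; apply: le_trans (ler_normB _ _) (lerD _ _).
    exact: cosT_bound.
  exact: sinT_bound.
rewrite Im_T//; apply: le_trans (ler_normD _ _) (lerD _ _).
  exact: sinT_bound.
exact: cosT_bound.
Qed.

Lemma sL2_opp f : sL2 f -> sL2 (fun x => f (- x)).
Proof.
move=> [[m1 m2] L]; split; last exact: Lint_opp L.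
by split; [exact: (measurableT_comp m1 (@oppr_measurable _ _))
          |exact: (measurableT_comp m2 (@oppr_measurable _ _))].
Qed.

Lemma n2_opp f : sL2 f -> n2 (fun x => f (- x)) = n2 f.
Proof. by move=> [_ L]; exact: Int_opp L. Qed.

Lemma ip_opp f g : sL2 f -> sL2 g -> ip (fun x => f (- x)) (fun x => g (- x)) = ip f g.
Proof. by move=> Lf Lg; exact: Int_opp (Lint_ip Lf Lg). Qed.

(** In |T f(t)|^2 the cross terms between the real and imaginary parts of [f] are odd in [t]; they
    cancel between t and - t, and the real case applies to each part. *)
Theorem plancherel f : cLint f -> sL2 f -> sL2 (T f) /\ n2 (T f) = 2 * pi * n2 f.
Proof.
move=> Lf Sf; have [f1 f2] := Lf.
have [L1 E1] := real_plancherel f1 (sL2_Re Sf).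
have [L2 E2] := real_plancherel f2 (sL2_Im Sf).
pose G t := cosT (fun x => Re (f x)) t ^+ 2 + sinT (fun x => Re (f x)) t ^+ 2 +
  (cosT (fun x => Im (f x)) t ^+ 2 + sinT (fun x => Im (f x)) t ^+ 2).
have LG : Lint G by exact: LintD.
have cosN' (h : R -> R) t : cosT h (- t) = cosT h t.
  by apply: eq_Int => x; rewrite mulNr cosN.
have sinN' (h : R -> R) t : Lint h -> sinT h (- t) = - sinT h t.
  move=> Lh; rewrite /sinT -IntN; last exact: Lint_sin.
  by apply: eq_Int => x; rewrite mulNr sinN mulrN.
have key t : cabs2 (T f t) + cabs2 (T f (- t)) = 2 * G t.
  rewrite !cabs2E !Re_T// !Im_T// !cosN' !sinN'// /G; ring.
have ST : sL2 (T f).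
  apply: (@sL2_le _ _ (fun t => 2 * G t)); first exact: cmeas_T.
    exact: LintZ.
  by move=> t; rewrite -key lerDl cabs2_ge0.
split => //.
have : n2 (T f) + n2 (T f) = 2 * \int[mu]_t G t.
  rewrite -{2}(n2_opp ST) /n2 -IntZ// -IntD.
  - exact: eq_Int.
  - by case: ST.
  - by case: (sL2_opp ST).
rewrite (IntD L1 L2) E1 E2 (n2E Sf); move: (pi) => p; lra.
Qed.

Lemma plancherel_polar f g : cLint f -> sL2 f -> cLint g -> sL2 g ->
  ip (T f) (T g) = 2 * pi * ip f g.
Proof.
move=> Lf Sf Lg Sg.
have [STf Ef] := plancherel Lf Sf.
have [STg Eg] := plancherel Lg Sg.
have [_ Efg] := plancherel (cLintD Lf Lg) (sL2D Sf Sg).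
move: Efg; rewrite (n2D Sf Sg).
rewrite [n2 _](_ : _ = n2 (fun t => T f t + T g t)); last first.
  by apply: eq_Int => t; rewrite TD.
rewrite (n2D STf STg) Ef Eg; move: (pi) => p; lra.
Qed.

(** Fubini with a symmetric kernel; moving the kernel to the other factor conjugates it, hence the
    reflection. *)
Lemma T_dual f g : cLint f -> cLint g -> ip (T f) g = ip f (fun x => T g (- x)).
Proof.
move=> Lf Lg; have [f1 f2] := Lf; have [g1 g2] := Lg.
have [A1 B1 E1] := cosT_dual f1 g1.
have [A2 B2 E2] := sinT_dual f2 g1.
have [A3 B3 E3] := sinT_dual f1 g2.
have [A4 B4 E4] := cosT_dual f2 g2.
have cosN' (h : R -> R) t : cosT h (- t) = cosT h t.
  by apply: eq_Int => x; rewrite mulNr cosN.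
have sinN' (h : R -> R) t : Lint h -> sinT h (- t) = - sinT h t.
  move=> Lh; rewrite /sinT -IntN; last exact: Lint_sin.
  by apply: eq_Int => x; rewrite mulNr sinN mulrN.
have l t : Re (T f t) * Re (g t) + Im (T f t) * Im (g t) =
  (cosT (fun x => Re (f x)) t * Re (g t) - sinT (fun x => Im (f x)) t * Re (g t)) +
  (sinT (fun x => Re (f x)) t * Im (g t) + cosT (fun x => Im (f x)) t * Im (g t)).
  by rewrite Re_T// Im_T//; ring.
have r x : Re (f x) * Re (T g (- x)) + Im (f x) * Im (T g (- x)) =
  (Re (f x) * cosT (fun x => Re (g x)) x - Im (f x) * sinT (fun x => Re (g x)) x) +
  (Re (f x) * sinT (fun x => Im (g x)) x + Im (f x) * cosT (fun x => Im (g x)) x).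
  by rewrite Re_T// Im_T// !cosN' !sinN'//; ring.
rewrite /ip (eq_Int l) (eq_Int r).
rewrite IntD; [|exact: LintB|exact: LintD].
rewrite [RHS]IntD; [|exact: LintB|exact: LintD].
by rewrite IntB// IntD// IntB// IntD// E1 E2 E3 E4.
Qed.

Definition cut (N : nat) f x := if `|x| <= N%:R then f x else 0.

Lemma measurable_ball (N : R) : measurable_fun [set: R] (fun x : R => `|x| <= N).
Proof. by apply: measurable_fun_ler => //; exact: measurableT_comp. Qed.

Lemma cmeas_cut N f : cmeas f -> cmeas (cut N f).
Proof. by move=> mf; exact: cmeas_if (measurable_ball _) mf. Qed.

Lemma sL2_cut N f : sL2 f -> sL2 (cut N f).
Proof. by move=> Sf; exact: sL2_if (measurable_ball _) Sf. Qed.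

Lemma Lint_ball (N : R) : Lint (fun x : R => if `|x| <= N then 1 else 0).
Proof.
have := @integrable_indic_itv R (- N) N true false.
congr (integrable _ _ _); apply/funext => x /=; rewrite indicE; congr EFin.
by rewrite mem_setE in_itv/= -ler_norml; case: ifP.
Qed.

Lemma cLint_cut N f : sL2 f -> cLint (cut N f).
Proof. by move=> Sf; exact: cLint_if (Lint_ball _) Sf. Qed.

Definition ksqrt : R := (Num.sqrt (2 * pi))^-1.

Lemma twopi_gt0 : 0 < 2 * pi :> R.
Proof. by rewrite mulr_gt0// pi_gt0. Qed.

Lemma ksqrt_gt0 : 0 < ksqrt.
Proof. by rewrite invr_gt0 sqrtr_gt0 twopi_gt0. Qed.

Lemma ksqrtK : ksqrt ^+ 2 * (2 * pi) = 1.
Proof.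
rewrite /ksqrt exprVn sqr_sqrtr ?(ltW twopi_gt0)// mulVf// gt_eqF//.
exact: twopi_gt0.
Qed.

Lemma FT_truncE f N xi : FT_trunc f N xi = ksqrt%:C%C * T (cut N f) (- xi).
Proof.
rewrite /FT_trunc mulrC; congr (_ * _); apply: cplx_ext => /=; rewrite Rintegral_mkcond;
apply: eq_Int => x; rewrite /patch /cut.
  case: (boolP (`|x| <= N%:R)) => xN; last first.
    by rewrite memNset ?mul0r//= -ler_norml; exact/negP.
  rewrite mem_set; last by rewrite /= -ler_norml.
  by rewrite mulNr !ReM /= cosN sinN.
case: (boolP (`|x| <= N%:R)) => xN; last first.
  by rewrite memNset ?mul0r//= -ler_norml; exact/negP.
rewrite mem_set; last by rewrite /= -ler_norml.
by rewrite mulNr !ImM /= cosN sinN.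
Qed.

End Transform.

Section Inversion.
Variable R : realType.
Local Notation mu := (@lebesgue_measure R).
Implicit Types (z w : R[i]) (f g h : R -> R[i]).

Lemma ae_mp (P Q : R -> Prop) : (forall x, P x -> Q x) ->
  (\forall x \ae mu, P x) -> \forall x \ae mu, Q x.
Proof. by move=> PQ; apply: (@filterS _ _ (ae_filter_ringOfSetsType mu)). Qed.

Lemma ae_mp2 (P1 P2 Q : R -> Prop) : (forall x, P1 x -> P2 x -> Q x) ->
  (\forall x \ae mu, P1 x) -> (\forall x \ae mu, P2 x) -> \forall x \ae mu, Q x.
Proof. by move=> PQ; apply: (@filterS2 _ _ (ae_filter_ringOfSetsType mu)). Qed.

Lemma ae_Int_eq0 (u : R -> R) : Lint u -> (forall x, 0 <= u x) ->
  \int[mu]_x u x = 0 -> \forall x \ae mu, u x = 0.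
Proof.
move=> Lu u0 Iu.
have := (ae_eq_integral_abs mu measurableT (measurable_int mu Lu)).1.
have -> : (\int[mu]_(x in setT) `|(EFin \o u) x| = 0)%E.
  transitivity (\int[mu]_x (u x)%:E)%E.
    by apply: eq_integral => x _ /=; rewrite ger0_norm.
  by rewrite Lint_EFin// Iu.
by move/(_ erefl); apply: filterS => x /(_ I) [].
Qed.

Lemma le_small_eq0 (a K : R) : (forall s, 0 < s -> `|a| <= s * K) -> a = 0.
Proof.
move=> h; apply/eqP; rewrite -normr_le0.
apply/ler_addgt0Pl => e e0; rewrite addr0.
have K1 : 0 < `|K| + 1 by rewrite ltr_wpDl.
apply: le_trans (h (e / (`|K| + 1)) (divr_gt0 e0 K1)) _.
rewrite -mulrA ler_piMr ?(ltW e0)// mulrC ler_pdivrMr// mul1r.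
by rewrite (le_trans (ler_norm _))// lerDl.
Qed.

Lemma cabs2_real (a : R) : cabs2 a%:C%C = a ^+ 2.
Proof. by rewrite cabs2E /= expr0n addr0. Qed.

Lemma ip_scale f g (a : R) : sL2 f -> sL2 g ->
  ip (fun x => a%:C%C * f x) g = a * ip f g.
Proof.
move=> Lf Lg; rewrite /ip -IntZ; last exact: Lint_ip.
by apply: eq_Int => x; rewrite !ReImE /=; ring.
Qed.

Lemma ipBl f g h : sL2 f -> sL2 g -> sL2 h ->
  ip (fun x => f x - g x) h = ip f h - ip g h.
Proof.
move=> Lf Lg Lh; rewrite /ip -IntB; [|exact: Lint_ip|exact: Lint_ip].
by apply: eq_Int => x; rewrite !ReImE; ring.
Qed.

Definition ksc f x : R[i] := (ksqrt R)%:C%C * f x.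

(** Let [k] be the difference of [psi] and [p0] on a ball, and pair it with itself. Plancherel
    carries the part with [psi] to the frequency side and [T_dual] the part with [p0]; what remains
    is the reflected [T k] paired with the truncated transform of [psi] minus [g], which tends to
    0. *)
Theorem fourier_inversion (psi g : R -> R[i]) : isL2 psi -> is_fourier psi g -> cLint g ->
  \forall x \ae mu, psi x = ksc (T g) x.
Proof.
move=> /isL2P Sp [/isL2P Sg hF] Lg.
have k0 := ksqrt_gt0 R.
pose c : R[i] := (ksqrt R)%:C%C.
have mTg := cmeas_T Lg.
have [M hM] := T_bound Lg.
pose p0 := ksc (T g).
have p0M x : cabs2 (p0 x) <= cabs2 c * M.
  by rewrite cabs2M ler_wpM2l// cabs2_ge0.
have mp0 : cmeas p0 by exact: cmeasM (cmeas_cst c) mTg.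
have Sp0 m : sL2 (cut m p0).
  apply: (sL2_le (cmeas_cut m mp0) (b := fun x => cabs2 c * M * (if `|x| <= m%:R then 1 else 0))).
    exact/LintZ/Lint_ball.
  by move=> x; rewrite /cut; case: ifP; rewrite ?mulr1 ?mulr0 ?cabs20.
have key m : \forall x \ae mu, cabs2 (psi x - p0 x) * (if `|x| <= m%:R then 1 else 0) = 0.
  pose k x := cut m psi x - cut m p0 x.
  have Sk : sL2 k by apply: sL2B => //; exact: sL2_cut.
  have ek x : k x = cut m k x by rewrite /k /cut; case: ifP; rewrite ?subrr.
  have Lk : cLint k by rewrite (funext ek); exact: cLint_cut.
  have [STk _] := plancherel Lk Sk.
  have [m1 m2] := Sk.
  have eI : n2 k = 0.
    apply: (@le_small_eq0 _ (ksqrt R * (n2 (T k) + 1))) => s s0.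
    (* Closeness s^2 and weight s^-1 in [ip_AMGM] make both resulting terms proportional to [s]. *)
    have [N0 hN] := hF (s ^+ 2) (exprn_gt0 _ s0).
    pose N := maxn N0 m.
    have := hN N (leq_maxl _ _).
    pose A xi := FT_trunc psi N xi.
    have LN := cLint_cut N Sp.
    have SN := sL2_cut N Sp.
    have [STN _] := plancherel LN SN.
    have SA : sL2 A.
      rewrite /A (funext (FT_truncE psi N)).
      exact/sL2Z/(sL2_opp STN).
    have SAg : sL2 (fun xi => A xi - g xi) by exact: sL2B.
    rewrite (L2norm2E SAg) lte_fin => hlt.
    have STk' := sL2_opp STk.
    have e1 : ip (cut N psi) k = ksqrt R * ip A (fun x => T k (- x)).
      rewrite /A (funext (FT_truncE psi N)) (ip_scale _ (sL2_opp STN) STk').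
      rewrite (ip_opp STN STk) (plancherel_polar LN SN Lk Sk).
      by rewrite [RHS]mulrA -expr2 [RHS]mulrA ksqrtK mul1r.
    have e2 : \int[mu]_x (Re (p0 x) * Re (k x) + Im (p0 x) * Im (k x)) =
        ksqrt R * ip g (fun x => T k (- x)).
      rewrite -(T_dual Lg Lk) /ip -IntZ.
        by apply: eq_Int => x; rewrite /p0 /ksc !ReImE /=; ring.
      have [h1 h2] := Lk; have [t1 t2] := mTg.
      have b1 x : `|Re (T g x)| <= 1 + M.
        by apply: (le_trans (normr_le_sqr1 _)); rewrite lerD2l (le_trans (Re_sqr_le _)).
      have b2 x : `|Im (T g x)| <= 1 + M.
        by apply: (le_trans (normr_le_sqr1 _)); rewrite lerD2l (le_trans (Im_sqr_le _)).
      apply: (@eq_Lint _ (fun x => Re (k x) * Re (T g x) + Im (k x) * Im (T g x))).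
        by move=> x; rewrite mulrC (mulrC (Im _)).
      by apply: LintD; [exact: Lint_bddM h1 t1 b1|exact: Lint_bddM h2 t2 b2].
    have e3 : \int[mu]_x (Re (p0 x) * Re (k x) + Im (p0 x) * Im (k x)) = ip (cut m p0) k.
      apply: eq_Int => x; rewrite ek /cut; case: ifP => //.
      by rewrite !mulr0.
    have e4 : ip (cut N psi) k = ip (cut m psi) k.
      have mN : m%:R <= N%:R :> R by rewrite ler_nat leq_maxr.
      apply: eq_Int => x; rewrite ek /cut; case: (boolP (`|x| <= m%:R)) => xm.
        by rewrite (le_trans xm mN).
      by rewrite !mulr0.
    have -> : n2 k = ksqrt R * ip (fun xi => A xi - g xi) (fun x => T k (- x)).
      rewrite (ipBl SA Sg STk') mulrBr -e1 -e2 e3 e4 -(ipBl (sL2_cut m Sp) (Sp0 m) Sk).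
      by apply: eq_Int => x; rewrite cabs2E !expr2.
    rewrite normrM (gtr0_norm k0) mulrCA ler_wpM2l ?(ltW k0)//.
    have := ip_AMGM SAg STk' (_ : 0 < s^-1); rewrite invr_gt0 invrK => /(_ s0).
    rewrite (n2_opp STk) => h.
    have : s^-1 * n2 (fun xi => A xi - g xi) <= s.
      by rewrite ler_pdivrMl// -expr2 ltW.
    have := n2_ge0 (T k); move: h; nra.
  have Lk2 : Lint (fun x => cabs2 (k x)) by [].
  apply: (ae_mp _ (ae_Int_eq0 Lk2 (fun x => cabs2_ge0 _) eI)) => x.
  by rewrite /k /cut; case: ifP => _; rewrite ?mulr1 ?mulr0.
apply: (ae_mp _ (ae_foralln key)) => x h.
have [n hn] : exists n : nat, `|x| <= n%:R.
  exists (Num.truncn `|x|).+1; apply: ltW; exact: truncnS_gt.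
have := h n; rewrite hn mulr1 => /cabs2_eq0/eqP; rewrite subr_eq0 => /eqP ->.
by [].
Qed.

End Inversion.

(** * Positive-definite functions have nonnegative transform *)

Section AeTransport.
Variable R : realType.
Local Notation mu := (@lebesgue_measure R).
Implicit Types (z w : R[i]) (f g h : R -> R[i]).

Lemma ae_preimage (phi : R -> R) (P : R -> Prop) : measurable_fun [set: R] phi ->
  (forall A, measurable A -> mu A = 0%E -> mu (phi @^-1` A) = 0%E) ->
  (\forall x \ae mu, P x) -> \forall x \ae mu, P (phi x).
Proof.
move=> mphi h [A [mA A0 PA]]; exists (phi @^-1` A); split.
- by rewrite -[X in measurable X]setTI; exact: mphi.
- exact: h.
- by move=> x /= nP; apply: PA.
Qed.

Lemma ae_shift (a : R) (P : R -> Prop) : (\forall x \ae mu, P x) -> \forall x \ae mu, P (x + a).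
Proof.
apply: ae_preimage; first exact: measurable_shift.
by move=> A mA A0; rewrite -A0; exact: lebesgue_measure_shift.
Qed.

Lemma ae_opp (P : R -> Prop) : (\forall x \ae mu, P x) -> \forall x \ae mu, P (- x).
Proof.
apply: ae_preimage; first exact: oppr_measurable.
by move=> A mA A0; rewrite -A0; exact: lebesgue_measureN.
Qed.

Lemma measurable_scale (c : R) : measurable_fun [set: R] (fun x : R => c * x).
Proof. exact: measurable_funM. Qed.

Lemma lebesgue_measure_scale (c : R) (c0 : 0 < c) (A : set R) : measurable A ->
  mu A = (c%:E * mu ((fun x : R => (c * x)%R) @^-1` A))%E.
Proof.
move=> mA; pose c' := NngNum (ltW c0).
have ms := measurable_scale c.
rewrite (@lebesgue_measure_unique R (mscale c' (pushforward mu (fun x : measurableTypeR R => (c * x)%R : measurableTypeR R))) _ A mA)//.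
move=> X [[a b] /= _ <-]; rewrite /mscale/= /pushforward.
have -> : (fun x : R => c * x) @^-1` `]a, b]%classic = `]c^-1 * a, c^-1 * b]%classic.
  by apply/seteqP; split=> x /=; rewrite !in_itv/= ltr_pdivrMl// ler_pdivlMl.
rewrite !lebesgue_measure_itv/= !lte_fin ltr_pM2l ?invr_gt0//.
case: ifP => _; last by rewrite mule0.
by rewrite -!EFinB -EFinM -mulrBr mulrA mulfV ?mul1r// gt_eqF.
Qed.

Lemma ae_scale (c : R) (P : R -> Prop) : 0 < c ->
  (\forall x \ae mu, P x) -> \forall x \ae mu, P (c * x).
Proof.
move=> c0; apply: ae_preimage; first exact: measurable_scale.
move=> A mA A0; have := lebesgue_measure_scale c0 mA; rewrite A0.
move/esym/eqP; rewrite mule_eq0 => /orP[/eqP[]/eqP|/eqP//].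
by rewrite gt_eqF.
Qed.

Lemma ae_exists_itv (P : R -> Prop) (a b : R) : a < b -> (\forall x \ae mu, P x) ->
  exists x, [/\ a <= x, x <= b & P x].
Proof.
move=> ab [A [mA A0 PA]].
apply: contrapT => hn.
have sub : `[a, b]%classic `<=` A.
  move=> x; rewrite /= in_itv/= => /andP[ax xb]; apply: PA => /= Px.
  by apply: hn; exists x.
have : (mu `[a, b]%classic <= mu A)%E.
  by apply: le_measure => //; rewrite inE//; exact: measurable_itv.
rewrite A0 lebesgue_measure_itv/= lte_fin ab -EFinB lee_fin leNgt subr_gt0 ab.
by [].
Qed.

Lemma conjM z w : ((z * w)^*%C = z^*%C * w^*%C).
Proof. by apply: cplx_ext; rewrite !ReImE; ring. Qed.

Lemma conj_sum (I : Type) (r : seq I) (F : I -> R[i]) :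
  ((\sum_(j <- r) F j)^*%C = \sum_(j <- r) (F j)^*%C).
Proof.
apply: cplx_ext; rewrite ?Reconj ?Imconj ?Re_sum ?Im_sum.
  by apply: eq_bigr => j _; rewrite Reconj.
by rewrite -sumrN; apply: eq_bigr => j _; rewrite Imconj.
Qed.

Definition esumc (I : eqType) (r : seq I) (a : I -> R[i]) (y : I -> R) (t : R) : R[i] :=
  \sum_(j <- r) a j * cis (y j * t).

Lemma cmeas_esumc (I : eqType) (r : seq I) a (y : I -> R) : cmeas (esumc r a y).
Proof.
apply: (cmeas_sum (F := fun j t => a j * cis (y j * t))) => j _.
by apply: cmeasM; [exact: cmeas_cst|exact: cmeas_cis].
Qed.

Lemma cabs2_sum_le (I : eqType) (r : seq I) (F : I -> R[i]) :
  cabs2 (\sum_(j <- r) F j) <= (size r)%:R * \sum_(j <- r) cabs2 (F j).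
Proof.
elim: r => [|i r ih]; first by rewrite !big_nil cabs20 mulr0.
rewrite !big_cons /=; set S := \sum_(j <- r) F j; set Q := \sum_(j <- r) cabs2 (F j).
have Q0 : 0 <= Q by apply: sumr_ge0 => j _; exact: cabs2_ge0.
have [r0|r0] := posnP (size r).
  have -> : S = 0 by rewrite /S (size0nil r0) big_nil.
  by rewrite addr0 r0 mul1r lerDl.
set n : R := (size r)%:R in ih *.
have n0 : 0 < n by rewrite ltr0n.
have h : cabs2 (F i + S) <= (1 + n) * cabs2 (F i) + (1 + n^-1) * cabs2 S.
  rewrite !cabs2E ReD ImD -subr_ge0.
  have -> : (1 + n) * (Re (F i) ^+ 2 + Im (F i) ^+ 2) + (1 + n^-1) * (Re S ^+ 2 + Im S ^+ 2) -
    ((Re (F i) + Re S) ^+ 2 + (Im (F i) + Im S) ^+ 2) =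
    n^-1 * ((n * Re (F i) - Re S) ^+ 2 + (n * Im (F i) - Im S) ^+ 2).
    by field; rewrite gt_eqF.
  by rewrite mulr_ge0 ?addr_ge0 ?sqr_ge0 ?invr_ge0 ?(ltW n0).
apply: (le_trans h).
have h2 : (1 + n^-1) * cabs2 S <= (1 + n) * Q.
  apply: (@le_trans _ _ ((1 + n^-1) * (n * Q))).
    by rewrite ler_wpM2l// addr_ge0 ?invr_ge0 ?(ltW n0).
  by rewrite mulrA mulrDl mul1r mulVf ?gt_eqF// addrC.
rewrite -[(size r).+1%:R]natr1 -/n (addrC n 1) (mulrDr (1 + n) (cabs2 (F i)) Q).
by apply: lerD.
Qed.

Lemma esumc_bound (I : eqType) (r : seq I) a (y : I -> R) t :
  cabs2 (esumc r a y t) <= (size r)%:R * \sum_(j <- r) cabs2 (a j).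
Proof.
apply: (le_trans (cabs2_sum_le _ _)); rewrite ler_wpM2l//.
by apply: ler_sum => j _; rewrite cabs2M cabs2_cis mulr1.
Qed.

(** Two index lists and two coefficient families are kept apart because this serves both for the
    positive-definite form and for pairing samples with other coefficients. *)
Lemma quadratic_T (I : eqType) (r s : seq I) (a b : I -> R[i]) (y : I -> R) g : cLint g ->
  \sum_(j <- r) \sum_(k <- s) a j * (b k)^*%C * T g (y j - y k) =
  cI (fun t => g t * (esumc r a y t * (esumc s b y t)^*%C)).
Proof.
move=> Lg.
have L j k : cLint (fun t => a j * (b k)^*%C * (g t * cis ((y j - y k) * t))).
  exact/cLintZ/cLint_cis.
transitivity (\sum_(j <- r) cI (fun t => \sum_(k <- s) a j * (b k)^*%C * (g t * cis ((y j - y k) * t)))).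
  apply: eq_bigr => j _.
  rewrite (cI_sum (F := fun k t => a j * (b k)^*%C * (g t * cis ((y j - y k) * t)))); last by move=> k _.
  by apply: eq_bigr => k _; rewrite cIZ//; exact: cLint_cis.
rewrite -(cI_sum (F := fun j t => \sum_(k <- s) a j * (b k)^*%C * (g t * cis ((y j - y k) * t)))).
  apply: eq_cI => t; rewrite mulr_suml mulr_sumr; apply: eq_bigr => j _.
  rewrite conj_sum mulr_sumr mulr_sumr; apply: eq_bigr => k _.
  rewrite conjM conj_cis mulrBl cisD; ring.
by move=> j _; apply: cLint_sum.
Qed.

End AeTransport.

(** * Riemann sums tested against a positive-definite function *)

Section PosdefIntegral.
Variable R : realType.
Local Notation mu := (@lebesgue_measure R).
Implicit Types (z w : R[i]) (f g h : R -> R[i]).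

Lemma Int_indic_itvco (a b : R) : a <= b ->
  Lint (fun x => ((a <= x) && (x < b))%:R) /\
  \int[mu]_x (((a <= x) && (x < b))%:R) = b - a :> R.
Proof.
move=> ab.
have e x : ((a <= x) && (x < b))%:R = \1_(`[a, b[%classic) x :> R.
  by rewrite indicE; congr (_%:R); rewrite mem_setE in_itv.
split; first by apply: (eq_Lint (fsym e)); exact: integrable_indic_itv.
have hm := @lebesgue_measure_itv R `[a, b[; rewrite /= lte_fin in hm.
rewrite (eq_Int e) /Rintegral integral_indic// setIT [X in fine X]hm.
move: ab; rewrite le_eqVlt => /orP[/eqP ->|ab]; first by rewrite ltxx subrr.
by rewrite ab.
Qed.

Section Cells.
Variables (L : R) (L0 : 0 < L) (n : nat).
Definition mesh : R := 2 * L / n.+1%:R.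
Definition node (j : 'I_n.+1) : R := - L + j%:R * mesh.
Definition cell (j : 'I_n.+1) (x : R) : bool := (node j <= x) && (x < node j + mesh).

Lemma mesh_gt0 : 0 < mesh.
Proof. by rewrite divr_gt0 ?mulr_gt0. Qed.

Lemma cell_unique x : `|x| < L -> exists j0, forall j, cell j x = (j == j0).
Proof.
have m0 := mesh_gt0; rewrite ltr_norml => /andP[x1 x2].
pose q := (x + L) / mesh.
have q0 : 0 <= q by rewrite divr_ge0 ?(ltW m0)//; lra.
have qn : q < n.+1%:R.
  rewrite ltr_pdivrMr// /mesh mulrC divfK ?pnatr_eq0//; lra.
have cE (j : 'I_n.+1) : cell j x = (j%:R <= q < j.+1%:R).
  rewrite /cell /node /q ler_pdivlMr// ltr_pdivrMr// -natr1 mulrDl mul1r.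
  by congr (_ && _); [rewrite addrC lerBlDr|rewrite -addrA [in LHS]addrC ltrBrDr].
have tn : (Num.truncn q < n.+1)%N.
  by rewrite -(ltr_nat R) (le_lt_trans _ qn)// truncn_le.
exists (Ordinal tn) => j; rewrite cE -val_eqE/= eq_sym.
by rewrite (truncn_eq _ q0).
Qed.

Lemma cell_sum x (c : 'I_n.+1 -> R[i]) : `|x| < L ->
  exists j0, cell j0 x /\ \sum_j (cell j x)%:R%:C%C * c j = c j0.
Proof.
move=> /cell_unique[j0 h]; exists j0; split; first by rewrite h.
rewrite (bigD1 j0)//= h eqxx mul1r big1 ?addr0// => j jj.
by rewrite h (negbTE jj) mul0r.
Qed.

Lemma node_near j x : cell j x -> `|x - node j| <= mesh.
Proof.
by rewrite /cell ler_norml => /andP[a b]; have m0 := mesh_gt0; apply/andP; split; lra.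
Qed.

Lemma Lint_cell j : Lint (fun x => (cell j x)%:R).
Proof. by have [] := @Int_indic_itvco (node j) (node j + mesh) ltac:(have := mesh_gt0; lra). Qed.

Lemma Int_cell j : \int[mu]_x (cell j x)%:R = mesh.
Proof.
have [_ ->] := @Int_indic_itvco (node j) (node j + mesh) ltac:(have := mesh_gt0; lra).
by rewrite addrC addKr.
Qed.

End Cells.

Section Discretise.
Variables (phi : R -> R[i]) (M N L : R).
Hypotheses (mphi : cmeas phi) (phiM : forall x, cabs2 (phi x) <= M).
Hypotheses (phi0 : forall x, N < `|x| -> phi x = 0) (NL : N < L) (N0 : 0 < N).
Let L0 : 0 < L. Proof. exact: lt_trans NL. Qed.

Lemma cLint_phi : cLint phi.
Proof.
have [m1 m2] := mphi.
have LB := LintZ (1 + M) (Lint_ball N).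
split; apply: Lint_le LB => // x; case: ifP => xN.
- by rewrite mulr1; apply: (le_trans (normr_le_sqr1 _)); rewrite lerD2l (le_trans (Re_sqr_le _)).
- by rewrite phi0 ?mulr0 ?normr0// ltNge xN.
- by rewrite mulr1; apply: (le_trans (normr_le_sqr1 _)); rewrite lerD2l (le_trans (Im_sqr_le _)).
- by rewrite phi0 ?mulr0 ?normr0// ltNge xN.
Qed.

Let D x := `|Re (phi x)| + `|Im (phi x)|.
Let LD : Lint D.
Proof. by have [l1 l2] := cLint_phi; apply: LintD; exact: Lint_norm. Qed.
Let D0 x : 0 <= D x. Proof. exact: addr_ge0. Qed.
Let DM x : D x <= 2 * (1 + M).
Proof.
rewrite mulr_natl mulr2n; apply: lerD; apply: (le_trans (normr_le_sqr1 _)); rewrite lerD2l.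
  exact: le_trans (Re_sqr_le _) (phiM x).
exact: le_trans (Im_sqr_le _) (phiM x).
Qed.

(** Since [phi] is merely measurable, its values at the nodes say nothing about its integral; the
    mass of [phi] on each cell is placed at the node instead. *)
Definition coefd n (j : 'I_n.+1) : R[i] := cI (fun x => phi x * (cell L j x)%:R%:C%C).
(** The integrand of [T phi t] with the exponential frozen on each cell at its left end. *)
Definition stepd n t x : R[i] := phi x * \sum_j (cell L j x)%:R%:C%C * cis (@node L n j * t).

Let cmeas_cell n (j : 'I_n.+1) : cmeas (fun x => (cell L j x)%:R%:C%C).
Proof. by apply: cmeas_real; exact: Lint_meas (Lint_cell L0 j). Qed.

Let cabs2_cell n (j : 'I_n.+1) x : cabs2 ((cell L j x)%:R%:C%C : R[i]) <= 1.
Proof. by rewrite cabs2_real; case: (cell _ _ _); rewrite ?expr1n ?expr0n ?ler01. Qed.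

Lemma Lint_phi_cell n (j : 'I_n.+1) : cLint (fun x => phi x * (cell L j x)%:R%:C%C).
Proof. by apply: (cLint_bdd cLint_phi (@cmeas_cell n j)) => x; exact: cabs2_cell. Qed.

Lemma stepdE n t : esumc (index_enum 'I_n.+1) (@coefd n) (@node L n) t = cI (stepd n t) /\
  cmeas (stepd n t).
Proof.
have e x : stepd n t x = \sum_(j <- index_enum 'I_n.+1) cis (@node L n j * t) * (phi x * (cell L j x)%:R%:C%C).
  by rewrite /stepd mulr_sumr; apply: eq_bigr => j _; ring.
have Li (j : 'I_n.+1) : cLint (fun x => cis (@node L n j * t) * (phi x * (cell L j x)%:R%:C%C)).
  exact/cLintZ/Lint_phi_cell.
split.
  rewrite (eq_cI e) (cI_sum (F := fun j x => cis (@node L n j * t) * (phi x * (cell L j x)%:R%:C%C))) => [|j _]; last exact: Li.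
  by apply: eq_bigr => j _; rewrite (cIZ _ (Lint_phi_cell j)) mulrC.
rewrite (funext e).
by apply: (cmeas_sum (F := fun j x => cis (@node L n j * t) * (phi x * (cell L j x)%:R%:C%C))) => j _; exact: cLint_meas.
Qed.

Lemma stepd_form n t x : phi x = 0 \/ exists s, `|x - s| <= mesh L n /\ stepd n t x = phi x * cis (s * t).
Proof.
have [xN|xN] := leP `|x| N; last by left; exact: phi0.
right; have [j [cj e]] := @cell_sum L L0 n x (fun j => cis (node L j * t)) (le_lt_trans xN NL).
by exists (node L j); split; [exact: node_near|rewrite /stepd e].
Qed.

Lemma ReIm_cisM z s : `|Re (z * cis s)| <= `|Re z| + `|Im z| /\ `|Im (z * cis s)| <= `|Re z| + `|Im z|.
Proof.
have c1 := normr_cos_le1 s; have s1 := normr_sin_le1 s.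
rewrite ReM ImM /=; split.
  apply: (le_trans (ler_normB _ _)); rewrite !normrM; apply: lerD; exact: ler_piMr.
by apply: (le_trans (ler_normD _ _)); rewrite !normrM addrC [leRHS]addrC addrC [leRHS]addrC; apply: lerD; exact: ler_piMr.
Qed.

Lemma stepd_dom n t x : `|Re (stepd n t x)| <= D x /\ `|Im (stepd n t x)| <= D x.
Proof.
have [p0|[s [_ ->]]] := stepd_form n t x; last exact: ReIm_cisM.
by rewrite /stepd p0 mul0r normr0; split.
Qed.

Lemma mesh_cvg0 : mesh L n @[n --> \oo] --> (0 : R).
Proof.
rewrite -(mulr0 (2 * L)); apply: cvgM; first exact: cvg_cst.
exact: cvg_harmonic.
Qed.

Lemma stepd_cvg t x : Re (stepd n t x) @[n --> \oo] --> Re (phi x * cis (t * x)) /\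
  Im (stepd n t x) @[n --> \oo] --> Im (phi x * cis (t * x)).
Proof.
have [p0|p0] := eqVneq (phi x) 0.
  have e n : stepd n t x = 0 by rewrite /stepd p0 mul0r.
  have eR n : Re (stepd n t x) = 0 by rewrite e.
  have eI n : Im (stepd n t x) = 0 by rewrite e.
  by rewrite p0 mul0r (funext eR) (funext eI); split; exact: cvg_cst.
have hs n : exists s, `|x - s| <= mesh L n /\ stepd n t x = phi x * cis (s * t).
  by case: (stepd_form n t x) => // h; rewrite h eqxx in p0.
have [s sP] := choice hs.
have sx : s n @[n --> \oo] --> x.
  apply/cvgrPdist_le => e e0.
  move/cvgrPdist_le: mesh_cvg0 => /(_ _ e0); apply: filterS => n.
  rewrite sub0r normrN => h; have [h1 _] := sP n.
  exact: le_trans h1 (le_trans (ler_norm _) h).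
have cc : cos (s n * t) @[n --> \oo] --> cos (t * x).
  apply: (@cvg_comp _ _ _ (fun n => s n * t) (@cos R) _ (nbhs (t * x))); last exact: continuous_cos.
  by rewrite (mulrC t); apply: cvgM; [exact: sx|exact: cvg_cst].
have ss : sin (s n * t) @[n --> \oo] --> sin (t * x).
  apply: (@cvg_comp _ _ _ (fun n => s n * t) (@sin R) _ (nbhs (t * x))); last exact: continuous_sin.
  by rewrite (mulrC t); apply: cvgM; [exact: sx|exact: cvg_cst].
have eR n : Re (stepd n t x) = Re (phi x) * cos (s n * t) - Im (phi x) * sin (s n * t).
  by have [_ ->] := sP n; rewrite ReM.
have eI n : Im (stepd n t x) = Re (phi x) * sin (s n * t) + Im (phi x) * cos (s n * t).
  by have [_ ->] := sP n; rewrite ImM.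
rewrite (funext eR) (funext eI) ReM ImM /=; split.
  by apply: cvgB; apply: cvgM => //; exact: cvg_cst.
by apply: cvgD; apply: cvgM => //; exact: cvg_cst.
Qed.

Let S n := esumc (index_enum 'I_n.+1) (@coefd n) (@node L n).

Lemma S_cvg t : cabs2 (S n t) @[n --> \oo] --> cabs2 (T phi t).
Proof.
have m n : cmeas (stepd n t) by have [] := stepdE n t.
have [_ cR] := Int_DCT (fun n => (m n).1) (fun x => (stepd_cvg t x).1) LD
  (fun n x => (stepd_dom n t x).1).
have [_ cIm] := Int_DCT (fun n => (m n).2) (fun x => (stepd_cvg t x).2) LD
  (fun n x => (stepd_dom n t x).2).
have e n : cabs2 (S n t) = (\int[mu]_x Re (stepd n t x)) ^+ 2 + (\int[mu]_x Im (stepd n t x)) ^+ 2.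
  by rewrite /S (stepdE n t).1.
by rewrite (funext e) cabs2E; apply: cvgD; apply: cvgM.
Qed.

Lemma S_bound n t : cabs2 (S n t) <= 2 * (\int[mu]_x D x) ^+ 2.
Proof.
have [e [m1 m2]] := stepdE n t.
have Dp := Int_ge0 D0.
have L1 : Lint (fun x => Re (stepd n t x)) := Lint_le m1 (fun x => (stepd_dom n t x).1) LD.
have L2 : Lint (fun x => Im (stepd n t x)) := Lint_le m2 (fun x => (stepd_dom n t x).2) LD.
rewrite /S e cabs2E /= mulr_natl mulr2n; apply: lerD;
  rewrite -[leLHS](real_normK (num_real _)) lerXn2r ?nnegrE//.
  apply: le_trans (Int_norm L1) _; apply: Int_le (Lint_norm L1) LD _ => x.
  exact: (stepd_dom n t x).1.
apply: le_trans (Int_norm L2) _; apply: Int_le (Lint_norm L2) LD _ => x.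
exact: (stepd_dom n t x).2.
Qed.

(** Each coefficient is O(mesh), while up to a constant their moduli sum to at most the L_1 norm of
    [phi], so the sum of squares is O(mesh). This sum weighs the diagonal of the quadratic form,
    where [psi 0] need not equal the value of the continuous representative. *)
Lemma coefd_sum n : \sum_(j < n.+1) cabs2 (@coefd n j) <=
  4 * (1 + M) * (\int[mu]_x D x) * mesh L n.
Proof.
pose d (j : 'I_n.+1) := \int[mu]_x (D x * (cell L j x)%:R).
have Lc (j : 'I_n.+1) : Lint (fun x => D x * (cell L j x)%:R).
  apply: (Lint_bddM LD (Lint_meas (Lint_cell L0 j)) (M := 1)) => x.
  by case: (cell _ _ _); rewrite ?normr1 ?normr0.
have d0 j : 0 <= d j by apply: Int_ge0 => x; rewrite mulr_ge0.
have dm j : d j <= 2 * (1 + M) * mesh L n.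
  rewrite -(Int_cell L0 j) -IntZ; last exact: Lint_cell.
  apply: Int_le => //; first by apply: LintZ; exact: Lint_cell.
  by move=> x; rewrite ler_wpM2r.
have cd j : cabs2 (@coefd n j) <= 2 * (d j) ^+ 2.
  have [l1 l2] := Lint_phi_cell j.
  have b1 x : `|Re (phi x * (cell L j x)%:R%:C%C)| <= D x * (cell L j x)%:R.
    rewrite ReM /= mulr0 subr0 normrM (ger0_norm (ler0n _ _)) ler_wpM2r//.
    by rewrite lerDl.
  have b2 x : `|Im (phi x * (cell L j x)%:R%:C%C)| <= D x * (cell L j x)%:R.
    rewrite ImM /= mulr0 add0r normrM (ger0_norm (ler0n _ _)) ler_wpM2r//.
    by rewrite lerDr.
  rewrite cabs2E /= mulr_natl mulr2n; apply: lerD;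
    rewrite -[leLHS](real_normK (num_real _)) lerXn2r ?nnegrE//.
    apply: le_trans (Int_norm l1) _; exact: Int_le (Lint_norm l1) (Lc j) b1.
  apply: le_trans (Int_norm l2) _; exact: Int_le (Lint_norm l2) (Lc j) b2.
have sd : \sum_j d j <= \int[mu]_x D x.
  rewrite /d -(Int_sum (f := fun j x => D x * (cell L j x)%:R)); last by move=> j _.
  apply: Int_le => //.
    by apply: (Lint_sum (f := fun j x => D x * (cell L j x)%:R)) => j _.
  move=> x; rewrite -mulr_sumr.
  have [xN|xN] := leP `|x| N; last by rewrite /D phi0//= normr0 addr0 mul0r.
  have [j0 h] := cell_unique L0 n (le_lt_trans xN NL).
  rewrite (bigD1 j0)//= h eqxx big1 ?addr0 ?mulr1// => j jj.
  by rewrite h (negbTE jj).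
apply: (@le_trans _ _ (\sum_j (4 * (1 + M) * mesh L n) * d j)).
  apply: ler_sum => j _; apply: (le_trans (cd j)).
  rewrite expr2 mulrA; apply: ler_wpM2r => //.
  have := dm j; have := d0 j; nra.
rewrite -mulr_sumr.
have M0 : 0 <= M by apply: le_trans (cabs2_ge0 _) (phiM 0).
have m0 := mesh_gt0 L0 n.
have -> : 4 * (1 + M) * (\int[mu]_x D x) * mesh L n = 4 * (1 + M) * mesh L n * (\int[mu]_x D x) by ring.
by rewrite ler_wpM2l// !mulr_ge0// ?addr_ge0// ltW.
Qed.

Lemma coefd_sum_cvg0 : \sum_(j < n.+1) cabs2 (@coefd n j) @[n --> \oo] --> (0 : R).
Proof.
apply: (@squeeze_cvgr _ _ _ _ (fun=> 0) (fun n => 4 * (1 + M) * (\int[mu]_x D x) * mesh L n)).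
- apply: nearW => n; rewrite coefd_sum andbT.
  by apply: sumr_ge0 => j _; exact: cabs2_ge0.
- exact: cvg_cst.
- rewrite -[X in _ --> X](mulr0 (4 * (1 + M) * (\int[mu]_x D x))).
  by apply: cvgM; [exact: cvg_cst|exact: mesh_cvg0].
Qed.

End Discretise.

(** The quadratic form at the nodes is [ksqrt] times the integral of g |S n|^2, plus a diagonal
    defect. As the mesh shrinks, [S n] tends boundedly to [T phi] and the defect vanishes. A complex
    number >= 0 is real, so the limit yields an inequality and an equation. *)
Theorem posdef_quadratic (psi g phi : R -> R[i]) (M N : R) : posdef psi -> cLint g ->
  (\forall x \ae mu, psi x = ksc (T g) x) ->
  cmeas phi -> (forall x, cabs2 (phi x) <= M) -> 0 < N -> (forall x, N < `|x| -> phi x = 0) ->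
  0 <= \int[mu]_t (Re (g t) * cabs2 (T phi t)) /\
  \int[mu]_t (Im (g t) * cabs2 (T phi t)) = 0.
Proof.
move=> pd Lg hae mphi phiM N0 phi0.
have [g1 g2] := Lg.
have q0 (i n : nat) : 0 < 2 * i.+1%:R / n.+1%:R :> R by rewrite divr_gt0 ?mulr_gt0.
(* [psi] is known to be the transform of [g] only a.e.; a generic [L] keeps all
   the differences of distinct nodes out of the exceptional set. *)
have good : \forall L \ae mu, forall i n : nat,
    psi (2 * i.+1%:R / n.+1%:R * L) = ksc (T g) (2 * i.+1%:R / n.+1%:R * L) /\
    psi (- (2 * i.+1%:R / n.+1%:R * L)) = ksc (T g) (- (2 * i.+1%:R / n.+1%:R * L)).
  apply: ae_foralln => i; apply: ae_foralln => n.
  apply: (ae_mp2 _ (ae_scale (q0 i n) hae) (ae_scale (q0 i n) (ae_opp hae))).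
  by move=> x; split.
have [L [L1 _ hL]] := @ae_exists_itv _ _ (N + 1) (N + 2) ltac:(lra) good.
have NL : N < L by lra.
have L0 : 0 < L by lra.
pose S n := esumc (index_enum 'I_n.+1) (@coefd phi L n) (@node L n).
pose e n := \sum_(j < n.+1) cabs2 (@coefd phi L n j).
(* The a.e. identity says nothing at the single point 0, where all diagonal terms are evaluated;
   [dl] is the possible defect there. *)
pose dl := psi 0 - ksc (T g) 0.
have hdiff n (j k : 'I_n.+1) : j != k ->
    psi (node L j - node L k) = ksc (T g) (node L j - node L k).
  move=> jk; have -> : node L j - node L k = (j%:R - k%:R) * mesh L n by rewrite /node; ring.
  have [kj|jk'|/val_inj jk'] := ltngtP k j; last by rewrite jk' eqxx in jk.
    have := (hL (j - k).-1 n).1.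
    rewrite prednK ?subn_gt0// natrB ?(ltnW kj)//.
    by have -> : 2 * (j%:R - k%:R) / n.+1%:R * L = (j%:R - k%:R) * mesh L n by rewrite /mesh; ring.
  have := (hL (k - j).-1 n).2.
  rewrite prednK ?subn_gt0// natrB ?(ltnW jk')//.
  by have -> : - (2 * (k%:R - j%:R) / n.+1%:R * L) = (j%:R - k%:R) * mesh L n by rewrite /mesh; ring.
have main n : 0 <= (ksqrt R)%:C%C * cI (fun t => g t * (S n t * (S n t)^*%C)) +
    dl * \sum_(j < n.+1) (@coefd phi L n j) * (@coefd phi L n j)^*%C.
  have := pd n.+1 (@node L n) (@coefd phi L n).
  congr (0 <= _); rewrite -(quadratic_T _ _ _ _ _ Lg) 2!mulr_sumr -big_split/=.
  apply: eq_bigr => j _; rewrite mulr_sumr (bigD1 j)//= [in RHS](bigD1 j)//= subrr.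
  rewrite [RHS]addrAC; congr (_ + _); first by rewrite /dl /ksc; ring.
  by apply: eq_bigr => k kj; rewrite hdiff 1?eq_sym// /ksc; ring.
have zz z : z * z^*%C = (cabs2 z)%:C%C.
  by apply: cplx_ext; rewrite !ReImE /= ?cabs2E; ring.
have LS n (u : R -> R) : Lint u -> Lint (fun t => u t * cabs2 (S n t)).
  move=> Lu; apply: (Lint_bddM Lu (measurable_cabs2 (cmeas_esumc _ _ _)) (M := 2 * (\int[mu]_x (`|Re (phi x)| + `|Im (phi x)|)) ^+ 2)).
  by move=> t; rewrite ger0_norm ?cabs2_ge0//; exact: (S_bound mphi phiM phi0 NL N0).
have mainR n : 0 <= ksqrt R * \int[mu]_t (Re (g t) * cabs2 (S n t)) + Re dl * e n /\
    ksqrt R * \int[mu]_t (Im (g t) * cabs2 (S n t)) + Im dl * e n = 0.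
  have := main n; rewrite lecE => /andP[/eqP h1 h2].
  have es : \sum_(j < n.+1) (@coefd phi L n j) * (@coefd phi L n j)^*%C = (e n)%:C%C.
    under eq_bigr do rewrite zz.
    apply: cplx_ext; first by rewrite Re_sum.
    by rewrite Im_sum big1.
  move: h1 h2; rewrite es !ReImE /= !mul0r !mulr0 !subr0 !addr0 !add0r.
  have -> : \int[mu]_x Re (g x * (S n x * (S n x)^*%C)) = \int[mu]_t (Re (g t) * cabs2 (S n t)).
    by apply: eq_Int => t; rewrite zz !ReImE /=; ring.
  have -> : \int[mu]_x Im (g x * (S n x * (S n x)^*%C)) = \int[mu]_t (Im (g t) * cabs2 (S n t)).
    by apply: eq_Int => t; rewrite zz !ReImE /=; ring.
  by move=> h1 h2; split; [exact: h2|rewrite h1].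
have lim (u : R -> R) : Lint u -> \int[mu]_t (u t * cabs2 (S n t)) @[n --> \oo] -->
    \int[mu]_t (u t * cabs2 (T phi t)).
  move=> Lu; have Ld := LintZ (2 * (\int[mu]_x (`|Re (phi x)| + `|Im (phi x)|)) ^+ 2) (Lint_norm Lu).
  have c t : u t * cabs2 (S n t) @[n --> \oo] --> u t * cabs2 (T phi t).
    by apply: cvgM; [exact: cvg_cst|exact: (S_cvg mphi phiM phi0 NL N0)].
  have b n t : `|u t * cabs2 (S n t)| <= 2 * (\int[mu]_x (`|Re (phi x)| + `|Im (phi x)|)) ^+ 2 * `|u t|.
    rewrite normrM mulrC ler_wpM2r// ger0_norm ?cabs2_ge0//.
    exact: (S_bound mphi phiM phi0 NL N0).
  by have [] := Int_DCT (fun n => Lint_meas (LS n u Lu)) c Ld b.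
have e0 := coefd_sum_cvg0 mphi phiM phi0 NL N0.
have k0 := ksqrt_gt0 R.
have limc (u : R -> R) (c : R) : Lint u ->
    ksqrt R * \int[mu]_t (u t * cabs2 (S n t)) + c * e n @[n --> \oo] -->
    ksqrt R * \int[mu]_t (u t * cabs2 (T phi t)).
  move=> Lu; rewrite -[X in _ --> X]addr0 -[X in _ --> _ + X](mulr0 c).
  apply: cvgD; apply: cvgM; [exact: cvg_cst|exact: lim|exact: cvg_cst|exact: e0].
split.
  rewrite -(pmulr_rge0 _ k0) -(cvg_lim _ (limc _ (Re dl) g1))//.
  apply: limr_ge; first by apply: cvgP (limc _ (Re dl) g1).
  by apply: nearW => n; exact: (mainR n).1.
have := limc _ (Im dl) g2; rewrite (funext (fun n => (mainR n).2)) => h.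
have hc : (fun=> 0 : R) n @[n --> \oo] --> (0 : R) by exact: cvg_cst.
have hz : ksqrt R * \int[mu]_t (Im (g t) * cabs2 (T phi t)) = 0.
  exact: (cvg_unique _ h hc).
move/eqP: hz.
by rewrite mulf_eq0 gt_eqF// => /eqP.
Qed.

End PosdefIntegral.

(** * From quadratic inequalities to pointwise positivity *)

Section Positivity.
Variable R : realType.
Local Notation mu := (@lebesgue_measure R).
Implicit Types (z w : R[i]) (f g h : R -> R[i]).

Lemma n2_cut_cvg f : sL2 f -> n2 (cut n f) @[n --> \oo] --> n2 f.
Proof.
move=> Sf; have [mf Lf] := Sf.
have m n : measurable_fun [set: R] (fun x => cabs2 (cut n f x)).
  exact: measurable_cabs2 (cmeas_cut n mf).
have c x : cabs2 (cut n f x) @[n --> \oo] --> cabs2 (f x).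
  apply: cvg_near_cst; near=> n.
  rewrite /cut ifT//; near: n; exact: nbhs_infty_ger.
have b n x : `|cabs2 (cut n f x)| <= cabs2 (f x).
  by rewrite ger0_norm ?cabs2_ge0// /cut; case: ifP => // _; rewrite cabs20 cabs2_ge0.
by have [] := Int_DCT m c Lf b.
Unshelve. all: by end_near. Qed.

Lemma cabs2_diff_le z w (s : R) : 0 < s ->
  `|cabs2 z - cabs2 w| <= (1 + s^-1) * cabs2 (z - w) + s * cabs2 w.
Proof.
move=> s0; set d := z - w.
have -> : z = d + w by rewrite /d subrK.
have s0' : 0 < s^-1 by rewrite invr_gt0.
set c := Re d * Re w + Im d * Im w.
have -> : cabs2 (d + w) - cabs2 w = cabs2 d + 2 * c.
  by rewrite !cabs2E ReD ImD /c; ring.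
have h : 2 * `|c| <= s^-1 * cabs2 d + s * cabs2 w.
  have h1 : 0 <= s^-1 * ((Re d - s * Re w) ^+ 2 + (Im d - s * Im w) ^+ 2).
    by rewrite mulr_ge0 ?addr_ge0 ?sqr_ge0// ltW.
  have h2 : 0 <= s^-1 * ((Re d + s * Re w) ^+ 2 + (Im d + s * Im w) ^+ 2).
    by rewrite mulr_ge0 ?addr_ge0 ?sqr_ge0// ltW.
  have e1 : s^-1 * ((Re d - s * Re w) ^+ 2 + (Im d - s * Im w) ^+ 2) =
    s^-1 * cabs2 d + s * cabs2 w - 2 * c.
    by rewrite !cabs2E /c; field; rewrite gt_eqF.
  have e2 : s^-1 * ((Re d + s * Re w) ^+ 2 + (Im d + s * Im w) ^+ 2) =
    s^-1 * cabs2 d + s * cabs2 w + 2 * c.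
    by rewrite !cabs2E /c; field; rewrite gt_eqF.
  by case: (ger0P c) => _; lra.
have d0 := cabs2_ge0 d.
apply: (le_trans (ler_normD _ _)); rewrite normrM (ger0_norm d0) (ger0_norm (ler0n _ 2)); lra.
Qed.

Lemma Lint_ind_cut (m : nat) (b : R -> bool) : measurable_fun [set: R] b ->
  cLint (fun x => (if (`|x| <= m%:R) && b x then 1 else 0)%:C%C : R[i]) /\
  sL2 (fun x => (if (`|x| <= m%:R) && b x then 1 else 0)%:C%C : R[i]).
Proof.
move=> mb.
have mc : measurable_fun [set: R] (fun x : R => (if (`|x| <= m%:R) && b x then 1 else 0 : R)).
  apply: measurable_fun_ifT => //.
  by apply: measurable_and => //; apply: measurable_fun_ler => //; exact: measurableT_comp.
split.
  split => /=; last exact: Lint0.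
  apply: Lint_le (Lint_ball m%:R) => // x.
  by case: ifP => [/andP[-> _]|_]; rewrite ?normr1// normr0; case: ifP.
apply: (sL2_le (cmeas_real mc) (Lint_ball m%:R)) => x.
by rewrite cabs2_real; case: ifP => [/andP[-> _]|_]; rewrite ?expr1n// expr0n; case: ifP.
Qed.

(** The spectra |T phi|^2 approximate the indicator: take [phi] the inverse transform of [u], cut to
    a ball. By [T_dual] and Plancherel the squared L_2 error of T (cut N phi) is exactly n2 u - 2 pi
    n2 (cut N phi), which tends to 0 because n2 u = 2 pi n2 phi. *)
Lemma Int_ge0_of_transform (gam : R -> R) (M : R) (m : nat) (b : R -> bool) :
  Lint gam -> (forall x, `|gam x| <= M) ->
  (forall (phi : R -> R[i]) (K N : R), cmeas phi -> (forall x, cabs2 (phi x) <= K) -> 0 < N ->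
     (forall x, N < `|x| -> phi x = 0) -> 0 <= \int[mu]_t (gam t * cabs2 (T phi t))) ->
  measurable_fun [set: R] b ->
  0 <= \int[mu]_t (gam t * (if (`|t| <= m%:R) && b t then 1 else 0)).
Proof.
move=> Lg gM hpos mb.
have M0 : 0 <= M by apply: le_trans (gM 0).
have [Lu Su] := Lint_ind_cut m mb.
set u := (fun x => _%:C%C) in Lu Su.
have uE x : (if (`|x| <= m%:R) && b x then 1 else 0) = cabs2 (u x).
  by rewrite /u cabs2_real; case: ifP; rewrite ?expr1n ?expr0n.
rewrite (eq_Int (fun t => congr1 (fun c => gam t * c) (uE t))).
have [P PE] : exists P : R, P = 2 * pi by exists (2 * pi).
have P0 : 0 < P by rewrite PE twopi_gt0.
pose c : R[i] := P^-1%:C%C.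
have [STu ETu] := plancherel Lu Su.
pose phi x := c * T u (- x).
have Sphi : sL2 phi by exact/sL2Z/sL2_opp.
have Ephi : P * n2 phi = n2 u.
  rewrite /phi (n2Z _ (sL2_opp STu)) (n2_opp STu) ETu cabs2_real -PE.
  by field; rewrite gt_eqF.
have [K hK] := T_bound Lu.
have phiK x : cabs2 (phi x) <= cabs2 c * K.
  by rewrite cabs2M ler_wpM2l// cabs2_ge0.
have [mphi _] := Sphi.
have Ig : Lint (fun t => gam t * cabs2 (u t)).
  have [_ Lu2] := Su.
  apply: (@eq_Lint _ (fun t => cabs2 (u t) * gam t)); first by move=> t; rewrite mulrC.
  exact: Lint_bddM Lu2 (Lint_meas Lg) gM.
apply/ler_addgt0Pl => eps eps0.
(* In [cabs2_diff_le], [s] spends eps/2 on the term in n2 u; [k] below leaves the other half for the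
   squared error. *)
pose s := eps / (2 * (M * n2 u + 1)).
have q0 : 0 <= M * n2 u by rewrite mulr_ge0 ?n2_ge0.
have s0 : 0 < s by rewrite divr_gt0 ?mulr_gt0//; lra.
have hs : M * (s * n2 u) <= eps / 2.
  rewrite -subr_ge0.
  have -> : eps / 2 - M * (s * n2 u) = s by rewrite /s; field; rewrite gt_eqF//; lra.
  exact: ltW.
pose k := M * (1 + s^-1) + 1.
have k0 : 0 < k.
  by rewrite ltr_wpDl// mulr_ge0// addr_ge0// invr_ge0 ltW.
have e2 : 0 < eps / (2 * k * P) by apply: divr_gt0 => //; apply: mulr_gt0 => //; apply: mulr_gt0.
move/cvgrPdist_le: (n2_cut_cvg Sphi) => /(_ _ e2)[N0 _ hN0].
pose N := N0.+1.
have hN : n2 phi - n2 (cut N phi) <= eps / (2 * k * P).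
  exact: le_trans (ler_norm _) (hN0 N (leqnSn _)).
have Lp := cLint_cut N Sphi.
have Sp := sL2_cut N Sphi.
have [STp ETp] := plancherel Lp Sp.
have ED : n2 (fun t => T (cut N phi) t - u t) = n2 u - P * n2 (cut N phi).
  rewrite (n2B STp Su) ETp (T_dual Lp Lu) -PE.
  have -> : ip (cut N phi) (fun x => T u (- x)) = P * n2 (cut N phi).
    rewrite /ip /n2 -IntZ; last by case: Sp.
    apply: eq_Int => x; rewrite /cut; case: ifP => _; last by rewrite !mul0r cabs20 mulr0 addr0.
    by rewrite cabs2E /phi !ReImE /c /=; field; rewrite gt_eqF.
  ring.
have hpos' := hpos (cut N phi) (cabs2 c * K) N%:R (cmeas_cut N mphi) _ _ _.
have {hpos'} hp : 0 <= \int[mu]_t (gam t * cabs2 (T (cut N phi) t)).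
  apply: hpos'.
  - move=> x; rewrite /cut; case: ifP => // _.
    by rewrite cabs20 (le_trans (cabs2_ge0 _) (phiK 0)).
  - by rewrite ltr0n.
  - by move=> x; rewrite ltNge /cut => /negbTE ->.
have IT : Lint (fun t => gam t * cabs2 (T (cut N phi) t)).
  have [_ L2] := STp.
  apply: (@eq_Lint _ (fun t => cabs2 (T (cut N phi) t) * gam t)); first by move=> t; rewrite mulrC.
  exact: Lint_bddM L2 (Lint_meas Lg) gM.
have SD := sL2B STp Su; have [_ LD] := SD; have [_ Lu2] := Su.
have LB : Lint (fun t => (1 + s^-1) * cabs2 (T (cut N phi) t - u t) + s * cabs2 (u t)).
  by apply: LintD; exact: LintZ.
have hd : \int[mu]_t (gam t * cabs2 (T (cut N phi) t)) - \int[mu]_t (gam t * cabs2 (u t)) <=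
    M * ((1 + s^-1) * n2 (fun t => T (cut N phi) t - u t) + s * n2 u).
  rewrite -IntB// /n2 -!(IntZ _ Lu2) -(IntZ _ LD) -IntD; [|exact: LintZ|exact: LintZ].
  rewrite -IntZ//; apply: Int_le; [exact: LintB|exact: LintZ|].
  move=> t; rewrite -mulrBr; apply: (le_trans (ler_norm _)); rewrite normrM.
  by apply: ler_pM => //; exact: cabs2_diff_le.
have hP : P * (n2 phi - n2 (cut N phi)) <= eps / (2 * k).
  apply: (@le_trans _ _ (P * (eps / (2 * k * P)))); first by rewrite ler_wpM2l// ltW.
  by rewrite le_eqVlt; apply/orP; left; apply/eqP; field; rewrite !gt_eqF.
have hk : M * (1 + s^-1) * n2 (fun t => T (cut N phi) t - u t) <= eps / 2.
  rewrite ED -Ephi -mulrBr.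
  apply: (@le_trans _ _ (k * (eps / (2 * k)))).
    have nn : 0 <= P * (n2 phi - n2 (cut N phi)).
      by rewrite mulrBr Ephi -ED n2_ge0.
    apply: ler_pM => //; last by rewrite /k lerDl.
    by rewrite mulr_ge0// addr_ge0// invr_ge0 ltW.
  by rewrite le_eqVlt; apply/orP; left; apply/eqP; field; rewrite !gt_eqF.
move: hd; rewrite mulrDr mulrA; lra.
Qed.

(** Test on the part of a ball where [gam] is negative: the integral is both >= 0 and <= 0, so its
    integrand vanishes a.e. *)
Lemma ae_ge0_of_ind (gam : R -> R) : Lint gam ->
  (forall m (b : R -> bool), measurable_fun [set: R] b ->
     0 <= \int[mu]_t (gam t * (if (`|t| <= m%:R) && b t then 1 else 0))) ->
  \forall x \ae mu, 0 <= gam x.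
Proof.
move=> Lg h.
have mb : measurable_fun [set: R] (fun x => gam x < 0).
  by apply: measurable_fun_ltr => //; exact: Lint_meas.
have key (m : nat) : \forall x \ae mu,
    - (gam x * (if (`|x| <= m%:R) && (gam x < 0) then 1 else 0)) = 0.
  have Li : Lint (fun x => gam x * (if (`|x| <= m%:R) && (gam x < 0) then 1 else 0)).
    apply: (Lint_bddM Lg (M := 1)).
      apply: measurable_fun_ifT => //.
      by apply: measurable_and => //; apply: measurable_fun_ler => //; exact: measurableT_comp.
    by move=> x; case: ifP; rewrite ?normr1 ?normr0.
  have n0 x : 0 <= - (gam x * (if (`|x| <= m%:R) && (gam x < 0) then 1 else 0)).
    by case: ifP => [/andP[_ g0]|_]; rewrite ?mulr0 ?oppr0// mulr1 oppr_ge0 ltW.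
  apply: ae_Int_eq0 => //; first exact: LintN.
  apply/eqP; rewrite eq_le Int_ge0// andbT IntN// oppr_le0; exact: h.
apply: (ae_mp _ (ae_foralln key)) => x hx.
rewrite leNgt; apply/negP => g0.
have := hx (Num.truncn `|x|).+1; rewrite g0 andbT ltW ?truncnS_gt// mulr1.
by move/eqP; rewrite oppr_eq0 lt_eqF.
Qed.

Theorem fourier_ge0 (psi g : R -> R[i]) (M : R) : posdef psi -> cLint g ->
  (forall x, cabs2 (g x) <= M) -> (\forall x \ae mu, psi x = ksc (T g) x) ->
  \forall x \ae mu, 0 <= Re (g x) /\ Im (g x) = 0.
Proof.
move=> pd Lg gM hae; have [g1 g2] := Lg.
have b1 x : `|Re (g x)| <= 1 + M.
  by apply: (le_trans (normr_le_sqr1 _)); rewrite lerD2l (le_trans (Re_sqr_le _)).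
have b2 x : `|Im (g x)| <= 1 + M.
  by apply: (le_trans (normr_le_sqr1 _)); rewrite lerD2l (le_trans (Im_sqr_le _)).
have q phi K N := @posdef_quadratic _ psi g phi K N pd Lg hae.
have h1 : \forall x \ae mu, 0 <= Re (g x).
  apply: ae_ge0_of_ind => // m b mb; apply: (Int_ge0_of_transform m g1 b1) => // phi K N p1 p2 p3 p4.
  by have [] := q phi K N p1 p2 p3 p4.
have h2 : \forall x \ae mu, 0 <= Im (g x).
  apply: ae_ge0_of_ind => // m b mb; apply: (Int_ge0_of_transform m g2 b2) => // phi K N p1 p2 p3 p4.
  by have [_ ->] := q phi K N p1 p2 p3 p4.
have h3 : \forall x \ae mu, 0 <= - Im (g x).
  apply: ae_ge0_of_ind; first exact: LintN.
  move=> m b mb; apply: (Int_ge0_of_transform m (LintN g2) (M := 1 + M)) => //.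
    by move=> x; rewrite normrN.
  move=> phi K N p1 p2 p3 p4; have [_ e] := q phi K N p1 p2 p3 p4.
  have L : Lint (fun t => Im (g t) * cabs2 (T phi t)).
    have Lp := cLint_phi p1 p2 p4; have [K' hK'] := T_bound Lp.
    apply: (Lint_bddM g2 (measurable_cabs2 (cmeas_T Lp)) (M := K')) => t.
    by rewrite ger0_norm ?cabs2_ge0.
  have -> : \int[mu]_t (- Im (g t) * cabs2 (T phi t)) = - \int[mu]_t (Im (g t) * cabs2 (T phi t)).
    by rewrite -IntN//; apply: eq_Int => t; rewrite mulNr.
  by rewrite e oppr0.
apply: (ae_mp2 _ h1 (ae_mp2 _ h2 h3 : \forall x \ae mu, Im (g x) = 0)) => //.
by move=> x a b; apply/eqP; rewrite eq_le a andbT -oppr_ge0.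
Qed.

End Positivity.

(** * Lower Riesz bound from interpolation *)

Section SeqSums.
Variable R : realType.

Lemma cvg_sum_seq (I : Type) (r : seq I) (u : I -> nat -> R) (l : I -> R) :
  (forall j, u j n @[n --> \oo] --> l j) ->
  \sum_(j <- r) u j n @[n --> \oo] --> \sum_(j <- r) l j.
Proof.
move=> h; elim: r => [|j r ih].
  by under eq_fun do rewrite big_nil; rewrite big_nil; exact: cvg_cst.
by under eq_fun do rewrite big_cons; rewrite big_cons; apply: cvgD.
Qed.

Lemma sum_uniq_le (I : eqType) (r s : seq I) (f : I -> R) : uniq r -> uniq s ->
  (forall j, 0 <= f j) -> (forall j, j \notin s -> f j = 0) ->
  \sum_(j <- r) f j <= \sum_(j <- s) f j.
Proof.
move=> ur us f0 fs.
rewrite (bigID (mem s))/= [X in _ + X]big1 ?addr0; last by move=> j /fs.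
rewrite -big_filter [leRHS](bigID (mem r))/= -[X in _ <= X + _]big_filter.
rewrite (perm_big [seq j <- s | j \in r])/=; last first.
  apply: uniq_perm; rewrite ?filter_uniq// => j.
  by rewrite !mem_filter andbC.
by rewrite lerDl sumr_ge0.
Qed.

(** Cauchy-Schwarz with prescribed radii in place of norms; they must be positive because the
    termwise inequality uses the weights B/A and A/B. *)
Lemma sum_CS (I : Type) (r : seq I) (a b : I -> R) (A B : R) : 0 < A -> 0 < B ->
  \sum_(j <- r) a j ^+ 2 <= A ^+ 2 -> \sum_(j <- r) b j ^+ 2 <= B ^+ 2 ->
  `|\sum_(j <- r) a j * b j| <= A * B.
Proof.
move=> A0 B0 ha hb.
have p j : `|a j * b j| <= 2^-1 * (B / A) * a j ^+ 2 + 2^-1 * (A / B) * b j ^+ 2.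
  have -> : 2^-1 * (B / A) * a j ^+ 2 + 2^-1 * (A / B) * b j ^+ 2 =
    2^-1 * (A * B)^-1 * ((B * a j) ^+ 2 + (A * b j) ^+ 2).
    by field; rewrite !gt_eqF.
  have AB : 0 < A * B by rewrite mulr_gt0.
  rewrite -mulrA mulrCA ler_pdivlMl//.
  rewrite -[A * B](gtr0_norm AB) -normrM ler_norml; apply/andP; split.
    by rewrite -subr_ge0 -(pmulr_rge0 _ (ltr0Sn R 1)); have := sqr_ge0 (B * a j + A * b j); nra.
  by rewrite -subr_ge0 -(pmulr_rge0 _ (ltr0Sn R 1)); have := sqr_ge0 (B * a j - A * b j); nra.
apply: (le_trans (ler_norm_sum _ _ _)).
apply: (le_trans (ler_sum _ (fun j _ => p j))).
rewrite big_split/= -!mulr_sumr.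
have c1 : 0 <= 2^-1 * (B / A) by rewrite mulr_ge0 ?divr_ge0 ?invr_ge0 ?(ltW A0) ?(ltW B0).
have c2 : 0 <= 2^-1 * (A / B) by rewrite mulr_ge0 ?divr_ge0 ?invr_ge0 ?(ltW A0) ?(ltW B0).
apply: (le_trans (lerD (ler_wpM2l c1 ha) (ler_wpM2l c2 hb))).
by rewrite le_eqVlt; apply/orP; left; apply/eqP; field; rewrite !gt_eqF.
Qed.

End SeqSums.

(** * Uniform boundedness by a gliding hump *)

Section UniformBoundedness.
Variable R : realType.
Variable (I : eqType).
Variables (r : nat -> seq I) (a : nat -> I -> R) (nu : nat -> R).
Hypotheses (ur : forall n, uniq (r n)) (nu0 : forall n, 0 < nu n).
Hypothesis nuE : forall n, \sum_(j <- r n) a n j ^+ 2 = nu n ^+ 2.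

(** All weights after p n add up to p n / 2, so later humps can spoil at most half of the gain at
    step [n]. *)
Let p n : R := 3^-1 ^+ n.+1.
Let v n j : R := if j \in r n then a n j / nu n else 0.
Let ell n (x : I -> R) := \sum_(j <- r n) a n j * x j.

Let p0 n : 0 < p n. Proof. by rewrite exprn_gt0. Qed.

Let v1 n s : uniq s -> \sum_(j <- s) v n j ^+ 2 <= 1.
Proof.
move=> us; apply: (@le_trans _ _ (\sum_(j <- r n) v n j ^+ 2)).
  apply: sum_uniq_le => //.
    by move=> j; exact: sqr_ge0.
  by move=> j js; rewrite /v (negbTE js) expr0n.
rewrite (eq_big_seq (fun j => (nu n ^-2) * a n j ^+ 2)); last first.
  by move=> j js; rewrite /v js exprMn exprVn mulrC.
by rewrite -mulr_sumr nuE mulVf// expf_neq0// gt_eqF.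
Qed.

Let ell_v n : ell n (v n) = nu n.
Proof.
rewrite /ell (eq_big_seq (fun j => (nu n)^-1 * a n j ^+ 2)); last first.
  by move=> j js; rewrite /v js; ring.
by rewrite -mulr_sumr nuE expr2 mulrA mulVf ?mul1r// gt_eqF.
Qed.

Let ell_v_le n m : `|ell n (v m)| <= nu n.
Proof.
rewrite -[leRHS]mulr1; apply: sum_CS => //; first by rewrite nuE.
by rewrite expr1n; exact: v1.
Qed.

(* The sign avoids cancellation with the earlier humps. *)
Fixpoint hump n : I -> R := if n is n'.+1 then
    fun j => hump n' j + (if 0 <= ell n' (hump n') then 1 else - 1) * p n' * v n' j
  else fun=> 0.

Let sg n : R := if 0 <= ell n (hump n) then 1 else - 1.
Let sg1 n : `|sg n| = 1. Proof. by rewrite /sg; case: ifP; rewrite ?normrN normr1. Qed.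
Let humpS n j : hump n.+1 j = hump n j + sg n * p n * v n j. Proof. by []. Qed.

Let ell_lin n (x y : I -> R) c : ell n (fun j => x j + c * y j) = ell n x + c * ell n y.
Proof.
rewrite /ell mulr_sumr -big_split/=; apply: eq_bigr => j _; ring.
Qed.

Let ell_hump n : p n * nu n <= `|ell n (hump n.+1)|.
Proof.
rewrite /= -/(sg n) ell_lin ell_v.
have pn : 0 < p n * nu n by rewrite mulr_gt0.
rewrite /sg; case: ifP => [e0|/negbT]; first by rewrite mul1r ger0_norm ?addr_ge0 ?(ltW pn)// lerDr.
by rewrite -ltNge => e0; rewrite mulN1r mulNr ler_normr; apply/orP; right; lra.
Qed.

(** The factor (1 - 3^-k) / 2 is the sum of 3^-i for i from 1 to k. *)
Let ell_tail n k : `|ell n (hump (n.+1 + k)) - ell n (hump n.+1)| <= nu n * (p n / 2 * (1 - 3^-1 ^+ k)).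
Proof.
elim: k => [|k ih]; first by rewrite addn0 subrr normr0 expr0 subrr !mulr0.
rewrite addnS /= -/(sg _) ell_lin.
set q := n.+1 + k in ih *.
have h : `|sg q * p q * ell n (v q)| <= p q * nu n.
  by rewrite normrM (normrM (sg q)) sg1 mul1r (gtr0_norm (p0 q)) ler_wpM2l ?(ltW (p0 q)).
have pq : p q = p n * 3^-1 ^+ k.+1 by rewrite /p -exprD /q addnS.
rewrite addrAC; apply: (le_trans (ler_normD _ _)).
apply: (le_trans (lerD ih h)).
by rewrite pq exprS le_eqVlt; apply/orP; left; apply/eqP; field.
Qed.

(** The weights used so far add up to (1 - 3^-n) / 2. The larger radius keeps [sum_CS] applicable at
    n = 0, where the exact one would be 0. *)
Let hump_norm n s : uniq s -> \sum_(j <- s) hump n j ^+ 2 <= (1 - 3^-1 ^+ n / 2) ^+ 2.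
Proof.
move=> us; elim: n => [|n ih].
  rewrite /= big1 => [|j _]; [exact: sqr_ge0|by rewrite expr0n].
have e : 0 < 3^-1 ^+ n :> R by rewrite exprn_gt0.
have e1 : 3^-1 ^+ n <= 1 :> R by apply: exprn_ile1; lra.
have A0 : 0 < 1 - 3^-1 ^+ n / 2 :> R by lra.
have hw : \sum_(j <- s) (sg n * p n * v n j) ^+ 2 <= p n ^+ 2.
  have -> : \sum_(j <- s) (sg n * p n * v n j) ^+ 2 = p n ^+ 2 * \sum_(j <- s) v n j ^+ 2.
    rewrite mulr_sumr; apply: eq_bigr => j _.
    by rewrite !exprMn -[sg n ^+ 2](real_normK (num_real _)) sg1 expr1n mul1r.
  by rewrite ler_piMr ?sqr_ge0//; exact: v1.
have hc := sum_CS A0 (p0 n) ih hw.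
have -> : \sum_(j <- s) hump n.+1 j ^+ 2 = \sum_(j <- s) hump n j ^+ 2 +
    2 * (\sum_(j <- s) hump n j * (sg n * p n * v n j)) + \sum_(j <- s) (sg n * p n * v n j) ^+ 2.
  by rewrite mulr_sumr -!big_split/=; apply: eq_bigr => j _; rewrite -/(sg n); ring.
have -> : (1 - 3^-1 ^+ n.+1 / 2) ^+ 2 = ((1 - 3^-1 ^+ n / 2) + p n) ^+ 2 :> R.
  by congr (_ ^+ 2); rewrite /p exprS; field.
have := ler_norm (\sum_(j <- s) hump n j * (sg n * p n * v n j)).
rewrite sqrrD; move: hc ih hw; lra.
Qed.

Let hump_cvg j : cvgn (fun n => hump n j).
Proof.
pose w n := sg n * p n * v n j.
have -> : (fun n => hump n j) = series w.
  apply/funext => n; rewrite /series/=; elim: n => [|n ih]; first by rewrite big_geq.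
  by rewrite humpS big_nat_recr//= ih.
apply: normed_cvg; apply: (@series_le_cvg _ _ (geometric 1 3^-1)).
- by move=> n; exact: normr_ge0.
- by move=> n; rewrite /geometric/= mul1r exprn_ge0.
- move=> n; rewrite /= /w normrM (normrM (sg n)) sg1 mul1r (gtr0_norm (p0 n)) mul1r.
  have vv : `|v n j| <= 1.
    have := @v1 n [:: j] isT; rewrite big_seq1 -[v n j ^+ 2](real_normK (num_real _)).
    by rewrite expr_le1.
  apply: (@le_trans _ _ (p n)); first by rewrite ler_piMr ?(ltW (p0 n)).
  rewrite /p exprS ler_piMl ?exprn_ge0//; lra.
- by apply: is_cvg_geometric_series; rewrite ger0_norm; lra.
Qed.

(** The limit is taken coordinatewise, and membership in the unit ball of l_2 is expressed by finite
    sums, which pass to the limit. Step [n] gains nu n * p n, of which the tail takes back at most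
    half. *)
Lemma gliding_hump : exists2 x : I -> R,
  (forall s, uniq s -> \sum_(j <- s) x j ^+ 2 <= 1) &
  forall n, nu n * (3^-1 ^+ n.+1 / 2) <= `|\sum_(j <- r n) a n j * x j|.
Proof.
pose x j := limn (fun n => hump n j).
exists x.
  move=> s us.
  have c : \sum_(j <- s) hump n j ^+ 2 @[n --> \oo] --> \sum_(j <- s) x j ^+ 2.
    by apply: cvg_sum_seq => j; apply: cvgM; exact: hump_cvg.
  rewrite -(cvg_lim _ c)//; apply: limr_le; first by apply: cvgP c.
  apply: nearW => n; apply: (le_trans (hump_norm n us)).
  have e : 0 < 3^-1 ^+ n :> R by rewrite exprn_gt0.
  have e1 : 3^-1 ^+ n <= 1 :> R by apply: exprn_ile1; lra.
  by rewrite expr_le1//; lra.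
move=> n.
have c : ell n (hump (n.+1 + k)) @[k --> \oo] --> ell n x.
  apply: cvg_sum_seq => j; apply: cvgM; first exact: cvg_cst.
  have hj : hump k j @[k --> \oo] --> x j by exact: (@hump_cvg j).
  have e : (fun k => hump (n.+1 + k) j) = (fun k => hump (k + n.+1)%N j).
    by apply/funext => k; rewrite addnC.
  by rewrite e; move: hj; rewrite -(cvg_shiftn n.+1).
have h : `|ell n x - ell n (hump n.+1)| <= nu n * (p n / 2).
  have c2 : `|ell n (hump (n.+1 + k)) - ell n (hump n.+1)| @[k --> \oo] --> `|ell n x - ell n (hump n.+1)|.
    by apply: cvg_norm; apply: cvgB => //; exact: cvg_cst.
  rewrite -(cvg_lim _ c2)//; apply: limr_le; first by apply: cvgP c2.
  apply: nearW => k; apply: (le_trans (ell_tail n k)).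
  apply: ler_wpM2l; first exact: ltW.
  apply: ler_piMr; first by apply: divr_ge0 => //; exact: ltW.
  have : 0 <= 3^-1 ^+ k :> R by apply: exprn_ge0.
  lra.
have := ell_hump n; rewrite -/(p n) -/(ell n x).
have : `|ell n (hump n.+1)| <= `|ell n x| + `|ell n x - ell n (hump n.+1)|.
  by have := ler_normB (ell n x) (ell n x - ell n (hump n.+1)); rewrite subKr.
move: h; lra.
Qed.

End UniformBoundedness.

(** [F] is a family of finitely supported functionals on real l_2, each given with a list that
    carries its coefficients. *)
Theorem uniform_boundedness (R : realType) (I : eqType) (F : seq I -> (I -> R) -> Prop) :
  (forall r a, F r a -> uniq r) ->
  (forall c : I -> R, (forall s, uniq s -> \sum_(j <- s) c j ^+ 2 <= 1) ->
     exists K, forall r a, F r a -> `|\sum_(j <- r) a j * c j| <= K) ->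
  exists K, forall r a, F r a -> \sum_(j <- r) a j ^+ 2 <= K.
Proof.
move=> Fu hF; apply: contrapT => hn.
(* Squared norms beyond 16^n give norms beyond 4^n, which outgrow the hump weights 3^-(n+1). *)
have ex n : exists ra : seq I * (I -> R), F ra.1 ra.2 /\ 16 ^+ n < \sum_(j <- ra.1) ra.2 j ^+ 2.
  apply: contrapT => hm; apply: hn; exists (16 ^+ n) => r a Fra.
  rewrite leNgt; apply/negP => h; apply: hm; by exists (r, a).
have [ra raP] := choice ex.
pose nu n : R := Num.sqrt (\sum_(j <- (ra n).1) (ra n).2 j ^+ 2).
have pos n : 0 < \sum_(j <- (ra n).1) (ra n).2 j ^+ 2.
  by apply: lt_trans (raP n).2; rewrite exprn_gt0.
have nu0 n : 0 < nu n by rewrite sqrtr_gt0.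
have nuE n : \sum_(j <- (ra n).1) (ra n).2 j ^+ 2 = nu n ^+ 2.
  by rewrite sqr_sqrtr// ltW.
have nu4 n : 4 ^+ n <= nu n.
  rewrite -(@ler_pXn2r _ 2)// ?nnegrE ?exprn_ge0 ?(ltW (nu0 n))// -nuE.
  rewrite -exprM mulnC exprM (_ : 4 ^+ 2 = 16 :> R); last by ring.
  exact: ltW (raP n).2.
have [x x1 hx] := gliding_hump (fun n => Fu _ _ (raP n).1) nu0 nuE.
have [K hK] := hF x x1.
have bound n : (4 / 3) ^+ n / 6 <= K.
  apply: le_trans (hK _ _ (raP n).1); apply: le_trans (hx n).
  apply: (@le_trans _ _ (4 ^+ n * (3^-1 ^+ n.+1 / 2))).
    by rewrite exprMn exprS le_eqVlt; apply/orP; left; apply/eqP; field.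
  by rewrite ler_wpM2r// divr_ge0// exprn_ge0.
have lin n : 1 + n%:R / 3 <= (4 / 3) ^+ n :> R.
  elim: n => [|n ih]; first by rewrite mul0r addr0 expr0.
  rewrite exprS -natr1; have : 0 <= n%:R :> R by []. move: ih; nra.
(* By the linear lower bound, (4/3)^n / 6 exceeds n / 18, which is now larger than |K|. *)
pose n := (Num.truncn (`|K| * 18)).+1.
have hn1 : `|K| * 18 < n%:R by exact: truncnS_gt.
have := bound n; have := lin n; have := ler_norm K; lra.
Qed.

(** * Paley-Wiener functions as transforms, and the lower bound for exponential sums *)

Section LowerRiesz.
Variable R : realType.
Local Notation mu := (@lebesgue_measure R).
Implicit Types (z w : R[i]) (f g h : R -> R[i]).

Lemma l2norm2_ge (c : int -> R[i]) (r : seq int) : uniq r ->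
  ((\sum_(j <- r) cabs2 (c j))%:E <= l2norm2 c)%E.
Proof.
move=> ur; apply: esum_ge; exists [set` r].
  by split => //; exact: finite_seq.
by rewrite -fsbig_seq// sumEFin.
Qed.

Lemma l2norm2_le (c : int -> R[i]) (C : R) :
  (forall r, uniq r -> \sum_(j <- r) cabs2 (c j) <= C) -> (l2norm2 c <= C%:E)%E.
Proof.
move=> h; apply: ge_ereal_sup => _ [X [finX _]] <-.
rewrite fsbig_finite// sumEFin lee_fin; apply: h.
exact: finmap.fset_uniq.
Qed.

(** Licenses the choice of representatives of the transform: supported in a window, bounded
    everywhere, or nonnegative everywhere. *)
Lemma is_fourier_ae (psi g g' : R -> R[i]) : isL2 psi -> is_fourier psi g -> cmeas g' ->
  (\forall x \ae mu, g x = g' x) -> is_fourier psi g' /\ sL2 g'.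
Proof.
move=> /isL2P Sp [/isL2P Sg hF] mg' gg'.
have Sg' : sL2 g'.
  split => //; have [mg Lg] := Sg.
  apply: ge0_Lint; first exact: measurable_cabs2.
    by move=> x; exact: cabs2_ge0.
  rewrite -(@ge0_ae_eq_integral _ _ _ mu setT (fun x => (cabs2 (g x))%:E)).
  - by rewrite Lint_EFin// ltry.
  - by [].
  - by apply/measurable_EFinP; exact: measurable_cabs2.
  - by apply/measurable_EFinP; exact: measurable_cabs2.
  - by move=> x _; rewrite lee_fin cabs2_ge0.
  - by move=> x _; rewrite lee_fin cabs2_ge0.
  - by apply: (ae_mp _ gg') => x -> _.
split => //; split; first exact/isL2P.
move=> e e0; have [N0 hN] := hF e e0; exists N0 => N NN.
apply: le_lt_trans (hN N NN).
have LN := cLint_cut N Sp; have SN := sL2_cut N Sp.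
have [STN _] := plancherel LN SN.
have SA : sL2 (fun xi => FT_trunc psi N xi).
  by rewrite (funext (FT_truncE psi N)); exact/sL2Z/(sL2_opp STN).
have [m1 _] := sL2B SA Sg; have [m2 _] := sL2B SA Sg'.
rewrite /L2norm2 le_eqVlt; apply/orP; left; apply/eqP.
apply: ge0_ae_eq_integral => //.
- by apply/measurable_EFinP; exact: measurable_cabs2.
- by apply/measurable_EFinP; exact: measurable_cabs2.
- by move=> x _; rewrite lee_fin cabs2_ge0.
- by move=> x _; rewrite lee_fin cabs2_ge0.
- by apply: (ae_mp _ gg') => x -> _.
Qed.

Lemma continuous_ae_eq (u v : R -> R) : continuous u -> continuous v ->
  (\forall x \ae mu, u x = v x) -> u =1 v.
Proof.
move=> cu cv uv x; apply/eqP; rewrite -subr_eq0; apply/negPn/negP => ne.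
have e0 : 0 < `|u x - v x| by rewrite normr_gt0.
have cd : (fun y => u y - v y) y @[y --> x] --> u x - v x.
  by apply: cvgB; [exact: cu|exact: cv].
move/cvgrPdist_lt: cd => /(_ _ e0)/nbhs_ballP[d /= d0 hd].
have [|y [y1 y2 e]] := @ae_exists_itv _ _ x (x + d / 2) _ uv.
  by rewrite ltrDl divr_gt0.
have hb : ball x d y.
  have d2 : d = d / 2 + d / 2 by field.
  by rewrite /ball/= ltr_norml; apply/andP; split; lra.
by have := hd y hb; rewrite /= e subrr subr0 ltxx.
Qed.

(** Centres other than 0 occur because the upper Riesz bound is applied on every translate of the
    torus. *)
Definition win (s : R) f t := if `|t - s| <= pi then f t else 0.

Lemma Lint_win1 (s : R) : Lint (fun t : R => if `|t - s| <= pi then 1 else 0).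
Proof. by have := Lint_shift (- s) (Lint_ball (@pi R)). Qed.

Lemma measurable_win1 (s : R) : measurable_fun [set: R] (fun t : R => `|t - s| <= pi).
Proof. exact: (measurableT_comp (@measurable_ball R pi) (measurable_shift (- s))). Qed.

Lemma cmeas_win s f : cmeas f -> cmeas (win s f).
Proof. by move=> mf; exact: cmeas_if (measurable_win1 s) mf. Qed.

Lemma cabs2_win s f t : cabs2 (win s f t) = (if `|t - s| <= pi then 1 else 0) * cabs2 (f t).
Proof. by rewrite /win; case: ifP; rewrite ?mul1r// mul0r cabs20. Qed.

Lemma sL2_win s f : sL2 f -> sL2 (win s f).
Proof. by move=> Sf; exact: sL2_if (measurable_win1 s) Sf. Qed.

Lemma sL2_win_bdd s f (M : R) : cmeas f -> (forall t, cabs2 (f t) <= M) -> sL2 (win s f).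
Proof.
move=> mf fM; apply: (sL2_le (cmeas_win s mf) (LintZ M (Lint_win1 s))) => t.
by rewrite /win; case: ifP; rewrite ?mulr1// mulr0 cabs20.
Qed.

Lemma cLint_win s f : sL2 f -> cLint (win s f).
Proof. by move=> Sf; exact: cLint_if (Lint_win1 s) Sf. Qed.

Lemma ccontinuous_ksc f : cLint f -> ccontinuous (ksc (T f)).
Proof.
move=> Lf; split.
  have -> : (fun x => Re (ksc (T f) x)) = fun x => ksqrt R * Re (T f x).
    by apply/funext => x; rewrite /ksc !ReImE /= mul0r subr0.
  by move=> x; apply: cvgM; [exact: cvg_cst|exact: continuous_ReT].
have -> : (fun x => Im (ksc (T f) x)) = fun x => ksqrt R * Im (T f x).
  by apply/funext => x; rewrite /ksc !ReImE /= mul0r addr0.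
by move=> x; apply: cvgM; [exact: cvg_cst|exact: continuous_ImT].
Qed.

(** A square-integrable transform supported in a bounded window is integrable, so inversion applies;
    continuity of both sides removes the exceptional null set. *)
Lemma PW_repr f : isPW f -> exists G, [/\ sL2 G, cLint G,
  (forall t, ~~ (`|t| <= pi) -> G t = 0) & forall x, f x = ksc (T G) x].
Proof.
move=> [Lf [c1 c2] [g [Fg g0]]].
have Sg : sL2 g by apply/isL2P; case: Fg.
pose G := win 0 g.
have mG : cmeas G by have [] := sL2_win 0 Sg.
have gG : \forall x \ae mu, g x = G x.
  apply: (ae_mp _ g0) => x hx; rewrite /G /win subr0; case: ifPn => // /negP hn.
  by apply: hx; rewrite -ler_norml.
have [FG SG] := is_fourier_ae Lf Fg mG gG.
have LG : cLint G by exact: cLint_win.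
exists G; split => //.
  by move=> t; rewrite /G /win subr0 => /negbTE ->.
have hae := fourier_inversion Lf FG LG.
have [cR cIm] := ccontinuous_ksc LG.
move=> x; apply: cplx_ext.
  by apply: (continuous_ae_eq c1 cR); apply: (ae_mp _ hae) => y ->.
by apply: (continuous_ae_eq c2 cIm); apply: (ae_mp _ hae) => y ->.
Qed.

Lemma sL2_win_esumc s (r : seq int) a (y : int -> R) : sL2 (win s (esumc r a y)).
Proof.
by apply: sL2_win_bdd; [exact: cmeas_esumc|move=> t; exact: esumc_bound].
Qed.

Lemma esumcZ (r : seq int) c a (y : int -> R) t :
  esumc r (fun j => c * a j) y t = c * esumc r a y t.
Proof. by rewrite /esumc mulr_sumr; apply: eq_bigr => j _; rewrite mulrA. Qed.

Lemma n2_win_esumcZ s (r : seq int) c a (y : int -> R) :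
  n2 (win s (esumc r (fun j => c * a j) y)) = cabs2 c * n2 (win s (esumc r a y)).
Proof.
rewrite -(n2Z _ (sL2_win_esumc s r a y)); apply: eq_Int => t.
by rewrite /win; case: ifP; rewrite ?mulr0// esumcZ.
Qed.

Lemma sum_dual (G : R -> R[i]) (r : seq int) (a : int -> R[i]) (xs : int -> R) :
  cLint G -> sL2 G -> (forall t, ~~ (`|t| <= pi) -> G t = 0) ->
  Re (\sum_(j <- r) (a j)^*%C * T G (xs j)) = ip G (win 0 (esumc r a (fun j => - xs j))).
Proof.
move=> LG SG G0.
have -> : \sum_(j <- r) (a j)^*%C * T G (xs j) =
    cI (fun t => \sum_(j <- r) (a j)^*%C * (G t * cis (xs j * t))).
  rewrite (cI_sum (F := fun j t => (a j)^*%C * (G t * cis (xs j * t)))); last first.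
    by move=> j _; exact/cLintZ/cLint_cis.
  by apply: eq_bigr => j _; rewrite cIZ//; exact: cLint_cis.
rewrite /cI /=; apply: eq_Int => t.
have -> : \sum_(j <- r) (a j)^*%C * (G t * cis (xs j * t)) =
    G t * (esumc r a (fun j => - xs j) t)^*%C.
  rewrite /esumc conj_sum mulr_sumr; apply: eq_bigr => j _.
  by rewrite conjM conj_cis mulNr opprK mulrCA.
rewrite /win subr0; case: ifPn => [_|/G0 ->]; last by rewrite mul0r /= !mul0r addr0.
by rewrite !ReImE; ring.
Qed.

(** For data [c] with interpolant [f], the number sum b_j c_j is a pairing of the transform of [f]
    with the exponential sum of [a], hence bounded over all exponential sums of norm at most 1.
    Uniform boundedness then bounds the coefficients. Real data reach the real parts of [a];
    multiplying [a] by - i reaches the imaginary parts. *)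
Theorem CIS_lower (xs : int -> R) : CIS xs -> exists2 K, 0 < K & forall r a, uniq r ->
  \sum_(j <- r) cabs2 (a j) <= K * n2 (win 0 (esumc r a (fun j => - xs j))).
Proof.
move=> cis_xs.
pose Q r a := n2 (win 0 (esumc r a (fun j => - xs j))).
pose F r (b : int -> R) := uniq r /\ exists a : int -> R[i], (forall j, b j = Re (a j)) /\ Q r a <= 1.
have [K hK] : exists K, forall r b, F r b -> \sum_(j <- r) b j ^+ 2 <= K.
  apply: uniform_boundedness; first by move=> r b [].
  move=> c hc.
  have hl2 : isl2 (fun j => (c j)%:C%C : R[i]).
    apply: (@le_lt_trans _ _ 1%:E); last exact: ltry.
    apply: l2norm2_le => r ur.
    by under eq_bigr do rewrite cabs2_real; exact: hc.
  have [f [PWf fc _]] := cis_xs _ hl2.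
  have [G [SG LG G0 fG]] := PW_repr PWf.
  exists (ksqrt R * (n2 G + 1)) => r b [ur [a [ba Qa]]].
  have k0 := ksqrt_gt0 R.
  have -> : \sum_(j <- r) b j * c j = ksqrt R * Re (\sum_(j <- r) (a j)^*%C * T G (xs j)).
    rewrite Re_sum mulr_sumr; apply: eq_bigr => j _.
    have h1 : Re (ksc (T G) (xs j)) = c j by rewrite -fG fc.
    have h2 : Im (ksc (T G) (xs j)) = 0 by rewrite -fG fc.
    have -> : ksqrt R * Re ((a j)^*%C * T G (xs j)) = Re ((a j)^*%C * ksc (T G) (xs j)).
      by rewrite /ksc !ReImE /=; ring.
    by rewrite ReM h1 h2 mulr0 subr0 Reconj ba.
  rewrite (sum_dual r a xs LG SG G0) normrM (gtr0_norm k0) ler_wpM2l ?(ltW k0)//.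
  have := ip_AMGM SG (sL2_win_esumc 0 r a (fun j => - xs j)) (@ltr01 R).
  rewrite invr1 !mul1r; have := n2_ge0 G; move: Qa; rewrite /Q; lra.
have K0 : 0 <= K by have := hK [::] (fun=> 0); rewrite big_nil; apply; split => //; exists (fun=> 0); split => //;
  rewrite /Q (_ : n2 _ = 0) ?ler01//; rewrite /n2 -(Int0 R); apply: eq_Int => t;
  rewrite /win /esumc big_nil; case: ifP; rewrite cabs20.
have hRe r a : uniq r -> \sum_(j <- r) Re (a j) ^+ 2 <= K * Q r a.
  move=> ur; apply/ler_addgt0Pl => e e0.
  have Q0 : 0 <= Q r a by exact: n2_ge0.
  (* The normalisation divides by the square root of Q + eta, because Q = 0 is not excluded at this
     point; the cost K eta is at most [e]. *)
  pose eta := e / (K + 1).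
  have eta0 : 0 < eta by rewrite divr_gt0// ltr_wpDl.
  pose s := (Num.sqrt (Q r a + eta))^-1.
  have q0 : 0 < Q r a + eta by rewrite ltr_wpDl.
  have s2 : s ^+ 2 = (Q r a + eta)^-1 by rewrite exprVn sqr_sqrtr// ltW.
  have := hK r (fun j => s * Re (a j)).
  have FF : F r (fun j => s * Re (a j)).
    split => //; exists (fun j => s%:C%C * a j); split.
      by move=> j; rewrite ReM /= mul0r subr0.
    by rewrite /Q n2_win_esumcZ cabs2_real s2 ler_pdivrMl// mulr1 lerDl ltW.
  move=> /(_ FF); under eq_bigr do rewrite exprMn s2.
  rewrite -mulr_sumr ler_pdivrMl// => h; apply: (le_trans h).
  rewrite mulrDl addrC lerD// ?[_ * K]mulrC//.
  by rewrite /eta mulrCA ler_piMr ?(ltW e0)// ler_pdivrMr ?ltr_wpDl// mul1r lerDl.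
(* Real and imaginary parts cost [K] each; the 1 makes the constant positive. *)
exists (2 * K + 1); first by rewrite ltr_wpDl ?mulr_ge0.
move=> r a ur.
have h1 := hRe r a ur.
have h2 := hRe r (fun j => (0 +i* (- 1))%C * a j) ur.
have e1 j : Re ((0 +i* (- 1))%C * a j) = Im (a j) by rewrite ReM /= mul0r sub0r mulN1r opprK.
move: h2; rewrite /Q n2_win_esumcZ (_ : cabs2 _ = 1); last by rewrite cabs2E /= expr0n add0r sqrrN expr1n.
rewrite mul1r; under eq_bigr do rewrite e1.
rewrite -/(Q r a) => h2.
have Q0 : 0 <= Q r a by exact: n2_ge0.
under eq_bigr do rewrite cabs2E.
rewrite big_split/=; move: h1 h2 Q0; rewrite /Q mulrDl mul1r -mulrA; lra.
Qed.

End LowerRiesz.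

(** * Upper Riesz bound from separation *)

Section Bessel.
Variable R : realType.
Local Notation mu := (@lebesgue_measure R).
Implicit Types (z w : R[i]) (f g h : R -> R[i]).

Lemma cos_ge1B (x : R) : 1 - `|x| <= cos x.
Proof.
wlog x0 : x / 0 < x.
  move=> h; have [x0|x0|<-] := ltgtP 0 x; first exact: h.
    by rewrite -normrN -cosN; apply: h; rewrite oppr_gt0.
  by rewrite normr0 cos0 subr0.
have [c _ e] := MVT x0 (fun y _ => is_derive_cos y) ltac:(by apply: continuous_subspaceT => y; exact: continuous_cos).
rewrite cos0 subr0 in e.
have := sin_le1 c; rewrite gtr0_norm// => s1.
have : sin c * x <= x by rewrite ler_piMl// ltW.
move: e; rewrite mulNr; lra.
Qed.

Lemma separated_of_lower (xs : int -> R) (K : R) : 0 < K ->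
  (forall r a, uniq r -> \sum_(j <- r) cabs2 (a j) <=
     K * n2 (win 0 (esumc r a (fun j => - xs j)))) ->
  exists2 d, 0 < d & forall j k, j != k -> d <= `|xs j - xs k|.
Proof.
move=> K0 hK.
(* The window length 2 pi, left unevaluated. The constant [C] rests on 2 - 2 cos u <= 2 |u|, where
   |u| <= pi |x_j - x_k| on the window. *)
pose W1 := \int[mu]_t (if `|t| <= @pi R then 1 else 0 : R).
have W0 : 0 <= W1 by apply: Int_ge0 => t; case: ifP.
have pi0 := pi_gt0 R.
pose C := K * (2 * pi * (W1 + 1)).
have C0 : 0 < C by rewrite !mulr_gt0// ltr_wpDl.
exists (2 / C); first by rewrite divr_gt0.
move=> j k jk; rewrite ler_pdivrMr//.
(* Two close nodes give nearly cancelling exponentials. *)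
pose a i : R[i] := if i == j then 1 else - 1.
have ur : uniq [:: j; k] by rewrite /= inE jk.
have := hK [:: j; k] a ur.
rewrite big_cons big_seq1 /a eqxx eq_sym (negbTE jk).
have -> : cabs2 (1 : R[i]) + cabs2 (- 1 : R[i]) = 2.
  by rewrite cabs2N cabs2E /= expr1n expr0n addr0.
move=> h; apply: (le_trans h).
have -> : `|xs j - xs k| * C = K * (2 * pi * `|xs j - xs k| * (W1 + 1)) by rewrite /C; ring.
apply: ler_wpM2l; first exact: ltW.
set d := `|xs j - xs k|.
have d0 : 0 <= d by exact: normr_ge0.
apply: (@le_trans _ _ (2 * pi * d * W1)); last first.
  by rewrite ler_wpM2l ?lerDl// !mulr_ge0// ltW.
rewrite /W1 -IntZ; last exact: Lint_ball.
apply: Int_le.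
- by have [_] := sL2_win_esumc 0 [:: j; k] a (fun j => - xs j).
- exact/LintZ/Lint_ball.
move=> t; rewrite cabs2_win subr0; case: ifP => tpi; last by rewrite mul0r mulr0.
rewrite mul1r mulr1 /esumc big_cons big_seq1 eqxx eq_sym (negbTE jk) mul1r.
have -> : cabs2 (cis (- xs j * t) + -1 * cis (- xs k * t)) = 2 - 2 * cos ((xs j - xs k) * t).
  rewrite cabs2E !ReImE /= !mulNr !cosN !sinN mulrBl cosB.
  have e1 := cos2Dsin2 (xs j * t); have e2 := cos2Dsin2 (xs k * t).
  move: e1 e2; move: (cos (xs j * t)) (sin (xs j * t)) (cos (xs k * t)) (sin (xs k * t)).
  move=> c1 s1 c2 s2 e1 e2.
  transitivity ((c1 ^+ 2 + s1 ^+ 2) + (c2 ^+ 2 + s2 ^+ 2) - 2 * (c1 * c2 + s1 * s2)).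
    by ring.
  by rewrite e1 e2; ring.
have := cos_ge1B ((xs j - xs k) * t); rewrite normrM -/d.
have : d * `|t| <= d * pi by rewrite ler_wpM2l.
move: (pi) => p; nra.
Qed.

Lemma cI_shift f (a : R) : cLint f -> cI (fun x => f (x + a)) = cI f.
Proof. by move=> [f1 f2]; apply: cplx_ext; [exact: Int_shift f1|exact: Int_shift f2]. Qed.

Lemma cLint_shift f (a : R) : cLint f -> cLint (fun x => f (x + a)).
Proof. by move=> [f1 f2]; split; [exact: Lint_shift f1|exact: Lint_shift f2]. Qed.

Lemma T_shift f (y t : R) : cLint f -> T (fun x => f (x - y)) t = cis (t * y) * T f t.
Proof.
move=> Lf; rewrite /T -(cI_shift (- y) (cLint_cis t Lf)) -cIZ.
  by apply: eq_cI => x; rewrite mulrCA -cisD; congr (_ * cis _); ring.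
exact: cLint_shift (cLint_cis t Lf).
Qed.

(** Attach to each node a translate of one bump of half-width [eta], modulated by the frequency [s].
    Disjointness gives n2 H = 2 eta sum |a_j|^2, while T H(- t) is the exponential sum times T b(-
    t), whose real part is at least [eta] on the window around [s]. The modulation makes the
    constant independent of [s]. *)
Theorem bessel (xs : int -> R) (d : R) : 0 < d ->
  (forall j k, j != k -> d <= `|xs j - xs k|) ->
  exists2 B, 0 < B & forall s r a, uniq r ->
    n2 (win s (esumc r a (fun j => - xs j))) <= B * \sum_(j <- r) cabs2 (a j).
Proof.
move=> d0 sep.
have pi0 := pi_gt0 R.
(* Half the separation keeps the bumps disjoint; 1/(2 pi) keeps |(s - t) x| <= 1/2 on the window, so
   that the cosine there is at least 1/2. *)
pose eta : R := Num.min (d / 2) (2 * pi)^-1.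
have eta0 : 0 < eta by rewrite lt_min divr_gt0//= invr_gt0 mulr_gt0.
have eta_d : 2 * eta <= d by rewrite -ler_pdivlMl// mulrC ge_min lexx.
have eta_pi : pi * eta <= 2^-1.
  apply: (@le_trans _ _ (pi * (2 * pi)^-1)).
    by rewrite ler_wpM2l ?(ltW pi0)// ge_min lexx orbT.
  by rewrite invfM mulrCA mulfV ?mulr1// gt_eqF.
pose ind (x : R) : R := ((- eta <= x) && (x < eta))%:R.
have [Lind Iind] : Lint ind /\ \int[mu]_x ind x = 2 * eta.
  have [h1 h2] := @Int_indic_itvco R (- eta) eta ltac:(lra).
  by split => //; rewrite h2; ring.
have ind01 x : ind x = 0 \/ ind x = 1.
  by rewrite /ind; case: (_ && _); [right|left].
have ind_sq x : ind x ^+ 2 = ind x by case: (ind01 x) => ->; rewrite ?expr0n ?expr1n.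
have ind0 x : 0 <= ind x by rewrite /ind.
(* The product of eta^-2 from the lower bound on [T b], 2 pi from Plancherel and 2 eta from the norm
   of [H]. *)
exists (4 * pi / eta); first by rewrite divr_gt0 ?mulr_gt0.
move=> s r a ur.
pose b x : R[i] := (ind x)%:C%C * cis (s * x).
have mb : cmeas b by apply: cmeasM; [exact: cmeas_real (Lint_meas Lind)|exact: cmeas_cis].
have bind x : cabs2 (b x) = ind x by rewrite cabs2M cabs2_cis mulr1 cabs2_real ind_sq.
have Lb : cLint b.
  by apply: cLint_cis; split; [exact: Lind|exact: Lint0].
pose H x := \sum_(j <- r) a j * b (x - xs j).
have LHj j : cLint (fun x => a j * b (x - xs j)) by exact: cLintZ (cLint_shift (- xs j) Lb).
have LH : cLint H by exact: (cLint_sum (F := fun j x => a j * b (x - xs j))).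
have indj x j k : j != k -> ind (x - xs j) * ind (x - xs k) = 0.
  move=> jk; have := sep j k jk; rewrite /ind.
  case: (boolP (_ && _)) => [/andP[u1 u2]|]; last by rewrite mul0r.
  case: (boolP (_ && _)) => [/andP[v1 v2]|]; last by rewrite mulr0.
  by rewrite leNgt ltr_norml => /negP[]; apply/andP; split; lra.
have Hsq x : cabs2 (H x) = \sum_(j <- r) cabs2 (a j) * ind (x - xs j).
  have [/hasP[j jr /eqP ij]|/hasPn none] := boolP (has (fun j => ind (x - xs j) == 1) r).
    have other k : k != j -> ind (x - xs k) = 0.
      by move=> kj; have := indj x _ _ kj; rewrite ij mulr1.
    have bz k : k != j -> b (x - xs k) = 0.
      by move=> kj; apply: cabs2_eq0; rewrite bind other.
    rewrite /H (bigD1_seq j)//= big1 => [|k kj]; last by rewrite bz ?mulr0.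
    rewrite addr0 (bigD1_seq j)//= big1 => [|k kj]; last by rewrite other ?mulr0.
    by rewrite addr0 cabs2M bind.
  have z k : k \in r -> ind (x - xs k) = 0.
    by move=> kr; case: (ind01 (x - xs k)) => // e; have := none k kr; rewrite e eqxx.
  rewrite /H big_seq big1 => [|k kr].
    rewrite cabs20 big_seq big1// => k kr.
    by rewrite z// mulr0.
  by rewrite (cabs2_eq0 (z := b _)) ?mulr0// bind z.
have LHsq : Lint (fun x => \sum_(j <- r) cabs2 (a j) * ind (x - xs j)).
  apply: (Lint_sum (f := fun j x => cabs2 (a j) * ind (x - xs j))) => j _.
  exact: LintZ (Lint_shift (- xs j) Lind).
have SH : sL2 H.
  by apply: (sL2_le (cLint_meas LH) LHsq) => x; rewrite Hsq.
have nH : n2 H = 2 * eta * \sum_(j <- r) cabs2 (a j).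
  rewrite /n2 (eq_Int Hsq) (Int_sum (f := fun j x => cabs2 (a j) * ind (x - xs j))).
    rewrite mulr_sumr; apply: eq_bigr => j _.
    by rewrite (IntZ _ (Lint_shift (- xs j) Lind)) (Int_shift (- xs j) Lind) Iind mulrC.
  by move=> j _; exact: LintZ (Lint_shift (- xs j) Lind).
have [STH ETH] := plancherel LH SH.
have TH t : T H (- t) = esumc r a (fun j => - xs j) t * T b (- t).
  rewrite (T_sum (F := fun j x => a j * b (x - xs j))) => [|j _]; last exact: LHj.
  rewrite /esumc mulr_suml; apply: eq_bigr => j _.
  rewrite (TZ _ _ (cLint_shift (- xs j) Lb)) T_shift// mulrA; congr (_ * cis _ * _); ring.
have Tb t : `|t - s| <= pi -> eta <= Re (T b (- t)).
  move=> ts; have -> : Re (T b (- t)) = \int[mu]_x Re (b x * cis (- t * x)) by [].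
  have -> : eta = \int[mu]_x (2^-1 * ind x) by rewrite IntZ// Iind; field.
  apply: Int_le; first exact: LintZ.
    by have [] := cLint_cis (- t) Lb.
  move=> x.
  have -> : Re (b x * cis (- t * x)) = ind x * cos ((s - t) * x).
    have -> : b x * cis (- t * x) = (ind x)%:C%C * cis ((s - t) * x).
      by rewrite mulrBl cisD /b -mulNr mulrA.
    by rewrite ReM /= mul0r subr0.
  rewrite mulrC.
  case: (boolP ((- eta <= x) && (x < eta))) => xe; last first.
    by rewrite /ind (negbTE xe) !mul0r.
  rewrite ler_wpM2l//; apply: le_trans (cos_ge1B _).
  rewrite normrM; have xn : `|x| <= eta.
    by move/andP: xe => [x1 x2]; rewrite ler_norml x1 ltW.
  have : `|s - t| * `|x| <= pi * eta by apply: ler_pM => //; rewrite distrC.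
  move: eta_pi; move: (pi) => p; lra.
have key t : cabs2 (win s (esumc r a (fun j => - xs j)) t) <= eta ^- 2 * cabs2 (T H (- t)).
  rewrite cabs2_win; case: ifP => ts; last by rewrite mul0r mulr_ge0 ?cabs2_ge0 ?invr_ge0 ?sqr_ge0.
  rewrite mul1r ler_pdivlMl ?exprn_gt0// TH cabs2M mulrC ler_wpM2l ?cabs2_ge0//.
  apply: le_trans (Re_sqr_le _); have := Tb t ts; move: (Re _) => q hq.
  by rewrite lerXn2r// nnegrE ltW// (lt_le_trans eta0).
have [_ Lopp] := sL2_opp STH.
apply: (@le_trans _ _ (\int[mu]_t (eta ^- 2 * cabs2 (T H (- t))))).
  apply: Int_le => //; last exact: LintZ.
  by have [_] := sL2_win_esumc s r a (fun j => - xs j).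
rewrite (IntZ _ Lopp) -/(n2 (fun t => T H (- t))) (n2_opp STH) ETH nH.
rewrite le_eqVlt; apply/orP; left; apply/eqP; move: (\sum_(j <- r) _) => q.
by move: (pi) => p; field; rewrite gt_eqF.
Qed.

End Bessel.

(** * Finite sums of shifts *)

Section Amalgam.
Variable R : realType.
Local Notation mu := (@lebesgue_measure R).
Implicit Types (z w : R[i]) (f g h : R -> R[i]).

(** The indices summed by [psum], as a list, so that estimates over arbitrary finite index lists
    apply to partial sums. *)
Definition rint (N : nat) : seq int := [seq (i%:Z - N%:Z) | i <- iota 0 (2 * N).+1].

Lemma rint_uniq N : uniq (rint N).
Proof.
rewrite map_inj_uniq ?iota_uniq// => i j /eqP.
by rewrite (inj_eq (addIr _)) eqz_nat => /eqP.
Qed.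

Lemma mem_rint N (k : int) : (`|k| <= N)%N -> k \in rint N.
Proof.
move=> kN; apply/mapP; exists (absz (k + N%:Z)%R).
  by rewrite mem_iota; lia.
lia.
Qed.

Lemma sub_rint (r : seq int) : exists N0, forall N, (N0 <= N)%N -> {subset r <= rint N}.
Proof.
elim: r => [|k r [N0 h]]; first by exists 0%N.
exists (maxn `|k|%N N0) => N; rewrite geq_max => /andP[h1 h2] j.
by rewrite inE => /orP[/eqP ->|]; [exact: mem_rint|exact: h].
Qed.

(** Half-open periods, so that each point lies in exactly one; [torus] is the one with k = 0. *)
Definition tor (k : int) (t : R) : bool := (- pi <= t - 2 * pi * k%:~R) && (t - 2 * pi * k%:~R < pi).
Definition cellidx (t : R) : int := Num.floor ((t + pi) / (2 * pi)).

Lemma torE k t : tor k t = (k == cellidx t).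
Proof.
have P0 := twopi_gt0 R.
apply/idP/eqP => [/andP[h1 h2]|->].
  apply/esym/floor_def; rewrite ler_pdivlMr// ltr_pdivrMr// intrD mulrDl mul1r mulrC.
  by apply/andP; split; lra.
have := floor_itv ((t + pi) / (2 * pi)); rewrite -/(cellidx t) => /andP[h1 h2].
move: h1 h2; rewrite ler_pdivlMr// ltr_pdivrMr// intrD mulrDl mul1r mulrC => h1 h2.
by apply/andP; split; lra.
Qed.

Lemma Lint_tor k : Lint (fun t => (tor k t)%:R).
Proof.
have p0 := pi_gt0 R.
have [L _] := @Int_indic_itvco R (- pi) pi ltac:(lra).
by have := Lint_shift (- (2 * pi * k%:~R)) L.
Qed.

Lemma tor_win k t : tor k t -> `|t - 2 * pi * k%:~R| <= pi.
Proof. by move=> /andP[h1 h2]; rewrite ler_norml h1 ltW. Qed.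

Lemma ge0_ae_Int_le (f b : R -> R) : measurable_fun [set: R] f -> (forall x, 0 <= f x) ->
  Lint b -> (forall x, 0 <= b x) -> (\forall x \ae mu, f x <= b x) ->
  Lint f /\ \int[mu]_x f x <= \int[mu]_x b x.
Proof.
move=> mf f0 Lb b0 fb.
have h : (\int[mu]_x (f x)%:E <= (\int[mu]_x b x)%:E)%E.
  rewrite -Lint_EFin//; apply: ae_ge0_le_integral => //.
  - by move=> x _; rewrite lee_fin.
  - exact/measurable_EFinP.
  - by move=> x _; rewrite lee_fin.
  - exact: (measurable_int mu Lb).
  - by apply: (ae_mp _ fb) => x ? _; rewrite lee_fin.
have Lf : Lint f by apply: ge0_Lint => //; exact: le_lt_trans h (ltry _).
by split => //; rewrite -lee_fin -Lint_EFin.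
Qed.

(** Duality between the amalgams W(L_oo, l_1) and W(L_1, l_oo): [M] bounds [h] on each period and
    [Q] bounds the mass of [q] on each window. Finitely many periods are summed, and Fatou passes to
    the whole line. *)
Lemma amalgam_bound (h q : R -> R) (M : int -> R) (W Q : R) :
  measurable_fun [set: R] h -> (forall t, 0 <= h t) ->
  measurable_fun [set: R] q -> (forall t, 0 <= q t) -> 0 <= Q ->
  (forall k, 0 <= M k) -> (forall k, \forall t \ae mu, tor k t -> h t <= M k) ->
  (forall r, uniq r -> \sum_(k <- r) M k <= W) ->
  (forall k : int, Lint (fun t => (if `|t - 2 * pi * k%:~R| <= pi then 1 else 0) * q t) /\
     \int[mu]_t ((if `|t - 2 * pi * k%:~R| <= pi then 1 else 0) * q t) <= Q) ->
  Lint (fun t => h t * q t) /\ \int[mu]_t (h t * q t) <= W * Q.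
Proof.
move=> mh h0 mq q0 Q0 M0 hM MW hq.
pose phi k t := (tor k t)%:R * (h t * q t).
have phi0 k t : 0 <= phi k t by rewrite /phi !mulr_ge0.
have Lphi k : Lint (phi k) /\ \int[mu]_t phi k t <= M k * Q.
  have [Lq Iq] := hq k.
  have [|||||L I] := @ge0_ae_Int_le (phi k) (fun t => M k * ((if `|t - 2 * pi * k%:~R| <= pi then 1 else 0) * q t)).
  - by apply: measurable_funM; [exact: Lint_meas (Lint_tor k)|exact: measurable_funM].
  - exact: phi0.
  - exact: LintZ.
  - by move=> t; rewrite !mulr_ge0//; case: ifP.
  - apply: (ae_mp _ (hM k)) => t ht; rewrite /phi.
    case: (boolP (tor k t)) => kt; last by rewrite mul0r !mulr_ge0//; case: ifP.
    by rewrite (tor_win kt) !mul1r ler_wpM2r// ht.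
  split => //; apply: (le_trans I); rewrite (IntZ _ Lq).
  by rewrite ler_wpM2l.
pose F n t := \sum_(k <- rint n) phi k t.
have LF n : Lint (F n).
  by apply: (Lint_sum (f := phi)) => k _; have [] := Lphi k.
have F0 n t : 0 <= F n t by apply: sumr_ge0.
have cF t : F n t @[n --> \oo] --> h t * q t.
  apply: cvg_near_cst; near=> n.
  have kn : cellidx t \in rint n.
    by apply: mem_rint; near: n; exact: nbhs_infty_ge.
  rewrite /F (bigD1_seq (cellidx t) kn (rint_uniq n)) /=.
  rewrite /phi torE eqxx mul1r big1 ?addr0// => k kt.
  by rewrite torE (negbTE kt) mul0r.
apply: (Int_fatou LF F0 cF) => n.
rewrite /F (Int_sum (f := phi)); last by move=> k _; have [] := Lphi k.
apply: (@le_trans _ _ (\sum_(k <- rint n) M k * Q)).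
  by apply: ler_sum => k _; have [] := Lphi k.
by rewrite -mulr_suml ler_wpM2r// MW// rint_uniq.
Unshelve. all: by end_near. Qed.

(** Intersect the conull sets of the bounds L + 1/(n+1), of which there are countably many. *)
Lemma ess_supP (A : set R) (u : R -> R) (L : R) : ess_sup_on A u = L%:E ->
  \forall x \ae mu, A x -> u x <= L.
Proof.
move=> e.
have key n : \forall x \ae mu, A x -> u x <= L + n.+1%:R^-1.
  have : (ess_sup_on A u < (L + n.+1%:R^-1)%:E)%E by rewrite e lte_fin ltrDl.
  move=> /ereal_inf_lt[M hM ML].
  apply: (ae_mp _ hM) => x h Ax; rewrite -lee_fin.
  exact: le_trans (h Ax) (ltW ML).
apply: (ae_mp _ (ae_foralln key)) => x h Ax.
apply/ler_addgt0Pl => eps eps0.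
have := h (Num.truncn eps^-1) Ax => /le_trans; apply.
rewrite addrC lerD2r -[leRHS]invrK lef_pV2 ?posrE ?invr_gt0//.
exact/ltW/truncnS_gt.
Qed.

Lemma ess_sup_ge0 (u : R -> R) : (forall x, 0 <= u x) -> (0 <= ess_sup_on (@torus R) u)%E.
Proof.
move=> u0; apply: le_ereal_inf_tmp => M hM; rewrite leNgt; apply/negP => M0.
have p0 := pi_gt0 R.
have [x [x1 x2 hx]] := @ae_exists_itv R _ (- pi) 0 ltac:(lra) hM.
have tx : torus x by rewrite /torus/=; apply/andP; split; lra.
by have := le_lt_trans (hx tx) M0; rewrite lte_fin ltNge u0.
Qed.

(** Fixes one representative of the transform for which nonnegativity and boundedness hold at every
    point. The last clause is the amalgam bound with the decomposition into periods hidden. *)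
Theorem fourier_amalgam (psi : R -> R[i]) : A1 psi -> A2 psi ->
  exists (G : R -> R) (W m : R), [/\ 0 < m, 0 <= W, Lint G & forall t, 0 <= G t <= W] /\
  [/\ \forall t \ae mu, `|t - 0| <= pi -> m <= G t,
   \forall x \ae mu, psi x = ksc (T (fun t => (G t)%:C%C)) x &
   forall (q : R -> R) (Q : R), measurable_fun [set: R] q -> (forall t, 0 <= q t) -> 0 <= Q ->
    (forall s : R, Lint (fun t => (if `|t - s| <= pi then 1 else 0) * q t) /\
      \int[mu]_t ((if `|t - s| <= pi then 1 else 0) * q t) <= Q) ->
    Lint (fun t => G t * q t) /\ \int[mu]_t (G t * q t) <= W * Q].
Proof.
move=> [L2psi pd] [g [Fg [Wfin inf_pos _]]].
have [/isL2P Sg _] := Fg; have [mg Lg2] := Sg.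
pose L k := Linf_T_shift g k.
have cm0 z : 0 <= cmod z by exact: sqrtr_ge0.
have L0 k : (0 <= L k)%E by exact: ess_sup_ge0.
have sumL r : uniq r -> (\sum_(k <- r) L k <= Wnorm g)%E.
  move=> ur; apply: esum_ge; exists [set` r].
    by split => //; exact: finite_seq.
  by rewrite -fsbig_seq.
have LW k : (L k <= Wnorm g)%E by have := sumL [:: k] isT; rewrite big_seq1.
have Lfin k : L k = (fine (L k))%:E.
  by rewrite fineK// ge0_fin_numE// (le_lt_trans (LW k)).
pose M k : R := fine (L k).
have Wf : Wnorm g = (fine (Wnorm g))%:E.
  by rewrite fineK// ge0_fin_numE// (le_trans (L0 0) (LW 0)).
pose W : R := fine (Wnorm g).
have M0 k : 0 <= M k by rewrite fine_ge0.
have MW r : uniq r -> \sum_(k <- r) M k <= W.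
  move=> ur; rewrite -lee_fin -Wf -sumEFin.
  by under eq_bigr do rewrite -Lfin; exact: sumL.
have MW1 k : M k <= W by have := MW [:: k] isT; rewrite big_seq1.
have W0 : 0 <= W by exact: le_trans (M0 0) (MW1 0).
have gM k : \forall t \ae mu, tor k t -> cmod (g t) <= M k.
  have h := ae_shift (- (2 * pi * k%:~R)) (ess_supP (Lfin k)).
  by apply: (ae_mp _ h) => t ht kt; have := ht kt; rewrite subrK.
have gMall : \forall t \ae mu, forall k, tor k t -> cmod (g t) <= M k.
  have h1 := ae_foralln (fun n => gM (Posz n)); have h2 := ae_foralln (fun n => gM (Negz n)).
  by apply: (ae_mp2 _ h1 h2) => t a b [n|n]; [exact: a|exact: b].
have gW : \forall t \ae mu, cabs2 (g t) <= W ^+ 2.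
  apply: (ae_mp _ gMall) => t ht.
  have := ht (cellidx t); rewrite torE eqxx => /(_ isT) h.
  rewrite -[cabs2 _]sqr_sqrtr ?cabs2_ge0//; rewrite lerXn2r ?nnegrE ?cm0//.
  exact: le_trans h (MW1 _).
(* Large values, which occur only on a null set, are replaced by 0, so that the bound holds
   everywhere as [fourier_ge0] requires. *)
pose g1 t : R[i] := if cabs2 (g t) <= W ^+ 2 then g t else 0.
have gg1 : \forall t \ae mu, g t = g1 t.
  by apply: (ae_mp _ gW) => t h; rewrite /g1 h.
have mc : measurable_fun [set: R] (fun t => cabs2 (g t) <= W ^+ 2).
  by apply: measurable_fun_ler => //; exact: measurable_cabs2.
have mg1 : cmeas g1 := cmeas_if mc mg.
have g1W t : cabs2 (g1 t) <= W ^+ 2.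
  by rewrite /g1; case: ifP => // _; rewrite cabs20 sqr_ge0.
have Re_cmod z : `|Re z| <= cmod z.
  by rewrite -sqrtr_sqr ler_wsqrtr// Re_sqr_le.
have Im_cmod z : `|Im z| <= cmod z.
  by rewrite -sqrtr_sqr ler_wsqrtr// Im_sqr_le.
(* The amalgam bound with q = 1 will make [g1] integrable. *)
have win1 k : Lint (fun t : R => (if `|t - 2 * pi * k%:~R| <= pi then 1 else 0) * 1) /\
    \int[mu]_t ((if `|t - 2 * pi * k%:~R| <= pi then 1 else 0) * 1) <= \int[mu]_t (if `|t| <= @pi R then 1 else 0 : R).
  have L1 := Lint_win1 (2 * pi * k%:~R : R).
  split; first by apply: eq_Lint L1 => t; rewrite mulr1.
  rewrite -(Int_shift (- (2 * pi * k%:~R)) (Lint_ball (@pi R))) le_eqVlt; apply/orP; left; apply/eqP.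
  by apply: eq_Int => t; rewrite mulr1.
have I0 : 0 <= \int[mu]_t (if `|t| <= @pi R then 1 else 0 : R) by apply: Int_ge0 => t; case: ifP.
have Lg1 : cLint g1.
  have [m1 m2] := mg1.
  split.
    have mh : measurable_fun [set: R] (fun t => `|Re (g1 t)|) by exact: measurableT_comp.
    have [||L1 _] := amalgam_bound mh (fun _ => normr_ge0 _) (measurable_cst (1 : R)) _ I0 M0 _ MW win1.
    - by move=> t; exact: ler01.
    - move=> k; apply: (ae_mp2 _ (gM k) gg1) => t a e kt; rewrite -e.
      exact: le_trans (Re_cmod _) (a kt).
    by apply: (Lint_le m1 _ L1) => t; rewrite mulr1.
  have mh : measurable_fun [set: R] (fun t => `|Im (g1 t)|) by exact: measurableT_comp.
  have [||L1 _] := amalgam_bound mh (fun _ => normr_ge0 _) (measurable_cst (1 : R)) _ I0 M0 _ MW win1.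
  - by move=> t; exact: ler01.
  - move=> k; apply: (ae_mp2 _ (gM k) gg1) => t a e kt; rewrite -e.
    exact: le_trans (Im_cmod _) (a kt).
  by apply: (Lint_le m2 _ L1) => t; rewrite mulr1.
have [Fg1 _] := is_fourier_ae L2psi Fg mg1 gg1.
have h1 := fourier_inversion L2psi Fg1 Lg1.
have hpos := fourier_ge0 pd Lg1 g1W h1.
pose G t := Num.max 0 (Re (g1 t)).
have mG : measurable_fun [set: R] G by apply: measurable_maxr => //; case: mg1.
have GW t : 0 <= G t <= W.
  rewrite /G le_max lexx/= ge_max W0/= (le_trans (ler_norm _))// (le_trans (Re_cmod _))//.
  by rewrite -[W]ger0_norm// -sqrtr_sqr ler_wsqrtr.
have LG : Lint G.
  apply: (Lint_le mG _ (Lint_norm Lg1.1)) => t.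
  by rewrite ger0_norm ?(andP (GW t)).1// /G ge_max normr_ge0 ler_norm.
have Gg : \forall t \ae mu, g t = (G t)%:C%C.
  apply: (ae_mp2 _ gg1 hpos) => t -> [a b]; rewrite /G; apply: cplx_ext => //=.
  by rewrite max_r.
have [FG _] := is_fourier_ae L2psi Fg (cmeas_real mG) Gg.
have [m m0 hm] : exists2 m, 0 < m & \forall t \ae mu, torus t -> m <= cmod (g t).
  move: inf_pos => /ereal_sup_gt[x hx x0].
  have [m m0 mx] : exists2 m : R, 0 < m & (m%:E <= x)%E.
    (* The extended real [x] may be +oo; then 1 serves as lower bound. *)
    by case: x hx x0 => [m|_ _|//]; [rewrite lte_fin => _ m0; exists m|exists 1 => //; rewrite leey].
  exists m => //; apply: (ae_mp _ hx) => t ht tt.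
  by rewrite -lee_fin; exact: le_trans mx (ht tt).
have cmodG t : g t = (G t)%:C%C -> cmod (g t) = G t.
  by move=> ->; rewrite /cmod cabs2_real sqrtr_sqr ger0_norm// (andP (GW t)).1.
(* [torus] excludes the endpoint pi, which the closed window contains; one point is a null set. *)
have npi : \forall t \ae mu, t != pi :> R.
  exists [set pi]; split; [exact: measurable_set1|exact: lebesgue_measure_set1|].
  by move=> t /= /negP; rewrite negbK => /eqP.
exists G, W, m; split; first by split.
split.
- apply: (ae_mp2 _ (ae_mp2 _ hm npi : \forall t \ae mu, `|t - 0| <= pi -> m <= cmod (g t)) Gg).
    by move=> t a e tp; rewrite -(cmodG t e); exact: a.
  move=> t a np; rewrite subr0 ler_norml => /andP[t1 t2]; apply: a.
  by rewrite /torus/= t1 lt_neqAle np t2.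
- exact: fourier_inversion L2psi FG (conj LG (Lint0 R)).
- move=> q Q mq q0 Q0 hq.
  apply: (amalgam_bound mG _ mq q0 Q0 M0 _ MW) => //.
  + by move=> t; exact: (andP (GW t)).1.
  + move=> k; apply: (ae_mp2 _ (gM k) Gg) => t a e kt.
    by rewrite -(cmodG t e); exact: a.
Qed.

End Amalgam.

(** * Norm and sampling estimates for finite sums of shifts *)

Section FiniteSums.
Variable R : realType.
Local Notation mu := (@lebesgue_measure R).
Implicit Types (z w : R[i]) (f h : R -> R[i]) (r s : seq int) (a b : int -> R[i]).

Variables (xs : int -> R) (G : R -> R) (W m K B : R).
Hypotheses (m0 : 0 < m) (W0 : 0 <= W) (LG : Lint G) (GW : forall t, 0 <= G t <= W).
Hypothesis Gm : \forall t \ae mu, `|t - 0| <= pi -> m <= G t.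
Hypothesis Gq : forall (q : R -> R) (Q : R), measurable_fun [set: R] q ->
  (forall t, 0 <= q t) -> 0 <= Q ->
  (forall s : R, Lint (fun t => (if `|t - s| <= pi then 1 else 0) * q t) /\
    \int[mu]_t ((if `|t - s| <= pi then 1 else 0) * q t) <= Q) ->
  Lint (fun t => G t * q t) /\ \int[mu]_t (G t * q t) <= W * Q.
Hypotheses (K0 : 0 < K) (B0 : 0 < B).

Definition expsum r a := esumc r a (fun j => - xs j).
Definition mass r a : R := \sum_(j <- r) cabs2 (a j).

Hypothesis lower : forall r a, uniq r -> mass r a <= K * n2 (win 0 (expsum r a)).
Hypothesis upper : forall (u : R) r a, uniq r -> n2 (win u (expsum r a)) <= B * mass r a.

Definition Gc (t : R) : R[i] := (G t)%:C%C.
(** Built from the continuous representative in place of [psi], so that its values at points are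
    determined by [G]. *)
Definition synth r a (x : R) : R[i] := \sum_(j <- r) a j * ksc (T Gc) (x - xs j).

Lemma mass_ge0 r a : 0 <= mass r a.
Proof. by apply: sumr_ge0 => j _; exact: cabs2_ge0. Qed.

Lemma G_ge0 t : 0 <= G t. Proof. by case/andP: (GW t). Qed.
Lemma G_le t : G t <= W. Proof. by case/andP: (GW t). Qed.

Lemma cLint_Gc : cLint Gc. Proof. by split; [exact: LG|exact: Lint0]. Qed.

Lemma cmeas_expsum r a : cmeas (expsum r a). Proof. exact: cmeas_esumc. Qed.

(** The amalgam clause with q = |E|^2, whose mass on a window the upper Riesz bound controls
    uniformly in the centre. *)
Lemma energy_upper r a : uniq r ->
  Lint (fun t => G t * cabs2 (expsum r a t)) /\
  \int[mu]_t (G t * cabs2 (expsum r a t)) <= W * B * mass r a.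
Proof.
move=> ur; rewrite -mulrA; apply: Gq.
- exact: measurable_cabs2 (cmeas_expsum r a).
- by move=> t; exact: cabs2_ge0.
- by rewrite mulr_ge0 ?mass_ge0// ltW.
move=> s; have [_ L] := sL2_win_esumc s r a (fun j => - xs j).
have e t : cabs2 (win s (expsum r a) t) = (if `|t - s| <= pi then 1 else 0) * cabs2 (expsum r a t).
  exact: cabs2_win.
by split; [exact: eq_Lint e L|rewrite -(eq_Int e); exact: upper].
Qed.

(** Keep only the window around 0, where G >= m; elsewhere the integrand is nonnegative. *)
Lemma energy_lower r a : uniq r -> m / K * mass r a <= \int[mu]_t (G t * cabs2 (expsum r a t)).
Proof.
move=> ur; have [L _] := energy_upper a ur.
have [_ Lw] := sL2_win_esumc 0 r a (fun j => - xs j).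
apply: (@le_trans _ _ (m * n2 (win 0 (expsum r a)))).
  by rewrite -mulrA ler_wpM2l ?(ltW m0)// ler_pdivrMl//; exact: lower.
rewrite /n2 -(IntZ _ Lw).
have [|||||_ h] := @ge0_ae_Int_le R (fun t => m * cabs2 (win 0 (expsum r a) t)) (fun t => G t * cabs2 (expsum r a t)) => //.
- exact: Lint_meas (LintZ m Lw).
- by move=> t; rewrite mulr_ge0 ?cabs2_ge0// ltW.
- by move=> t; rewrite mulr_ge0 ?cabs2_ge0// G_ge0.
apply: (ae_mp _ Gm) => t ht; rewrite cabs2_win; case: ifP => tp.
  by rewrite mul1r ler_wpM2r ?cabs2_ge0// ht.
by rewrite mul0r mulr0 mulr_ge0 ?cabs2_ge0// G_ge0.
Qed.

Lemma cLint_GE r a : cLint (fun t => Gc t * expsum r a t).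
Proof. by apply: (cLint_bdd cLint_Gc (cmeas_expsum r a)) => t; exact: esumc_bound. Qed.

Lemma cabs2_GE r a t : cabs2 (Gc t * expsum r a t) = G t * (G t * cabs2 (expsum r a t)).
Proof. by rewrite cabs2M cabs2_real expr2 mulrA. Qed.

Lemma sL2_GE r a : uniq r -> sL2 (fun t => Gc t * expsum r a t).
Proof.
move=> ur; have [L _] := energy_upper a ur.
apply: (sL2_le (cLint_meas (cLint_GE r a)) (LintZ W L)) => t.
by rewrite cabs2_GE ler_wpM2r ?G_le// mulr_ge0 ?G_ge0 ?cabs2_ge0.
Qed.

Lemma synthE r a x : synth r a x = ksc (T (fun t => Gc t * expsum r a t)) x.
Proof.
rewrite /synth /ksc.
have e t : Gc t * expsum r a t = \sum_(j <- r) a j * (Gc t * cis (- xs j * t)).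
  by rewrite /expsum /esumc mulr_sumr; apply: eq_bigr => j _; rewrite mulrCA.
rewrite (funext e) (T_sum (F := fun j t => a j * (Gc t * cis (- xs j * t)))) => [|j _]; last first.
  exact/cLintZ/cLint_cis/cLint_Gc.
rewrite mulr_sumr; apply: eq_bigr => j _.
rewrite (TZ _ _ (cLint_cis _ cLint_Gc)) T_modulation addrC mulrCA.
by congr (_ * (_ * T _ _)); rewrite addrC.
Qed.

Lemma synth_plancherel r a : uniq r -> sL2 (synth r a) /\
  n2 (synth r a) = \int[mu]_t (G t * (G t * cabs2 (expsum r a t))).
Proof.
move=> ur; have [S E] := plancherel (cLint_GE r a) (sL2_GE a ur).
rewrite (funext (synthE r a)); split; first exact: sL2Z.
rewrite (n2Z _ S) E cabs2_real mulrA ksqrtK mul1r.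
by apply: eq_Int => t; exact: cabs2_GE.
Qed.

Lemma synth_upper r a : uniq r -> n2 (synth r a) <= W ^+ 2 * B * mass r a.
Proof.
move=> ur; have [S ->] := synth_plancherel a ur; have [L I] := energy_upper a ur.
have LS := sL2_GE a ur.
apply: (@le_trans _ _ (W * \int[mu]_t (G t * cabs2 (expsum r a t)))).
  rewrite -(IntZ _ L); apply: Int_le; [|exact: LintZ|].
    by case: LS => _; apply: eq_Lint => t; exact: cabs2_GE.
  by move=> t; rewrite ler_wpM2r ?G_le// mulr_ge0 ?G_ge0 ?cabs2_ge0.
by rewrite expr2 -!mulrA ler_wpM2l// mulrA.
Qed.

Lemma synth_lower r a : uniq r -> m ^+ 2 / K * mass r a <= n2 (synth r a).
Proof.
move=> ur; have [S ->] := synth_plancherel a ur.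
have [_ Lw] := sL2_win_esumc 0 r a (fun j => - xs j).
have LS : Lint (fun t => G t * (G t * cabs2 (expsum r a t))).
  by have [_] := sL2_GE a ur; apply: eq_Lint => t; exact: cabs2_GE.
apply: (@le_trans _ _ (m ^+ 2 * n2 (win 0 (expsum r a)))).
  by rewrite -mulrA ler_wpM2l ?sqr_ge0// ler_pdivrMl//; exact: lower.
rewrite /n2 -(IntZ _ Lw).
have [|||||_ h] := @ge0_ae_Int_le R (fun t => m ^+ 2 * cabs2 (win 0 (expsum r a) t))
  (fun t => G t * (G t * cabs2 (expsum r a t))) => //.
- exact: Lint_meas (LintZ _ Lw).
- by move=> t; rewrite mulr_ge0 ?cabs2_ge0// sqr_ge0.
- by move=> t; rewrite !mulr_ge0 ?cabs2_ge0// G_ge0.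
apply: (ae_mp _ Gm) => t ht; rewrite cabs2_win; case: ifP => tp.
  rewrite mul1r expr2 -mulrA; have mG := ht tp.
  apply: ler_pM => //; first exact: ltW.
    by rewrite mulr_ge0 ?cabs2_ge0// ltW.
  by rewrite ler_wpM2r ?cabs2_ge0.
by rewrite mul0r mulr0 !mulr_ge0 ?cabs2_ge0// G_ge0.
Qed.

(** The real part of the Hermitian form with weight [G]. *)
Definition cross (F F' : R -> R[i]) : R :=
  \int[mu]_t (G t * (Re (F t) * Re (F' t) + Im (F t) * Im (F' t))).

Lemma cross_AMGM (F F' : R -> R[i]) (tau : R) : cmeas F -> cmeas F' ->
  Lint (fun t => G t * cabs2 (F t)) -> Lint (fun t => G t * cabs2 (F' t)) -> 0 < tau ->
  2 * `|cross F F'| <= tau * \int[mu]_t (G t * cabs2 (F t)) +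
    tau^-1 * \int[mu]_t (G t * cabs2 (F' t)).
Proof.
move=> [m1 m2] [m1' m2'] L1 L2 tau0.
have ti : 0 < tau^-1 by rewrite invr_gt0.
pose u t := G t * (Re (F t) * Re (F' t) + Im (F t) * Im (F' t)).
have bd t : 2 * `|u t| <= tau * (G t * cabs2 (F t)) + tau^-1 * (G t * cabs2 (F' t)).
  rewrite normrM (ger0_norm (G_ge0 t)).
  have -> : tau * (G t * cabs2 (F t)) + tau^-1 * (G t * cabs2 (F' t)) =
    G t * (tau * cabs2 (F t) + tau^-1 * cabs2 (F' t)) by ring.
  rewrite mulrCA ler_wpM2l ?G_ge0//.
  set c := Re _ * _ + _; set p := F t; set q := F' t.
  have h1 : 0 <= tau^-1 * ((tau * Re p - Re q) ^+ 2 + (tau * Im p - Im q) ^+ 2).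
    by rewrite mulr_ge0 ?addr_ge0 ?sqr_ge0// ltW.
  have h2 : 0 <= tau^-1 * ((tau * Re p + Re q) ^+ 2 + (tau * Im p + Im q) ^+ 2).
    by rewrite mulr_ge0 ?addr_ge0 ?sqr_ge0// ltW.
  have e1 : tau^-1 * ((tau * Re p - Re q) ^+ 2 + (tau * Im p - Im q) ^+ 2) =
    tau * cabs2 p + tau^-1 * cabs2 q - 2 * c.
    by rewrite !cabs2E /c; field; rewrite gt_eqF.
  have e2 : tau^-1 * ((tau * Re p + Re q) ^+ 2 + (tau * Im p + Im q) ^+ 2) =
    tau * cabs2 p + tau^-1 * cabs2 q + 2 * c.
    by rewrite !cabs2E /c; field; rewrite gt_eqF.
  by case: (ger0P c) => _; lra.
have mu_ : measurable_fun [set: R] u.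
  apply: measurable_funM; first exact: Lint_meas LG.
  by apply: measurable_funD; exact: measurable_funM.
have LB : Lint (fun t => tau * (G t * cabs2 (F t)) + tau^-1 * (G t * cabs2 (F' t))).
  by apply: LintD; exact: LintZ.
have Lu : Lint u.
  by apply: (Lint_le mu_ _ LB) => t; have := bd t; have := normr_ge0 (u t); lra.
rewrite -(IntZ _ L1) -(IntZ _ L2) -IntD; [|exact: LintZ|exact: LintZ].
apply: (@le_trans _ _ (\int[mu]_t (2 * `|u t|))).
  by rewrite (IntZ _ (Lint_norm Lu)) ler_wpM2l//; exact: Int_norm.
by apply: Int_le => //; exact/LintZ/Lint_norm.
Qed.

(** The identity behind both sampling estimates: the nodes enter only through the differences x_k -
    x_j, so [quadratic_T] applies with the frequencies - x_j. *)
Lemma sample_cross r s a b :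
  Re (\sum_(k <- s) (b k)^*%C * synth r a (xs k)) = ksqrt R * cross (expsum r a) (expsum s b).
Proof.
have -> : \sum_(k <- s) (b k)^*%C * synth r a (xs k) =
    (ksqrt R)%:C%C * \sum_(j <- r) \sum_(k <- s) a j * (b k)^*%C * T Gc (- xs j - - xs k).
  rewrite exchange_big/= mulr_sumr; apply: eq_bigr => k _.
  rewrite /synth !mulr_sumr; apply: eq_bigr => j _.
  by rewrite /ksc opprK (addrC (- xs j)); ring.
rewrite (quadratic_T r s a b (fun j => - xs j) cLint_Gc) ReM /= mul0r subr0; congr (_ * _).
apply: eq_Int => t; rewrite /Gc !ReImE /=; ring.
Qed.

(** [X] stands on both sides because samples get tested against themselves. The chosen [tau] makes
    its occurrence on the right at most [X], which the factor 2 on the left absorbs. *)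
Lemma absorb (X U V : R) : 0 <= U -> 0 <= V -> 0 <= X ->
  (forall tau, 0 < tau -> 2 * X <= ksqrt R * (tau * U + tau^-1 * (V * X))) ->
  X <= ksqrt R * (ksqrt R * V + 1) * U.
Proof.
move=> U0 V0 X0 h; have k0 := ksqrt_gt0 R.
pose tau := ksqrt R * V + 1.
have tau0 : 0 < tau by rewrite ltr_wpDl// mulr_ge0// ltW.
have := h tau tau0; rewrite -/tau.
have h2 : ksqrt R * (tau^-1 * (V * X)) <= X.
  have -> : ksqrt R * (tau^-1 * (V * X)) = tau^-1 * (ksqrt R * V) * X by ring.
  by rewrite ler_piMl// ler_pdivrMl// mulr1 /tau lerDl.
rewrite mulrDr mulrA; lra.
Qed.

Definition c_sample : R := ksqrt R * (ksqrt R * (W * B) + 1) * (W * B).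

Lemma sample_upper r s a : uniq r -> uniq s ->
  \sum_(k <- s) cabs2 (synth r a (xs k)) <= c_sample * mass r a.
Proof.
move=> ur us; set X := \sum_(k <- s) _.
(* Testing against the samples themselves makes both the pairing and the mass of [b] equal to
   [X]. *)
pose b k := synth r a (xs k).
have X0 : 0 <= X by apply: sumr_ge0 => k _; exact: cabs2_ge0.
have [L1 I1] := energy_upper a ur; have [L2 I2] := energy_upper b us.
have WB : 0 <= W * B by rewrite mulr_ge0// ltW.
rewrite /c_sample -mulrA; apply: absorb => //; first by rewrite mulr_ge0// mass_ge0.
move=> tau tau0.
have XE : X = ksqrt R * cross (expsum r a) (expsum s b).
  rewrite -sample_cross Re_sum; apply: eq_bigr => k _.
  by rewrite /b cabs2E !ReImE; ring.
have k0 := ksqrt_gt0 R.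
have := cross_AMGM (cmeas_expsum r a) (cmeas_expsum s b) L1 L2 tau0.
have : X <= ksqrt R * `|cross (expsum r a) (expsum s b)|.
  by rewrite {1}XE ler_wpM2l ?(ltW k0)// ler_norm.
have h1 : tau * \int[mu]_t (G t * cabs2 (expsum r a t)) <= tau * (W * B * mass r a).
  by rewrite ler_wpM2l// ltW.
have h2 : tau^-1 * \int[mu]_t (G t * cabs2 (expsum s b t)) <= tau^-1 * (W * B * X).
  by rewrite ler_wpM2l// invr_ge0 ltW.
move=> hX hc.
apply: (@le_trans _ _ (ksqrt R * (2 * `|cross (expsum r a) (expsum s b)|))); first by lra.
by rewrite ler_wpM2l ?(ltW k0)//; lra.
Qed.

Definition c_point : R := ksqrt R * (ksqrt R * (\int[mu]_t G t) + 1) * (W * B).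

(** The argument of [sample_upper] with a single exponential at an arbitrary point. It makes l_2
    convergence of coefficients imply uniform convergence of the sums, which carries the samples
    through the limit. *)
Lemma point_upper r a x : uniq r -> cabs2 (synth r a x) <= c_point * mass r a.
Proof.
move=> ur; set X := cabs2 _.
pose z := synth r a x.
have X0 : 0 <= X by exact: cabs2_ge0.
have [L1 I1] := energy_upper a ur.
have WB : 0 <= W * B by rewrite mulr_ge0// ltW.
have IG0 : 0 <= \int[mu]_t G t by apply: Int_ge0 => t; exact: G_ge0.
rewrite /c_point -mulrA; apply: absorb => //; first by rewrite mulr_ge0// mass_ge0.
move=> tau tau0.
pose F t := z * cis (- x * t).
have mF : cmeas F by apply: cmeasM; [exact: cmeas_cst|exact: cmeas_cis].
have FX t : cabs2 (F t) = X by rewrite cabs2M cabs2_cis mulr1.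
have L2 : Lint (fun t => G t * cabs2 (F t)).
  by apply: eq_Lint (LintZ X LG) => t; rewrite FX mulrC.
have I2 : \int[mu]_t (G t * cabs2 (F t)) = \int[mu]_t G t * X.
  by rewrite mulrC -(IntZ X LG); apply: eq_Int => t; rewrite FX mulrC.
have k0 := ksqrt_gt0 R.
have XE : X = ksqrt R * cross (expsum r a) F.
  have -> : X = Re (z^*%C * z) by rewrite /X cabs2E !ReImE; ring.
  have -> : z^*%C * z = (ksqrt R)%:C%C * (z^*%C * T (fun t => Gc t * expsum r a t) x).
    by rewrite {2}/z synthE /ksc; ring.
  rewrite ReM /= mul0r subr0; congr (_ * _).
  rewrite /T -(cIZ _ (cLint_cis _ (cLint_GE r a))) /=; apply: eq_Int => t.
  have -> : z^*%C * (Gc t * expsum r a t * cis (x * t)) = Gc t * (expsum r a t * (F t)^*%C).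
    by rewrite /F conjM conj_cis mulNr opprK; ring.
  by rewrite /Gc !ReImE /=; ring.
have hc := cross_AMGM (cmeas_expsum r a) mF L1 L2 tau0.
have hX : X <= ksqrt R * `|cross (expsum r a) F|.
  by rewrite {1}XE ler_wpM2l ?(ltW k0)// ler_norm.
have h1 : tau * \int[mu]_t (G t * cabs2 (expsum r a t)) <= tau * (W * B * mass r a).
  by rewrite ler_wpM2l// ltW.
rewrite I2 in hc.
apply: (@le_trans _ _ (ksqrt R * (2 * `|cross (expsum r a) F|))); first by lra.
by rewrite ler_wpM2l ?(ltW k0)//; lra.
Qed.

(** Test the samples against the coefficients: [energy_lower] bounds the pairing below by tau times
    the mass, and the arithmetic-geometric inequality with the same [tau] bounds it above, which
    leaves tau mass <= X / tau. *)
Lemma sample_lower r a : uniq r ->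
  (ksqrt R * (m / K)) ^+ 2 * mass r a <= \sum_(k <- r) cabs2 (synth r a (xs k)).
Proof.
move=> ur; set X := \sum_(k <- r) _.
have k0 := ksqrt_gt0 R.
pose tau := ksqrt R * (m / K).
have tau0 : 0 < tau by rewrite mulr_gt0// divr_gt0.
have h1 : tau * mass r a <= Re (\sum_(k <- r) (a k)^*%C * synth r a (xs k)).
  rewrite sample_cross /tau -mulrA ler_wpM2l ?(ltW k0)//.
  apply: (le_trans (energy_lower a ur)); rewrite le_eqVlt; apply/orP; left; apply/eqP.
  by apply: eq_Int => t; rewrite cabs2E !expr2.
have h2 : 2 * Re (\sum_(k <- r) (a k)^*%C * synth r a (xs k)) <= tau * mass r a + tau^-1 * X.
  rewrite Re_sum /mass /X !mulr_sumr -big_split/=; apply: ler_sum => k _.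
  set p := a k; set q := synth r a (xs k).
  have h : 0 <= tau^-1 * ((tau * Re p - Re q) ^+ 2 + (tau * Im p - Im q) ^+ 2).
    by rewrite mulr_ge0 ?addr_ge0 ?sqr_ge0 ?invr_ge0 ?(ltW tau0).
  have e : tau^-1 * ((tau * Re p - Re q) ^+ 2 + (tau * Im p - Im q) ^+ 2) =
    tau * cabs2 p + tau^-1 * cabs2 q - 2 * Re (p^*%C * q).
    by rewrite !cabs2E !ReImE; field; rewrite gt_eqF.
  move: h; rewrite e; lra.
have h3 : tau * mass r a <= tau^-1 * X by lra.
rewrite -/tau expr2 -mulrA.
apply: (@le_trans _ _ (tau * (tau^-1 * X))); first by rewrite ler_wpM2l// ltW.
by rewrite mulrA mulfV ?mul1r// gt_eqF.
Qed.

End FiniteSums.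

(** * Passage to the limit *)

Section Limits.
Variable R : realType.
Local Notation mu := (@lebesgue_measure R).
Implicit Types (r s : seq int) (a b : int -> R[i]).

Lemma rintP N (k : int) : k \in rint N -> (`|k| <= N)%N.
Proof. by case/mapP => i; rewrite mem_iota => hi ->; lia. Qed.

Lemma rint_mono N M : (N <= M)%N -> {subset rint N <= rint M}.
Proof. by move=> NM k /rintP h; apply: mem_rint; exact: leq_trans h NM. Qed.

Variables (k psi : R -> R[i]) (xs : int -> R) (C1 C2 C3 C4 C5 : R).
Hypotheses (ck1 : continuous (fun x => Re (k x))) (ck2 : continuous (fun x => Im (k x))).
Hypothesis mpsi : cmeas psi.
Hypothesis psik : \forall x \ae mu, psi x = k x.
Hypotheses (C1p : 0 < C1) (C2p : 0 < C2) (C3p : 0 < C3) (C4p : 0 < C4) (C5p : 0 < C5).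

(** [k] is the continuous representative of [psi]; the finite-sum estimates enter the limit argument
    as [P1] to [P5]. *)
Definition shiftsum r a (x : R) : R[i] := \sum_(j <- r) a j * k (x - xs j).

Hypothesis PL2 : forall r a, uniq r -> sL2 (shiftsum r a).
Hypothesis P1 : forall r a, uniq r -> mass r a <= C1 * n2 (shiftsum r a).
Hypothesis P2 : forall r a, uniq r -> n2 (shiftsum r a) <= C2 * mass r a.
Hypothesis P3 : forall r s a, uniq r -> uniq s ->
  \sum_(j <- s) cabs2 (shiftsum r a (xs j)) <= C3 * mass r a.
Hypothesis P4 : forall r a, uniq r ->
  mass r a <= C4 * \sum_(j <- r) cabs2 (shiftsum r a (xs j)).
Hypothesis P5 : forall r a x, uniq r -> cabs2 (shiftsum r a x) <= C5 * mass r a.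

Variables (c : int -> R[i]) (f : R -> R[i]).
Hypotheses (c2 : isl2 c) (cf : ccontinuous f) (sf : series_L2 psi xs c f).

Let L : R := fine (l2norm2 c).
Let S N : R := mass (rint N) c.
Let P N := shiftsum (rint N) c.

Lemma l2norm2_ge0 a : (0 <= l2norm2 a)%E.
Proof. by apply: esum_ge0 => j _; rewrite lee_fin cabs2_ge0. Qed.

Let LE : l2norm2 c = L%:E.
Proof. by rewrite /L fineK// ge0_fin_numE// l2norm2_ge0. Qed.

Let mass_le r : uniq r -> mass r c <= L.
Proof. by move=> ur; rewrite -lee_fin -LE; exact: l2norm2_ge. Qed.

Let S_le N : S N <= L. Proof. exact/mass_le/rint_uniq. Qed.

Lemma mass_sub r s a : uniq r -> uniq s -> {subset r <= s} -> mass r a <= mass s a.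
Proof.
move=> ur us rs.
have e : \sum_(i <- r) cabs2 (a i) = \sum_(i <- [seq i <- s | i \in r]) cabs2 (a i).
  apply: perm_big; apply: uniq_perm; rewrite ?filter_uniq// => j.
  by rewrite mem_filter; case: (boolP (j \in r)) => // /rs ->.
rewrite /mass [leRHS](bigID (mem r))/= -[X in _ <= X + _]big_filter.
by rewrite e lerDl sumr_ge0// => j _; exact: cabs2_ge0.
Qed.

Let S_tail e : 0 < e -> exists N0, forall N, (N0 <= N)%N -> L - S N <= e.
Proof.
move=> e0.
have [r [ur hr]] : exists r, uniq r /\ L - e < mass r c.
  apply: contrapT => hn.
  have : (l2norm2 c <= (L - e)%:E)%E.
    apply: l2norm2_le => r ur; rewrite leNgt; apply/negP => h.
    by apply: hn; exists r.
  by rewrite LE lee_fin; lra.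
have [N0 h0] := sub_rint r.
exists N0 => N NN.
have := mass_sub c ur (rint_uniq N) (h0 N NN); rewrite -/(S N); lra.
Qed.

(** The difference of two partial sums is again a finite sum, so [P3] and [P5] apply to it with the
    mass of the block between them. *)
Let Pdiff N M : (N <= M)%N -> exists r, [/\ uniq r, mass r c = S M - S N &
  forall x, P M x - P N x = shiftsum r c x].
Proof.
move=> NM; exists [seq j <- rint M | j \notin rint N].
have key (V : zmodType) (F : int -> V) : \sum_(j <- rint M) F j =
    \sum_(j <- rint N) F j + \sum_(j <- [seq j <- rint M | j \notin rint N]) F j.
  rewrite (bigID (mem (rint N)))/= -big_filter -[X in _ + X = _]big_filter; congr (_ + _).
  apply: perm_big; apply: uniq_perm; rewrite ?filter_uniq ?rint_uniq// => j.
  by rewrite mem_filter; case: (boolP (j \in rint N)) => // /(rint_mono NM) ->.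
split; first by rewrite filter_uniq// rint_uniq.
  by rewrite /S /mass (key R (fun j => cabs2 (c j))) addrAC subrr add0r.
by move=> x; rewrite /P /shiftsum (key _ (fun j => c j * k (x - xs j))) addrAC subrr add0r.
Qed.

Let cP r a : continuous (fun x => Re (shiftsum r a x)) /\ continuous (fun x => Im (shiftsum r a x)).
Proof.
elim: r => [|j r [ih1 ih2]].
  have e x : shiftsum [::] a x = 0 by rewrite /shiftsum big_nil.
  by split => x; under eq_fun do rewrite e; exact: cvg_cst.
have e x : shiftsum (j :: r) a x = a j * k (x - xs j) + shiftsum r a x.
  by rewrite /shiftsum big_cons.
have sh x : (x' - xs j) @[x' --> x] --> x - xs j.
  by apply: cvgB; [exact: cvg_id|exact: cvg_cst].
have k1 x : Re (k (x' - xs j)) @[x' --> x] --> Re (k (x - xs j)).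
  by apply: (cvg_comp _ (fun y => Re (k y)) (sh x)); exact: ck1.
have k2 x : Im (k (x' - xs j)) @[x' --> x] --> Im (k (x - xs j)).
  by apply: (cvg_comp _ (fun y => Im (k y)) (sh x)); exact: ck2.
split => x.
  under eq_fun do rewrite e ReD ReM; rewrite /=.
  apply: cvgD; last exact: ih1.
  by apply: cvgB; apply: cvgM; [exact: cvg_cst|exact: k1|exact: cvg_cst|exact: k2].
under eq_fun do rewrite e ImD ImM; rewrite /=.
apply: cvgD; last exact: ih2.
by apply: cvgD; apply: cvgM; [exact: cvg_cst|exact: k2|exact: cvg_cst|exact: k1].
Qed.

Let mf : cmeas f.
Proof. by case: cf => h1 h2; split; exact: continuous_measurable_fun. Qed.

Let psumE N x : psum psi xs c N x = \sum_(j <- rint N) c j * psi (x - xs j).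
Proof.
rewrite /psum /rint big_map.
by rewrite -(big_mkord xpredT (fun i => c (i%:Z - N%:Z) * psi (x - xs (i%:Z - N%:Z)))) /index_iota subn0.
Qed.

Let psum_ae N : \forall x \ae mu, psum psi xs c N x = P N x.
Proof.
have h r : \forall x \ae mu, \sum_(j <- r) c j * psi (x - xs j) = shiftsum r c x.
  elim: r => [|j r ih].
    by apply: aeW => x; rewrite /shiftsum !big_nil.
  apply: (ae_mp2 _ ih (ae_shift (- xs j) psik)) => x e1 e2.
  by rewrite /shiftsum !big_cons e2; congr (_ + _).
by apply: (ae_mp _ (h (rint N))) => x e; rewrite psumE.
Qed.

Let mP N : cmeas (P N). Proof. by have [] := PL2 c (rint_uniq N). Qed.

Let m_psum N : cmeas (psum psi xs c N).
Proof.
rewrite (funext (psumE N)); apply: (cmeas_sum (F := fun j x => c j * psi (x - xs j))) => j _.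
apply: cmeasM; first exact: cmeas_cst.
by case: mpsi => m1 m2; split; [exact: (measurableT_comp m1 (measurable_shift (- xs j)))|
  exact: (measurableT_comp m2 (measurable_shift (- xs j)))].
Qed.

(** The series is written with [psi] itself; the a.e. identity transfers its L_2 convergence to
    [P N]. *)
Let D_small e : 0 < e -> exists N0, forall N, (N0 <= N)%N ->
  sL2 (fun x => P N x - f x) /\ n2 (fun x => P N x - f x) < e.
Proof.
move=> e0; have [N0 h] := sf e0; exists N0 => N NN.
have mq : cmeas (fun x => psum psi xs c N x - f x) by exact: cmeasB.
have Sq : sL2 (fun x => psum psi xs c N x - f x).
  split => //; apply: ge0_Lint; first exact: measurable_cabs2.
    by move=> x; exact: cabs2_ge0.
  exact: lt_trans (h N NN) (ltry _).
have md : cmeas (fun x => P N x - f x) by exact: cmeasB.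
have [|||||Ld Id] := @ge0_ae_Int_le R (fun x => cabs2 (P N x - f x))
    (fun x => cabs2 (psum psi xs c N x - f x)).
- exact: measurable_cabs2.
- by move=> x; exact: cabs2_ge0.
- by case: Sq.
- by move=> x; exact: cabs2_ge0.
- by apply: (ae_mp _ (psum_ae N)) => x ->.
split => //; apply: (le_lt_trans Id).
by have := h N NN; rewrite (L2norm2E Sq).
Qed.

Lemma limit_sL2 : sL2 f.
Proof.
have [N0 h] := D_small ltr01; have [S1 _] := h N0 (leqnn _).
rewrite (_ : f = fun x => P N0 x - (P N0 x - f x)).
  by apply: sL2B => //; exact: PL2 (rint_uniq N0).
by apply/funext => x; rewrite subKr.
Qed.

(** For M >= N, [P5] controls P M - P N at every point by the tail. If the bound failed at [x], by
    continuity it would fail on an interval, where |P M - f| would stay away from 0 for all such M,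
    against L_2 convergence. *)
Let point_err N x : cabs2 (P N x - f x) <= 2 * C5 * (L - S N).
Proof.
rewrite leNgt; apply/negP => wx.
pose w y := cabs2 (P N y - f y) - 2 * C5 * (L - S N).
have wx0 : 0 < w x by rewrite subr_gt0.
have cw : w y @[y --> x] --> w x.
  apply: cvgB; last exact: cvg_cst.
  have [p1 p2] := cP (rint N) c; have [f1 f2] := cf.
  have r1 : Re (P N y - f y) @[y --> x] --> Re (P N x - f x).
    by under eq_fun do rewrite ReB; rewrite ReB; apply: cvgB; [exact: p1|exact: f1].
  have r2 : Im (P N y - f y) @[y --> x] --> Im (P N x - f x).
    by under eq_fun do rewrite ImB; rewrite ImB; apply: cvgB; [exact: p2|exact: f2].
  by rewrite /cabs2; apply: cvgD; apply: cvgM.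
have wx2 : 0 < w x / 2 by rewrite divr_gt0.
move/cvgrPdist_lt: cw => /(_ _ wx2)/nbhs_ballP[d /= d0 hd].
(* On [x, x + d/2) the excess is at least w x / 2, so its integral d w x / 4 is a lower bound for 2
   n2 (P M - f); this threshold contradicts it. *)
have e0 : 0 < d * w x / 8 by rewrite divr_gt0// mulr_gt0.
have [M0 hM] := D_small e0.
pose M := maxn N M0.
have [[_ LD] ID] := hM M (leq_maxr _ _).
have [r [ur mr Er]] := Pdiff (leq_maxl N M0 : (N <= M)%N).
have [|LI II] := @Int_indic_itvco R x (x + d / 2); first by rewrite lerDl divr_ge0// ltW.
have cmp : \int[mu]_y (w x / 2 * ((x <= y) && (y < x + d / 2))%:R) <=
    \int[mu]_y (2 * cabs2 (P M y - f y)).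
  apply: Int_le; [exact: LintZ|exact: LintZ|move=> y].
  case: (boolP ((x <= y) && _)) => [/andP[y1 y2]|_]; last first.
    by rewrite mulr0 mulr_ge0// cabs2_ge0.
  have hb : ball x d y.
    have d2 : d = d / 2 + d / 2 by field.
    by rewrite /ball/= ltr_norml; apply/andP; split; lra.
  have wy : w x / 2 <= w y.
    by have := hd y hb => /ltr_normlP[_]; lra.
  have b1 : cabs2 (P N y - f y) <= 2 * cabs2 (P M y - f y) + 2 * cabs2 (P M y - P N y).
    have -> : P N y - f y = (P M y - f y) - (P M y - P N y) by ring.
    exact: cabs2B_le.
  have b2 : cabs2 (P M y - P N y) <= C5 * (L - S N).
    rewrite Er (le_trans (P5 c y ur))// mr ler_wpM2l ?(ltW C5p)//.
    by have := S_le M; lra.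
  by rewrite mulr1; move: wy b1 b2; rewrite /w; lra.
move: cmp; rewrite (IntZ _ LI) (IntZ _ LD) II -/(n2 _).
have -> : x + d / 2 - x = d / 2 by ring.
by move: ID; lra.
Qed.

(** Proportional to the number of nodes, hence meant for a fixed list [s] while [N] grows. *)
Let sum_err s N : \sum_(j <- s) cabs2 (P N (xs j) - f (xs j)) <=
  (size s)%:R * (2 * C5 * (L - S N)).
Proof.
elim: s => [|j s ih]; first by rewrite big_nil mul0r.
by rewrite big_cons /= -natr1 mulrDl mul1r addrC lerD.
Qed.

Let sum_split s (u v : int -> R[i]) : \sum_(j <- s) cabs2 (u j - v j) <=
  2 * \sum_(j <- s) cabs2 (u j) + 2 * \sum_(j <- s) cabs2 (v j).
Proof.
by rewrite !mulr_sumr -big_split; apply: ler_sum => j _; exact: cabs2B_le.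
Qed.

(** Lets the estimates below carry their errors as a fixed multiple of [e]. *)
Let le_eps (u v D : R) : 0 <= D -> (forall e, 0 < e -> u <= v + D * e) -> u <= v.
Proof.
move=> D0 h; apply/ler_addgt0Pl => e e0.
have D1 : 0 < D + 1 by rewrite ltr_wpDl.
apply: (le_trans (h (e / (D + 1)) (divr_gt0 e0 D1))).
by rewrite addrC lerD2r mulrCA ler_piMr ?(ltW e0)// ler_pdivrMr// mul1r lerDl.
Qed.

Lemma limit_L2_lower : L <= 2 * C1 * n2 f.
Proof.
apply: (@le_eps _ _ (1 + 2 * C1)); first by rewrite addr_ge0// mulr_ge0// ltW.
move=> e e0; have [N1 h1] := S_tail e0; have [N2 h2] := D_small e0.
pose N := maxn N1 N2.
have t1 := h1 N (leq_maxl _ _); have [SD t2] := h2 N (leq_maxr _ _).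
have t3 := P1 c (rint_uniq N).
have t4 := n2D_le limit_sL2 SD.
have E : n2 (fun x => f x + (P N x - f x)) = n2 (P N).
  by apply: eq_Int => x; rewrite addrC subrK.
rewrite E in t4.
have t5 : C1 * n2 (P N) <= C1 * (2 * n2 f + 2 * e).
  by rewrite ler_wpM2l ?(ltW C1p)//; lra.
by move: t1 t3 t5; rewrite -/(S N) -/(P N); lra.
Qed.

Lemma limit_L2_upper : n2 f <= 2 * C2 * L.
Proof.
apply: (@le_eps _ _ 2) => // e e0; have [N h2] := D_small e0.
have [SD t2] := h2 N (leqnn _).
have t3 := P2 c (rint_uniq N).
have t4 := n2B_le (PL2 c (rint_uniq N)) SD.
have E : n2 (fun x => shiftsum (rint N) c x - (P N x - f x)) = n2 f.
  by apply: eq_Int => x; rewrite subKr.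
rewrite E in t4.
have t5 : C2 * S N <= C2 * L by rewrite ler_wpM2l ?(ltW C2p)//; exact: S_le.
by move: t2 t3 t4 t5; rewrite -/(S N) -/(P N); lra.
Qed.

Lemma limit_sample_upper s : uniq s -> \sum_(j <- s) cabs2 (f (xs j)) <= 2 * C3 * L.
Proof.
move=> us; apply: (@le_eps _ _ (4 * (size s)%:R * C5)).
  by rewrite !mulr_ge0// ltW.
move=> e e0; have [N h] := S_tail e0; have t1 := h N (leqnn _).
have t2 := sum_split s (fun j => P N (xs j)) (fun j => P N (xs j) - f (xs j)).
have t3 := P3 c (rint_uniq N) us.
have t4 := sum_err s N.
have t5 : C3 * S N <= C3 * L by rewrite ler_wpM2l ?(ltW C3p)//; exact: S_le.
have t6 : (size s)%:R * (2 * C5 * (L - S N)) <= (size s)%:R * (2 * C5 * e).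
  by rewrite ler_wpM2l// ler_wpM2l// mulr_ge0// ltW.
have E : \sum_(j <- s) cabs2 (P N (xs j) - (P N (xs j) - f (xs j))) =
    \sum_(j <- s) cabs2 (f (xs j)).
  by apply: eq_bigr => j _; rewrite subKr.
rewrite E in t2.
by move: t2 t3 t4 t5 t6; rewrite -/(S N) -/(P N); lra.
Qed.

(** Free of the size of [s], as [limit_sample_lower] requires with s = rint N. Pass from [P N] to
    [P M] by [P3], then let M grow with [s] fixed, so that the bound proportional to the size
    disappears. *)
Let sample_err s N : uniq s ->
  \sum_(j <- s) cabs2 (P N (xs j) - f (xs j)) <= 2 * C3 * (L - S N).
Proof.
move=> us; apply: (@le_eps _ _ (4 * (size s)%:R * C5)).
  by rewrite !mulr_ge0// ltW.
move=> e e0; have [N0 h] := S_tail e0; pose M := maxn N N0.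
have t1 := h M (leq_maxr _ _).
have [r [ur mr Er]] := Pdiff (leq_maxl N N0 : (N <= M)%N).
have t2 := sum_split s (fun j => P M (xs j) - f (xs j)) (fun j => shiftsum r c (xs j)).
have t3 := P3 c ur us; rewrite mr in t3.
have t4 := sum_err s M.
have t5 : C3 * (S M - S N) <= C3 * (L - S N).
  by rewrite ler_wpM2l ?(ltW C3p)//; have := S_le M; lra.
have t6 : (size s)%:R * (2 * C5 * (L - S M)) <= (size s)%:R * (2 * C5 * e).
  by rewrite ler_wpM2l// ler_wpM2l// mulr_ge0// ltW.
have E : \sum_(j <- s) cabs2 (P M (xs j) - f (xs j) - shiftsum r c (xs j)) =
    \sum_(j <- s) cabs2 (P N (xs j) - f (xs j)).
  by apply: eq_bigr => j _; rewrite -Er; congr cabs2; ring.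
rewrite E in t2.
by move: t2 t3 t4 t5 t6; lra.
Qed.

(** [P4] compares the coefficients in [rint N] with samples at the same nodes, so the list grows
    together with N; this is where [sample_err] enters. *)
Lemma limit_sample_lower (F : R) :
  (forall s, uniq s -> \sum_(j <- s) cabs2 (f (xs j)) <= F) -> L <= 2 * C4 * F.
Proof.
move=> hF; apply: (@le_eps _ _ (1 + 4 * C3 * C4)).
  by rewrite addr_ge0// !mulr_ge0// ltW.
move=> e e0; have [N h] := S_tail e0; have t1 := h N (leqnn _).
have t2 := sum_split (rint N) (fun j => P N (xs j) - f (xs j)) (fun j => - f (xs j)).
have t3 := P4 c (rint_uniq N).
have t4 := sample_err N (rint_uniq N).
have t5 := hF _ (rint_uniq N).
have E : \sum_(j <- rint N) cabs2 (P N (xs j) - f (xs j) - - f (xs j)) =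
    \sum_(j <- rint N) cabs2 (P N (xs j)).
  by apply: eq_bigr => j _; rewrite opprK subrK.
have E' : \sum_(j <- rint N) cabs2 (- f (xs j)) = \sum_(j <- rint N) cabs2 (f (xs j)).
  by apply: eq_bigr => j _; rewrite cabs2N.
rewrite E E' in t2.
have t6 : C3 * (L - S N) <= C3 * e by rewrite ler_wpM2l// ltW.
have t7 : C4 * \sum_(j <- rint N) cabs2 (P N (xs j)) <= C4 * (2 * (2 * (C3 * e)) + 2 * F).
  by rewrite ler_wpM2l ?(ltW C4p)//; lra.
by move: t1 t3 t7; rewrite -/(S N) -/(P N); lra.
Qed.

End Limits.

Section Constants.
Variable R : realType.

Lemma sqrte_le_mul (C : R) (X Y : \bar R) : 0 < C -> (0 <= X)%E -> (X <= C%:E * Y)%E ->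
  (sqrte X <= (Num.sqrt C)%:E * sqrte Y)%E.
Proof.
move=> C0 X0 h; rewrite -[(Num.sqrt C)%:E]/(sqrte C%:E) -sqrteM; last by rewrite lee_fin ltW.
by rewrite lee_sqrt// (le_trans X0 h).
Qed.

Lemma sqrte_le_mulV (C : R) (X Y : \bar R) : 0 < C -> (0 <= X)%E -> (X <= C%:E * Y)%E ->
  (((Num.sqrt C)^-1)%:E * sqrte X <= sqrte Y)%E.
Proof.
by move=> C0 X0 h; rewrite lee_pdivrMl ?sqrtr_gt0//; exact: sqrte_le_mul.
Qed.

End Constants.

Theorem theorem3 (R : realType) (psi : R -> R[i]) (xs : int -> R) :
  A1 psi -> A2 psi -> CIS xs ->
  exists c1 c2 c3 c4 : R,
    [/\ 0 < c1, 0 < c2, 0 < c3 & 0 < c4] /\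
    forall (c : int -> R[i]) (f : R -> R[i]),
      isl2 c -> ccontinuous f -> series_L2 psi xs c f ->
      [/\ (c1%:E * l2norm c <= L2norm f)%E,
          (L2norm f <= c2%:E * l2norm c)%E,
          (c3%:E * l2norm (fun j => f (xs j)) <= l2norm c)%E &
          (l2norm c <= c4%:E * l2norm (fun j => f (xs j)))%E].
Proof.
move=> a1 a2 cis_xs.
have [G [W [m [[m0 W0 LG GW] [Gm psiG Gq]]]]] := fourier_amalgam a1 a2.
have [K K0 lower] := CIS_lower cis_xs.
have [d d0 sep] := separated_of_lower K0 lower.
have [B B0 upper] := bessel d0 sep.
have mpsi : cmeas psi by case: a1 => /isL2P[].
pose k := ksc (T (Gc G)).
have [ck1 ck2] := ccontinuous_ksc (cLint_Gc LG).
have WB : 0 <= W * B by rewrite mulr_ge0// ltW.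
have m2 : 0 < m ^+ 2 by rewrite exprn_gt0.
have k0 := ltW (ksqrt_gt0 R).
have I0 : 0 <= \int[lebesgue_measure]_t G t by apply: Int_ge0 => t; case/andP: (GW t).
have c_ge0 u : 0 <= u -> 0 <= ksqrt R * (ksqrt R * u + 1) * (W * B).
  by move=> u0; apply: mulr_ge0 => //; apply: mulr_ge0 => //; apply: addr_ge0 => //; exact: mulr_ge0.
have cs0 : 0 <= c_sample W B by exact: c_ge0.
have cp0 : 0 <= c_point G W B by exact: c_ge0.
(* [C1] and [C4] invert the lower bounds for finite sums; in the others the added 1 ensures
   positivity, since [W] comes only with W >= 0. *)
pose C1 := K / m ^+ 2; pose C2 := W ^+ 2 * B + 1; pose C3 := c_sample W B + 1.
pose C4 := ((ksqrt R * (m / K)) ^+ 2)^-1; pose C5 := c_point G W B + 1.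
have kmK : 0 < (ksqrt R * (m / K)) ^+ 2.
  by rewrite exprn_gt0// mulr_gt0 ?ksqrt_gt0// divr_gt0.
have C1p : 0 < C1 by rewrite divr_gt0.
have C2p : 0 < C2 by rewrite ltr_wpDl// mulr_ge0 ?sqr_ge0// ltW.
have C3p : 0 < C3 by rewrite ltr_wpDl.
have C4p : 0 < C4 by rewrite invr_gt0.
have C5p : 0 < C5 by rewrite ltr_wpDl.
have PL2 r a : uniq r -> sL2 (shiftsum k xs r a).
  by move=> ur; have [] := synth_plancherel LG GW Gq B0 upper a ur.
have P1 r a : uniq r -> mass r a <= C1 * n2 (shiftsum k xs r a).
  move=> ur; have := synth_lower m0 LG GW Gm Gq K0 B0 lower upper a ur.
  by rewrite -ler_pdivlMl ?divr_gt0// invf_div.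
have P2 r a : uniq r -> n2 (shiftsum k xs r a) <= C2 * mass r a.
  move=> ur; apply: (le_trans (synth_upper W0 LG GW Gq B0 upper a ur)).
  by rewrite ler_wpM2r ?mass_ge0// lerDl.
have P3 r s a : uniq r -> uniq s ->
    \sum_(j <- s) cabs2 (shiftsum k xs r a (xs j)) <= C3 * mass r a.
  move=> ur us; apply: (le_trans (sample_upper W0 LG GW Gq B0 upper a ur us)).
  by rewrite ler_wpM2r ?mass_ge0// lerDl.
have P4 r a : uniq r ->
    mass r a <= C4 * \sum_(j <- r) cabs2 (shiftsum k xs r a (xs j)).
  move=> ur; rewrite ler_pdivlMl//.
  exact: (sample_lower m0 LG GW Gm Gq K0 B0 lower upper a ur).
have P5 r a x : uniq r -> cabs2 (shiftsum k xs r a x) <= C5 * mass r a.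
  move=> ur; apply: (le_trans (point_upper W0 LG GW Gq B0 upper a x ur)).
  by rewrite ler_wpM2r ?mass_ge0// lerDl.
(* Square roots because the estimates concern squared norms; the factor 2 is the price of passing to
   the limit. *)
exists (Num.sqrt (2 * C1))^-1, (Num.sqrt (2 * C2)), (Num.sqrt (2 * C3))^-1, (Num.sqrt (2 * C4)).
split; first by split; rewrite ?invr_gt0 sqrtr_gt0 mulr_gt0.
move=> c f lc cf sf.
have LE : l2norm2 c = (fine (l2norm2 c))%:E by rewrite fineK// ge0_fin_numE// l2norm2_ge0.
have Sf := limit_sL2 mpsi psiG PL2 cf sf.
(* The samples are shown square-summable first, so that the last bound can be read between real
   numbers. *)
have Fle : (l2norm2 (fun j => f (xs j)) <= (2 * C3 * fine (l2norm2 c))%:E)%E.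
  by apply: l2norm2_le => s; exact: (limit_sample_upper ck1 ck2 mpsi psiG C3p C5p PL2 P3 P5 lc cf sf).
have FE : l2norm2 (fun j => f (xs j)) = (fine (l2norm2 (fun j => f (xs j))))%:E.
  by rewrite fineK// ge0_fin_numE ?l2norm2_ge0// (le_lt_trans Fle)// ltry.
have p2 (C : R) : 0 < C -> 0 < 2 * C by move=> C0; rewrite mulr_gt0.
rewrite /l2norm /L2norm; split.
- apply: (sqrte_le_mulV (p2 _ C1p) (l2norm2_ge0 c)).
  rewrite LE (L2norm2E Sf) -EFinM lee_fin.
  exact: (limit_L2_lower mpsi psiG C1p PL2 P1 lc cf sf).
- apply: (sqrte_le_mul (p2 _ C2p)); rewrite (L2norm2E Sf) ?lee_fin ?n2_ge0//.
  rewrite LE -EFinM lee_fin.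
  exact: (limit_L2_upper mpsi psiG C2p PL2 P2 lc cf sf).
- apply: (sqrte_le_mulV (p2 _ C3p) (l2norm2_ge0 _)).
  by rewrite LE -EFinM.
- apply: (sqrte_le_mul (p2 _ C4p) (l2norm2_ge0 c)).
  rewrite LE FE -EFinM lee_fin.
  apply: (limit_sample_lower ck1 ck2 mpsi psiG C3p C4p C5p PL2 P3 P4 P5 lc cf sf) => s us.
  by rewrite -lee_fin -FE; exact: (l2norm2_ge (fun j => f (xs j))).
Qed.
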